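(* Assume Assumptions 1 and 2 and Conditions 1--7 (all stated in the context). Then, whether or not the null hypothesis $H_0$ holds, as $n\to\infty$, \[ T_n-\sqrt{n}\,\Delta \xrightarrow{d} \mathcal N(0,\sigma^2), \qquad \sigma^2=(1,\mathbf h^\top\mathbf J^{-1})\,\boldsymbol\Sigma\,(1,\mathbf h^\top\mathbf J^{-1})^\top . \]
   Context: Data: $(Y_iR_i,R_i,\mathbf X_i)$, $i=1,\dots,n$, are i.i.d. copies of $(YR,R,\mathbf X)$, where $Y$ is an outcome (binary, discrete or continuous), $\mathbf X$ is a fully observed covariate vector, and $R\in\{0,1\}$ indicates that $Y$ is observed. $\mathbb E,\operatorname{Var},\Pr$ refer to the true joint distribution of $(RY,R,\mathbf X)$, with $F(\mathbf x)$ the marginal distribution function of $\mathbf X$ and $F_n$ its empirical distribution function. Let $r(\mathbf x)$ be a known $\mathbb R^m$-valued function. Null model: $H_0$: $\Pr(R=1\mid Y=y,\mathbf X=\mathbf x)=\{1+\exp(\alpha+\boldsymbol\beta^\top r(\mathbf x)+\gamma y)\}^{-1}$ for some $\alpha\in\mathbb R,\boldsymbol\beta\in\mathbb R^m,\gamma\in\mathbb R$; $H_A$: this propensity score is not of that form. Assumption 1: there is an instrumental variable (a component of $\mathbf X$ that affects the distribution of $Y$ but not $\Pr(R=1\mid Y,\mathbf X)$). Assumption 2: the conditional density/mass function of $Y$ given $\mathbf X=\mathbf x$, $R=1$ is $f(y\mid\mathbf x;\boldsymbol\xi)$ for a known parametric family with unknown $\boldsymbol\xi\in\mathbb R^p$.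 Let $\boldsymbol\theta=(\alpha,\boldsymbol\beta^\top,\gamma,\boldsymbol\xi^\top)^\top\in\mathbb R^{m+p+2}$, $c(\mathbf x;\gamma,\boldsymbol\xi)=\log\int e^{\gamma y}f(y\mid\mathbf x;\boldsymbol\xi)\,dy$, and $\pi(\mathbf x;\boldsymbol\theta)=[1+\exp\{\alpha+\boldsymbol\beta^\top r(\mathbf x)+c(\mathbf x;\gamma,\boldsymbol\xi)\}]^{-1}$. Define $\ell(y,\mathbf x,r;\boldsymbol\theta)=r\log f(y\mid\mathbf x;\boldsymbol\xi)+r\log\pi(\mathbf x;\boldsymbol\theta)+(1-r)\log\{1-\pi(\mathbf x;\boldsymbol\theta)\}$, $L(y,\mathbf x,r;\boldsymbol\theta)=e^{\ell(y,\mathbf x,r;\boldsymbol\theta)}$, $\psi=\partial\ell/\partial\boldsymbol\theta$, $\ell_n(\boldsymbol\theta)=\sum_i\ell(Y_i,\mathbf X_i,R_i;\boldsymbol\theta)$, $\hat{\boldsymbol\theta}=\arg\max_{\boldsymbol\theta}\ell_n(\boldsymbol\theta)$ and $\boldsymbol\theta^*=\arg\max_{\boldsymbol\theta}\mathbb E\,\ell(Y,\mathbf X,R;\boldsymbol\theta)$. Let $L_t(y,\mathbf x,r)$ be the true likelihood contribution of $(RY,R)$ given $\mathbf X=\mathbf x$. Let $H(\mathbf x,r;\boldsymbol\theta)=\{r-\pi(\mathbf x;\boldsymbol\theta)\}^2-\pi(\mathbf x;\boldsymbol\theta)\{1-\pi(\mathbf x;\boldsymbol\theta)\}$, $T_n=n^{-1/2}\sum_{i=1}^nH(\mathbf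 X_i,R_i;\hat{\boldsymbol\theta})$ and $\Delta=\mathbb E\{H(\mathbf X,R;\boldsymbol\theta^* )\}$. Let $Z(y,\mathbf x,r;\boldsymbol\theta)=(H(\mathbf x,r;\boldsymbol\theta),\psi(y,\mathbf x,r;\boldsymbol\theta)^\top)^\top$, $\mathbf J=-\mathbb E\{\partial^2\ell(Y,\mathbf X,R;\boldsymbol\theta^* )/\partial\boldsymbol\theta\partial\boldsymbol\theta^\top\}$, $\boldsymbol\Sigma=\operatorname{Var}\{Z(Y,\mathbf X,R;\boldsymbol\theta^* )\}$ and $\mathbf h=\mathbb E\{\partial H(\mathbf X,R;\boldsymbol\theta^* )/\partial\boldsymbol\theta\}$. Conditions: (1) $\boldsymbol\theta^*$ is the unique maximizer of $\mathbb E\,\ell_n(\boldsymbol\theta)$. (2) The parameter space $\Theta$ is compact and $\boldsymbol\theta^*$ is interior. (3) $\ell$ has continuous third-order partial derivatives in $\boldsymbol\theta$ for all $(y,\mathbf x,r)$. (4) $\mathbb E|\log L_t(Y,\mathbf X,R)|<\infty$, and for sufficiently small $\rho>0$, $\mathbb E[\log\{1+\sup_{\|\boldsymbol\theta'-\boldsymbol\theta\|<\rho}L(Y,\mathbf X,R;\boldsymbol\theta')\}]<\infty$ for all $\boldsymbol\theta\in\Theta$. (5) $\mathbf J$ has full rank and $\boldsymbol\Sigma$ is positive definite. (6) The entries of $\mathbf h$ exist and are finite. (7) There exist $\epsilon>0$ and $M(y,\mathbf x,r)$ with $\mathbb E M(Y,\mathbf X,R)<\infty$ such that for any components $\theta_1,\theta_2,\theta_3$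 of $\boldsymbol\theta$, $\sup_{\|\boldsymbol\theta-\boldsymbol\theta^*\|\le\epsilon}|\partial^3\ell/\partial\theta_1\partial\theta_2\partial\theta_3|\le M$ and $\sup_{\|\boldsymbol\theta-\boldsymbol\theta^*\|\le\epsilon}|\partial^2H/\partial\theta_1\partial\theta_2|\le M$. *)

(* Defs.v *)
From HB Require Import structures.
From mathcomp Require Import all_boot all_order all_algebra.
From mathcomp Require Import all_classical all_reals all_analysis.
Set Implicit Arguments.
Unset Strict Implicit.
Unset Printing Implicit Defensive.
Import Order.TTheory GRing.Theory Num.Theory.
Import numFieldNormedType.Exports.
Local Open Scope classical_set_scope.
Local Open Scope ring_scope.

Section defs.
Context {R : realType}.

Section param.
Variables m p : nat.
Notation D := (m + p).+2.
Definition alpha (th : 'rV[R]_D) : R := th ord0 (inord 0).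
Definition beta (th : 'rV[R]_D) : 'rV[R]_m := \row_(j < m) th ord0 (inord j.+1).
Definition gamma (th : 'rV[R]_D) : R := th ord0 (inord m.+1).
Definition xi (th : 'rV[R]_D) : 'rV[R]_p := \row_(j < p) th ord0 (inord (m.+2 + j)).
End param.

Definition pd {n} (j : 'I_n) (g : 'rV[R]_n -> R) : 'rV[R]_n -> R :=
  fun th => derive g th (delta_mx 0 j).

Definition C3_on {n} (U : set 'rV[R]_n) (g : 'rV[R]_n -> R) : Prop :=
  forall i j l : 'I_n,
    (forall th, U th ->
       [/\ derivable g th (delta_mx 0 i),
           derivable (pd i g) th (delta_mx 0 j),
           derivable (pd j (pd i g)) th (delta_mx 0 l) &
           {for th, continuous (pd l (pd j (pd i g)))}]).

Section model.
Variables (k m p : nat).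
Notation D := (m + p).+2.
Variable nu : {measure set R -> \bar R}.          (* dominating measure for Y *)
Variable f : 'rV[R]_p -> k.-tuple R -> R -> R.    (* f xi x y = f(y | x; xi) *)
Variable rr : k.-tuple R -> 'rV[R]_m.

Definition cfun (x : k.-tuple R) (th : 'rV[R]_D) : R :=
  ln (fine (\int[nu]_y ((expR (gamma th * y) * f (xi th) x y)%:E))%E).

Definition pifun (x : k.-tuple R) (th : 'rV[R]_D) : R :=
  (1 + expR (alpha th + (beta th *m (rr x)^T) ord0 ord0 + cfun x th))^-1.

Definition ell (y : R) (x : k.-tuple R) (r : R) (th : 'rV[R]_D) : R :=
  r * ln (f (xi th) x y) + r * ln (pifun x th) + (1 - r) * ln (1 - pifun x th).

Definition Lik y x r th : R := expR (ell y x r th).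

Definition Hfun (x : k.-tuple R) (r : R) (th : 'rV[R]_D) : R :=
  (r - pifun x th) ^+ 2 - pifun x th * (1 - pifun x th).

Definition psi y x r th : 'rV[R]_D := \row_(j < D) pd j (ell y x r) th.

Definition Zvec y x r th : 'rV[R]_(1 + D) :=
  row_mx (\row_(_ < 1) Hfun x r th) (psi y x r th).

Variables (d0 : measure_display) (T : measurableType d0) (P : probability T R).
Variables (Y0 R0 : T -> R) (X0 : T -> k.-tuple R).

Definition Eell (th : 'rV[R]_D) : \bar R :=
  (\int[P]_w (ell (R0 w * Y0 w) (X0 w) (R0 w) th)%:E)%E.

Definition Jmat (th : 'rV[R]_D) : 'M[R]_D :=
  \matrix_(i, j) - Rintegral P setT
     (fun w => pd i (pd j (ell (R0 w * Y0 w) (X0 w) (R0 w))) th).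

Definition Zw (th : 'rV[R]_D) (a : 'I_(1 + D)) (w : T) : R :=
  Zvec (R0 w * Y0 w) (X0 w) (R0 w) th ord0 a.

Definition Sigmat (th : 'rV[R]_D) : 'M[R]_(1 + D) :=
  \matrix_(a, b) (Rintegral P setT (fun w => Zw th a w * Zw th b w)
                  - Rintegral P setT (Zw th a) * Rintegral P setT (Zw th b)).

Definition hvec (th : 'rV[R]_D) : 'rV[R]_D :=
  \row_j Rintegral P setT (fun w => pd j (Hfun (X0 w) (R0 w)) th).

Definition Delta (th : 'rV[R]_D) : R :=
  Rintegral P setT (fun w => Hfun (X0 w) (R0 w) th).

Definition sigma2 (th : 'rV[R]_D) : R :=
  let w := row_mx (1 : 'M[R]_1) (hvec th *m invmx (Jmat th)) in
  (w *m Sigmat th *m w^T) ord0 ord0.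

End model.

Definition elln {k m p} (nu : {measure set R -> \bar R}) f rr
  {T : Type} (Ys Rs : nat -> T -> R) (Xs : nat -> T -> k.-tuple R)
  (n : nat) (w : T) (th : 'rV[R]_(m + p).+2) : R :=
  \sum_(i < n) ell nu f rr (Rs i w * Ys i w) (Xs i w) (Rs i w) th.

Definition Tstat {k m p} (nu : {measure set R -> \bar R}) f rr
  {T : Type} (Rs : nat -> T -> R) (Xs : nat -> T -> k.-tuple R)
  (thetahat : nat -> T -> 'rV[R]_(m + p).+2) (n : nat) (w : T) : R :=
  (Num.sqrt n%:R)^-1 *
    \sum_(i < n) Hfun (m:=m) (p:=p) nu f rr (Xs i w) (Rs i w) (thetahat n w).

Definition iid_copies {d0 d1} {T : measurableType d0} {S : measurableType d1}
  (P : probability T R) (O : nat -> T -> S) (O0 : T -> S) : Prop :=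
  [/\ measurable_fun setT O0, (forall i, measurable_fun setT (O i)) &
      forall (n : nat) (idx : 'I_n -> nat), injective idx ->
      forall A : 'I_n -> set S, (forall a, measurable (A a)) ->
      P (\bigcap_(a in [set: 'I_n]) (O (idx a) @^-1` A a)) =
      (\prod_(a < n) P (O0 @^-1` A a))%E].

Definition normal_cdf (s2 t : R) : R :=
  Rintegral (@lebesgue_measure R) [set x | x <= t] (normal_pdf 0 (Num.sqrt s2)).

(* convergence in distribution to N(0, s2) (whose cdf is continuous) *)
Definition cvg_in_dist_normal {d0} {T : measurableType d0} (P : probability T R)
  (S : nat -> T -> R) (s2 : R) : Prop :=
  forall t : R,
    (fun n => fine (P [set w | S n w <= t])) @ \oo --> normal_cdf s2 t.

(* log(1 + e) for the (nonnegative) extended real e, with log(1 + oo) = oo *)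
Definition log1p_e (e : \bar R) : \bar R :=
  match e with EFin r => (ln (1 + r))%:E | +oo%E => +oo%E | -oo%E => 0%E end.
End defs.

(* Main.v *)
(* The estimator is consistent by Wald's argument: E l is bounded away from its
   maximum near each parameter other than theta*, by Fatou's lemma applied to
   suprema of l over shrinking balls, and the compact set Theta minus a ball is
   covered by finitely many such neighbourhoods. Near theta* the score equation
   and T_n are expanded to first order, with a quadratic remainder whose constant
   is integrable by Condition 7; solving for the estimator shows that
   T_n - sqrt n Delta differs from n^(-1/2) times the sum of the influence
   functions H - Delta + h J^-1 psi by a term vanishing in probability. Only
   1 - pi = exp l(., x, 0) enters H, so H is as smooth as l.
   The central limit theorem comes from Lindeberg's replacement: the operators
   g |-> E g(. + X / sqrt n) and g |-> E g(. + N / sqrt n) commute, so that their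
   n-th powers are within n times their distance, which is o(1/n) on a smooth
   test function, here a logistic approximation of an indicator. *)
Require Import Defs.
From HB Require Import structures.
From mathcomp Require Import all_boot all_order all_algebra.
From mathcomp Require Import all_classical all_reals all_analysis.
From mathcomp Require Import measurable_realfun.
From mathcomp Require Import ring lra.
Import Order.TTheory GRing.Theory Num.Theory.
Import numFieldNormedType.Exports.
Local Open Scope classical_set_scope.
Local Open Scope ring_scope.

Set Implicit Arguments.
Unset Strict Implicit.
Unset Printing Implicit Defensive.

(** Two features of the hypotheses shape the proof. Smoothness is given by partial derivatives for
    each fixed observation, with a bound [M] that is integrable along the full data but not known to
    be measurable in the observation. So nothing is differentiated under the integral sign:
    integrals are compared through pointwise Taylor bounds, and [M] is replaced by the smallest
    constant in such a bound, a supremum over a dense sequence of increments and hence measurable.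
    Exceptional events need not be measurable either; their probability is bounded through
    measurable covers. Moreover [H] and the scores have only second moments. In the limit theorems a
    Taylor remainder is therefore kept as a minimum of two powers: the lower one gives a dominating
    function, the higher one pointwise convergence. The same replacement, with zero in place of the
    Gaussian, yields the weak law and a Chebyshev inequality, so that independence enters only
    through the identity between the mean of a function of an i.i.d. sum and an iterated
    operator. *)

Section expectation.
Context {d} {T : measurableType d} {R : realType}.
Variable P : probability T R.
Implicit Types f g : T -> R.

Definition L1 f := P.-integrable setT (EFin \o f).
Definition Ex f : R := Rintegral P setT f.
Definition Pr (A : set T) : R := fine (P A).

Lemma L1_measurable f : L1 f -> measurable_fun setT f.
Proof. by move=> /integrableP[/measurable_EFinP]. Qed.

Lemma L1_le f g : measurable_fun setT f -> L1 g -> (forall x, `|f x| <= g x) ->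
  L1 f.
Proof.
move=> mf ig fg; apply: (le_integrable _ _ _ ig) => //.
  exact/measurable_EFinP.
by move=> x _ /=; rewrite lee_fin (le_trans (fg x))// ler_norm.
Qed.

Lemma L1_cst c : L1 (fun=> c).
Proof. exact: finite_measure_integrable_cst. Qed.

Lemma L1_bounded f c : measurable_fun setT f -> (forall x, `|f x| <= c) -> L1 f.
Proof. by move=> mf fc; apply: (L1_le mf (L1_cst c)). Qed.

Lemma L1D f g : L1 f -> L1 g -> L1 (fun x => f x + g x).
Proof. by move=> lf lg; exact: (integrableD _ lf lg). Qed.

Lemma L1B f g : L1 f -> L1 g -> L1 (fun x => f x - g x).
Proof. by move=> lf lg; exact: (integrableB _ lf lg). Qed.

Lemma L1Z c f : L1 f -> L1 (fun x => c * f x).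
Proof. by move=> lf; exact: (integrableZl _ c lf). Qed.

Lemma L1_norm f : L1 f -> L1 (fun x => `|f x|).
Proof. by move=> lf; exact: (integrable_norm lf). Qed.

Lemma L1_sum (I : Type) (s : seq I) (F : I -> T -> R) :
  (forall i, L1 (F i)) -> L1 (fun x => \sum_(i <- s) F i x).
Proof.
move=> h; elim: s => [|i s ih].
  by under [X in L1 X]eq_fun do rewrite big_nil; exact: L1_cst.
by under [X in L1 X]eq_fun do rewrite big_cons; exact: L1D.
Qed.

Lemma Ex_cst c : Ex (fun=> c) = c.
Proof. by rewrite /Ex Rintegral_cst//= (probability_setT P) mulr1. Qed.

Lemma ExD f g : L1 f -> L1 g -> Ex (fun x => f x + g x) = Ex f + Ex g.
Proof. by move=> lf lg; rewrite /Ex RintegralD. Qed.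

Lemma ExB f g : L1 f -> L1 g -> Ex (fun x => f x - g x) = Ex f - Ex g.
Proof. by move=> lf lg; rewrite /Ex RintegralB. Qed.

Lemma ExZ c f : L1 f -> Ex (fun x => c * f x) = c * Ex f.
Proof. by move=> lf; rewrite /Ex RintegralZl. Qed.

Lemma eq_Ex f g : f =1 g -> Ex f = Ex g.
Proof. by move=> /funext ->. Qed.

Lemma Ex_le f g : L1 f -> L1 g -> (forall x, f x <= g x) -> Ex f <= Ex g.
Proof. by move=> lf lg fg; apply: le_Rintegral. Qed.

Lemma Ex_ge0 f : (forall x, 0 <= f x) -> 0 <= Ex f.
Proof. by move=> f0; apply: Rintegral_ge0. Qed.

Lemma norm_Ex f : L1 f -> `|Ex f| <= Ex (fun x => `|f x|).
Proof. by move=> lf; apply: le_normr_Rintegral. Qed.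

Lemma Ex_sum (I : Type) (s : seq I) (F : I -> T -> R) :
  (forall i, L1 (F i)) ->
  Ex (fun x => \sum_(i <- s) F i x) = \sum_(i <- s) Ex (F i).
Proof.
move=> h; elim: s => [|i s ih].
  by under eq_Ex do rewrite big_nil; rewrite Ex_cst big_nil.
under eq_Ex do rewrite big_cons.
by rewrite big_cons ExD ?ih//; exact: L1_sum.
Qed.

Lemma EFin_Ex f : L1 f -> (\int[P]_x (f x)%:E)%E = (Ex f)%:E.
Proof. by move=> lf; rewrite /Ex /Rintegral fineK//; exact: integrable_fin_num. Qed.

Lemma EFin_Pr A : measurable A -> P A = (Pr A)%:E.
Proof. by move=> mA; rewrite /Pr fineK//; exact: fin_num_measure. Qed.

Lemma Pr_ge0 A : 0 <= Pr A.
Proof. by rewrite fine_ge0. Qed.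

Lemma L1_indic A : measurable A -> L1 (\1_A).
Proof.
move=> mA; apply: (@L1_bounded _ 1); first exact: measurable_indic.
by move=> x; rewrite indicE ger0_norm; case: (_ \in _).
Qed.

Lemma Ex_indic A : measurable A -> Ex (\1_A) = Pr A.
Proof. by move=> mA; rewrite /Ex /Rintegral integral_indic// setIT. Qed.

Lemma le_Pr A B : measurable A -> measurable B -> A `<=` B -> Pr A <= Pr B.
Proof.
move=> mA mB AB; rewrite /Pr fine_le ?fin_num_measure//.
by apply: le_measure => //; rewrite inE.
Qed.

Lemma PrU A B : measurable A -> measurable B -> Pr (A `|` B) <= Pr A + Pr B.
Proof.
move=> mA mB; rewrite -lee_fin EFinD -!EFin_Pr//; last exact: measurableU.
exact: measureU2.
Qed.

Lemma Pr_le_Ex A f : measurable A -> L1 f -> (forall x, 0 <= f x) ->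
  (forall x, A x -> 1 <= f x) -> Pr A <= Ex f.
Proof.
move=> mA lf f0 f1; rewrite -Ex_indic//; apply: Ex_le => //.
  exact: L1_indic.
move=> x; rewrite indicE; case: (boolP (x \in A)) => [/set_mem/f1//|_]; exact: f0.
Qed.

Lemma Ex_le_Pr A f : measurable A -> L1 f -> (forall x, f x <= 1) ->
  (forall x, ~ A x -> f x <= 0) -> Ex f <= Pr A.
Proof.
move=> mA lf f1 f0; rewrite -Ex_indic//; apply: Ex_le => //.
  exact: L1_indic.
move=> x; rewrite indicE; case: (boolP (x \in A)) => [//|/negP xA].
by apply: f0 => Ax; apply: xA; rewrite inE.
Qed.

Lemma cvg_Ex (f_ : nat -> T -> R) f g :
  (forall n, measurable_fun setT (f_ n)) -> measurable_fun setT f -> L1 g ->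
  (forall n x, `|f_ n x| <= g x) -> (forall x, f_ ^~ x @ \oo --> f x) ->
  (fun n => Ex (f_ n)) @ \oo --> Ex f.
Proof.
move=> mf_ mf lg fg ff.
have [] := @dominated_convergence _ T R P setT measurableT (fun n => EFin \o f_ n)
  (EFin \o f) (EFin \o g).
- by move=> n; exact/measurable_EFinP.
- exact/measurable_EFinP.
- by apply: aeW => x _ /=; apply/fine_cvgP; split; [exact: nearW|exact: ff].
- exact: lg.
- by apply: aeW => x n _ /=; rewrite lee_fin.
move=> lf _ cv; rewrite /Ex /Rintegral.
apply: (fine_cvg (f := fun n => (\int[P]_x (EFin \o f_ n) x)%E)).
by rewrite fineK; [exact: cv|exact: integrable_fin_num].
Qed.

End expectation.

(** * Averaging a function over a random translation *)

Section translation_average.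
Context {d} {T : measurableType d} {R : realType} (P : probability T R).

(** Values in [0, 1] make every average integrable without any moment of the translation, and the
    class is stable under [avg]. *)
Definition unit_fun (g : R -> R) :=
  measurable_fun setT g /\ forall x, 0 <= g x <= 1.

(** The convolution operator of the law of [X]. Its n-th iterate is the mean of g(x + X_1 + ... +
    X_n) for i.i.d. copies of [X], which [Ex_iid_sum] proves below. *)
Definition avg (X : T -> R) (g : R -> R) (x : R) : R := Ex P (fun w => g (x + X w)).

Lemma unit_fun_L1 (X : T -> R) g x : measurable_fun setT X -> unit_fun g ->
  L1 P (fun w => g (x + X w)).
Proof.
move=> mX [mg g01]; apply: (@L1_bounded _ _ _ _ _ 1).
  by apply: measurableT_comp => //; exact: measurable_funD.
by move=> w; have /andP[g0 g1] := g01 (x + X w); rewrite ger0_norm.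
Qed.

Lemma L1_indicM_unit (E : set T) (X : T -> R) g x : measurable E ->
  measurable_fun setT X -> unit_fun g -> L1 P (fun w => \1_E w * g (x + X w)).
Proof.
move=> mE mX ug; apply: (L1_le _ (unit_fun_L1 x mX ug)).
  apply: measurable_funM; first exact: measurable_indic.
  exact: L1_measurable (unit_fun_L1 x mX ug).
move=> w; case: ug => _ /(_ (x + X w))/andP[g0 _].
by rewrite indicE; case: (_ \in _); rewrite ?mul1r ?mul0r ?normr0 ?ger0_norm.
Qed.

(** Measurability is the point: [avg X g] is a partial integral of a nonnegative function on a
    product space, so Tonelli applies. *)
Lemma avg_unit_fun X g : measurable_fun setT X -> unit_fun g -> unit_fun (avg X g).
Proof.
move=> mX ug; have [mg g01] := ug; split; last first.
  move=> x; apply/andP; split.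
    by apply: Ex_ge0 => w; have /andP[] := g01 (x + X w).
  rewrite -[leRHS](Ex_cst P); apply: Ex_le; [exact: unit_fun_L1|exact: L1_cst|].
  by move=> w; have /andP[] := g01 (x + X w).
apply/measurable_EFinP.
pose f (z : R * T) := (g (z.1 + X z.2))%:E.
rewrite (_ : EFin \o _ = fun x => \int[P]_w f (x, w))%E; last first.
  by apply/funext => x; rewrite /= -EFin_Ex//; exact: unit_fun_L1.
apply: (@measurable_fun_fubini_tonelli_F _ _ R T R P f) => //.
  apply/measurable_EFinP; apply: measurableT_comp => //.
  by apply: measurable_funD => //; apply: measurableT_comp.
by move=> z; rewrite /f lee_fin; have /andP[] := g01 (z.1 + X z.2).
Qed.

(** Contraction in the uniform norm: the error of one replacement is not amplified by the steps that
    follow. *)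
Lemma dist_avg X g h e : measurable_fun setT X -> unit_fun g -> unit_fun h ->
  (forall x, `|g x - h x| <= e) -> forall x, `|avg X g x - avg X h x| <= e.
Proof.
move=> mX ug uh gh x; rewrite /avg -ExB; try exact: unit_fun_L1.
have l : L1 P (fun w => g (x + X w) - h (x + X w)) by apply: L1B; exact: unit_fun_L1.
rewrite (le_trans (norm_Ex l))// -[leRHS](Ex_cst P).
apply: Ex_le => //; [exact: L1_norm|exact: L1_cst].
Qed.

Lemma iter_avg_unit_fun X n g : measurable_fun setT X -> unit_fun g ->
  unit_fun (iter n (avg X) g).
Proof. by move=> mX ug; elim: n => //= n ih; exact: avg_unit_fun. Qed.

End translation_average.

(** * Lindeberg's replacement for commuting operators *)

Section lindeberg.
Context {d1 d2} {T1 : measurableType d1} {T2 : measurableType d2} {R : realType}.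
Variables (P1 : probability T1 R) (P2 : probability T2 R).
Variables (X1 : T1 -> R) (X2 : T2 -> R).
Hypotheses (mX1 : measurable_fun setT X1) (mX2 : measurable_fun setT X2).

(** Translations commute, so this is the exchange of two integrals. *)
Lemma avgC g : unit_fun g ->
  avg P1 X1 (avg P2 X2 g) = avg P2 X2 (avg P1 X1 g).
Proof.
move=> ug; have [mg g01] := ug; apply/funext => x; apply: EFin_inj.
pose f (z : T1 * T2) := (g (x + X1 z.1 + X2 z.2))%:E.
rewrite -EFin_Ex; last by apply: unit_fun_L1 => //; exact: avg_unit_fun.
rewrite -[RHS]EFin_Ex; last by apply: unit_fun_L1 => //; exact: avg_unit_fun.
transitivity (\int[P1]_w1 \int[P2]_w2 f (w1, w2))%E.
  by apply: eq_integral => w1 _; rewrite -EFin_Ex//; exact: unit_fun_L1.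
rewrite fubini_tonelli//; last 2 first.
- apply/measurable_EFinP; apply: measurableT_comp => //.
  apply: measurable_funD; last exact: measurableT_comp.
  by apply: measurable_funD => //; exact: measurableT_comp.
- by move=> z; rewrite /f lee_fin; have /andP[] := g01 (x + X1 z.1 + X2 z.2).
apply: eq_integral => w2 _; rewrite -EFin_Ex; last exact: unit_fun_L1.
by apply: eq_integral => w1 _; rewrite /f /= addrAC.
Qed.

(* Lindeberg's replacement: the two operators commute, so the n-fold iterates
   differ by at most n times the distance of a single step. *)
Lemma dist_iter_avg g (e : R) : unit_fun g ->
  (forall x, `|avg P1 X1 g x - avg P2 X2 g x| <= e) -> forall n x,
  `|iter n (avg P1 X1) g x - iter n (avg P2 X2) g x| <= n%:R * e.
Proof.
move=> ug h.
have comm n : avg P2 X2 (iter n (avg P1 X1) g) = iter n (avg P1 X1) (avg P2 X2 g).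
  elim: n => //= n ih; rewrite -ih avgC//; exact: iter_avg_unit_fun.
have u1 n : unit_fun (iter n (avg P1 X1) g) by exact: iter_avg_unit_fun.
have u2 n : unit_fun (iter n (avg P2 X2) g) by exact: iter_avg_unit_fun.
have step n : forall x, `|iter n.+1 (avg P1 X1) g x
    - avg P2 X2 (iter n (avg P1 X1) g) x| <= e.
  rewrite comm iterSr; elim: n => //= n ih x.
  by apply: dist_avg => //; apply: iter_avg_unit_fun => //; exact: avg_unit_fun.
elim=> [|n ih] x; first by rewrite /= subrr normr0 mul0r.
rewrite (le_trans (ler_distD (avg P2 X2 (iter n (avg P1 X1) g) x) _ _))//.
rewrite -nat1r mulrDl mul1r lerD//.
exact: (dist_avg P2 mX2 (u1 n) (u2 n) ih x).
Qed.

End lindeberg.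

(** * Joint law of independent variables, restricted to an event *)

Section restricted_law.
Context {d d1} {T : measurableType d} {T1 : measurableType d1} {R : realType}.
Variables (P : probability T R) (E : set T) (mE : measurable E).
Variable X : {mfun T >-> T1}.

(** The law of [X] under the measure that sends A to the probability of A and E. It is finite but in
    general not a probability; the finiteness registered below allows product measures to be formed
    with it. *)
Definition restricted_law := pushforward (mrestr P mE) X.

Let restricted_law0 : restricted_law set0 = 0%E.
Proof. exact: measure0. Qed.

Let restricted_law_ge0 A : (0 <= restricted_law A)%E.
Proof. exact: measure_ge0. Qed.

Let restricted_law_sigma_additive : semi_sigma_additive restricted_law.
Proof. exact: measure_semi_sigma_additive. Qed.

HB.instance Definition _ := isMeasure.Build _ _ _ restricted_law
  restricted_law0 restricted_law_ge0 restricted_law_sigma_additive.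

Let restricted_law_fin : fin_num_fun restricted_law.
Proof.
move=> A mA; apply: (fin_num_measure (mrestr P mE)).
by rewrite -[X in measurable X]setTI; exact: measurable_funP.
Qed.

HB.instance Definition _ := @Measure_isFinite.Build _ T1 R restricted_law
  restricted_law_fin.

End restricted_law.

Section joint_law.
Context {d d1 d2} {T : measurableType d} {T1 : measurableType d1}
  {T2 : measurableType d2} {R : realType} (P : probability T R).

Lemma integral_mrestr (E : set T) (mE : measurable E) (g : T -> \bar R) :
  measurable_fun setT g -> (forall w, 0 <= g w)%E ->
  (\int[mrestr P mE]_w g w = \int[P]_w ((\1_E w)%:E * g w))%E.
Proof.
move=> mg g0.
have PE0 : mrestr P mE (~` E) = 0%E by rewrite /mrestr setICl measure0.
have mE' := measurableC mE.
rewrite (@ge0_negligible_integral _ _ _ _ setT (~` E))//.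
rewrite setTD setCK (eq_measure_integral P); last first.
  by move=> A mA AE; rewrite /= /mrestr setIidl.
rewrite integral_mkcond epatch_indic.
by apply: eq_integral => w _; rewrite muleC.
Qed.

Variables (E : set T) (X : T -> T1) (Y Y0 : T -> T2).
Hypotheses (mE : measurable E) (mX : measurable_fun setT X)
  (mY : measurable_fun setT Y) (mY0 : measurable_fun setT Y0).
Hypothesis XY : forall A B, measurable A -> measurable B ->
  P (E `&` X @^-1` A `&` Y @^-1` B) = (P (E `&` X @^-1` A) * P (Y0 @^-1` B))%E.

Let X' : {mfun T >-> T1} := HB.pack X (isMeasurableFun.Build _ _ _ _ _ mX).
Let Y' : {mfun T >-> T2} := HB.pack Y0 (isMeasurableFun.Build _ _ _ _ _ mY0).
Let mXY : measurable_fun setT (fun w => (X w, Y w)).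
Proof. exact: measurable_fun_pair. Qed.
Let XY' : {mfun T >-> (T1 * T2)%type} :=
  HB.pack (fun w => (X w, Y w)) (isMeasurableFun.Build _ _ _ _ _ mXY).

(** Hypothesis [XY] identifies the restricted law of the pair with a product measure on rectangles;
    uniqueness of the product measure extends this to all measurable sets, and Tonelli does the
    rest. *)
Lemma integral_joint_law (f : T1 * T2 -> \bar R) :
  measurable_fun setT f -> (forall z, 0 <= f z)%E ->
  (\int[P]_w ((\1_E w)%:E * f (X w, Y w)) =
   \int[P]_w' \int[P]_w ((\1_E w)%:E * f (X w, Y0 w')))%E.
Proof.
move=> mf f0.
transitivity (\int[restricted_law P mE X' \x distribution P Y']_z f z)%E.
  rewrite (eq_measure_integral (pushforward (mrestr P mE) XY')); last first.
    move=> A mA _; apply: product_measure_unique => // B C mB mC /=.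
    rewrite /restricted_law /pushforward /mrestr /= /distribution /pushforward /=.
    rewrite (setIC (X @^-1` B)) -XY//; congr (P _).
    by apply/seteqP; split=> w /=; rewrite /preimage /=; tauto.
  rewrite ge0_integral_pushforward//= preimage_setT integral_mrestr//.
  exact: measurableT_comp.
rewrite fubini_tonelli2// ge0_integral_pushforward//=; last first.
- by move=> y _; apply: integral_ge0.
- exact: measurable_fun_fubini_tonelli_G.
rewrite preimage_setT; apply: eq_integral => w' _ /=; rewrite /fubini_G.
have mfw : measurable_fun setT (fun x => f (x, Y0 w')).
  exact: measurable_fun_pair1.
rewrite ge0_integral_pushforward//= preimage_setT integral_mrestr//.
exact: (measurableT_comp mfw mX).
Qed.

End joint_law.

(** * Sums of i.i.d. variables as iterated averages *)

Section iid_sums.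
Context {d d1} {T : measurableType d} {S : measurableType d1} {R : realType}
  (P : probability T R).
Variables (O : nat -> T -> S) (O0 : T -> S).
Hypothesis iidO : iid_copies P O O0.
Variable h : S -> R.
Hypothesis mh : measurable_fun setT h.

Lemma iid_copies_measurable i : measurable_fun setT (O i).
Proof. by case: iidO. Qed.

Lemma iid_copies_measurable0 : measurable_fun setT O0.
Proof. by case: iidO. Qed.

Let mO := iid_copies_measurable.
Let mO0 := iid_copies_measurable0.

Lemma measurable_iid_sum n : measurable_fun setT (fun w => \sum_(i < n) h (O i w)).
Proof. by apply: measurable_sum => i; exact: measurableT_comp. Qed.

Definition tail_event (A : nat -> set S) (N n : nat) : set T :=
  \bigcap_(i in [set i | (n <= i < N)%N]) (O i @^-1` A i).

Lemma measurable_tail_event A N n : (forall i, measurable (A i)) ->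
  measurable (tail_event A N n).
Proof.
move=> mA; apply: bigcap_measurableType => i _.
by rewrite -[X in measurable X]setTI; exact: mO.
Qed.

Lemma tail_eventS A N n : (n < N)%N ->
  tail_event A N n = O n @^-1` A n `&` tail_event A N n.+1.
Proof.
move=> nN; apply/seteqP; split => [w Ew|w [Anw Ew] i /= /andP[ni iN]].
  split; first by apply: Ew; rewrite /= leqnn.
  by move=> i /= /andP[ni iN]; apply: Ew; rewrite /= iN (ltnW ni).
by move: ni; rewrite leq_eqVlt => /predU1P[<-//|ni]; apply: Ew; rewrite /= ni.
Qed.

Lemma Pr_tail_event0 A N : (forall i, measurable (A i)) ->
  Pr P (tail_event A N 0) = \prod_(0 <= i < N) Pr P (O0 @^-1` A i).
Proof.
move=> mA; case: iidO => _ _ /(_ N (@nat_of_ord N)) /(_ (@ord_inj N)).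
move=> /(_ (fun a => A a)) /(_ (fun a => mA a)) H; apply: EFin_inj.
rewrite -EFin_Pr; last exact: measurable_tail_event.
rewrite (_ : tail_event A N 0 = \bigcap_(a in [set: 'I_N]) (O a @^-1` A a)).
  rewrite H big_mkord -prodEFin; apply: eq_bigr => i _; rewrite -EFin_Pr//.
  by rewrite -[X in measurable X]setTI; exact: mO0.
apply/seteqP; split => [w Ew i _|w Ew i /= iN]; first by apply: Ew => /=.
exact: (Ew (Ordinal iN)).
Qed.

Let X0 w := h (O0 w).
Let mX0 : measurable_fun setT X0. Proof. exact: measurableT_comp. Qed.

(* Carrying the event "O_i in A_i for n <= i < N" through the induction on n
   encodes the independence of the first n variables from the later ones. *)
Lemma Ex_iid_sum_tail A N : (forall i, measurable (A i)) ->
  forall n, (n <= N)%N -> forall g x, unit_fun g ->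
  Ex P (fun w => \1_(tail_event A N n) w * g (x + \sum_(i < n) h (O i w))) =
  iter n (avg P X0) g x * \prod_(n <= i < N) Pr P (O0 @^-1` A i).
Proof.
move=> mA n; elim: n A mA => [|n ih] A mA nN g x ug.
  rewrite -Pr_tail_event0// -Ex_indic; last exact: measurable_tail_event.
  rewrite /= -ExZ; last exact/L1_indic/measurable_tail_event.
  by apply: eq_Ex => w; rewrite big_ord0 addr0 mulrC.
have mE := measurable_tail_event N n.+1 mA.
(* Putting the free set [B] at index n makes the induction hypothesis speak about [O n] jointly with
   the first n variables. *)
pose A' B i := if i == n then B else A i.
have mA' B : measurable B -> forall i, measurable (A' B i).
  by move=> mB i; rewrite /A'; case: ifP.
have prodA' B : \prod_(n <= i < N) Pr P (O0 @^-1` A' B i) =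
    Pr P (O0 @^-1` B) * \prod_(n.+1 <= i < N) Pr P (O0 @^-1` A i).
  rewrite big_ltn// {1}/A' eqxx; congr (_ * _).
  apply: eq_big_nat => i /andP[ni _]; rewrite /A'; case: eqP => // ini.
  by move: ni; rewrite ini ltnn.
have tailA' B : tail_event (A' B) N n = O n @^-1` B `&` tail_event A N n.+1.
  rewrite tail_eventS// {1}/A' eqxx; congr (_ `&` _).
  apply: eq_bigcapr => i /= /andP[ni _]; rewrite /A'; case: eqP => // ini.
  by move: ni; rewrite ini ltnn.
have mpre B : measurable B -> measurable (O n @^-1` B).
  by move=> mB; rewrite -[X in measurable X]setTI; exact: mO.
have mpreS C : measurable C ->
    measurable ((fun w => \sum_(i < n) h (O i w)) @^-1` C).
  by move=> mC; rewrite -[X in measurable X]setTI; exact: measurable_iid_sum.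
(* The induction hypothesis for the indicator of [C]: on the tail event, the probabilities of
   rectangles factor, as [integral_joint_law] requires. *)
have pS B C : measurable B -> measurable C ->
    Pr P (tail_event A N n.+1 `&` (fun w => \sum_(i < n) h (O i w)) @^-1` C `&`
      O n @^-1` B) =
    iter n (avg P X0) \1_C 0 * (Pr P (O0 @^-1` B) *
      \prod_(n.+1 <= i < N) Pr P (O0 @^-1` A i)).
  move=> mB mC.
  have uC : unit_fun (\1_C : R -> R).
    split; first exact: measurable_indic.
    by move=> y; rewrite indicE ler0n lern1 leq_b1.
  rewrite -prodA' -(ih _ (mA' B mB) (ltnW nN) _ _ uC) -Ex_indic; last first.
    by apply: measurableI; [apply: measurableI|]; [|exact: mpreS|exact: mpre].
  apply: eq_Ex => w; rewrite tailA' !indicI /= add0r.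
  by rewrite mulrC mulrA; congr (_ * _ * _).
have mpre0 B : measurable B -> measurable (O0 @^-1` B).
  by move=> mB; rewrite -[X in measurable X]setTI; exact: mO0.
have PT : Pr P (O0 @^-1` setT) = 1 by rewrite preimage_setT /Pr (probability_setT P).
have uiter : unit_fun (iter n (avg P X0) g) by exact: iter_avg_unit_fun.
have mG : measurable_fun setT (fun z : R * S => (g (x + (z.1 + h z.2)))%:E).
  apply/measurable_EFinP; apply: measurableT_comp; first by case: ug.
  apply: measurable_funD => //; apply: measurable_funD => //.
  exact: measurableT_comp.
apply: EFin_inj; rewrite -EFin_Ex; last by apply: L1_indicM_unit => //; exact: measurable_iid_sum.
transitivity (\int[P]_w ((\1_(tail_event A N n.+1) w)%:E *
   (g (x + (\sum_(i < n) h (O i w) + h (O n w))))%:E))%E.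
  by apply: eq_integral => w _; rewrite big_ord_recr /= EFinM.
rewrite (@integral_joint_law _ _ _ _ _ _ _ P _
   (fun w => \sum_(i < n) h (O i w)) (O n) O0 mE _ _ _ _
   (fun z : R * S => (g (x + (z.1 + h z.2)))%:E)) //; last 3 first.
- exact: measurable_iid_sum.
- move=> C B mC mB; rewrite !EFin_Pr; first last.
  + by apply: measurableI; [apply: measurableI|]; [|exact: mpreS|exact: mpre].
  + by apply: measurableI => //; exact: mpreS.
  + exact: mpre0.
  have := pS setT C measurableT mC; rewrite preimage_setT setIT => ->.
  by rewrite pS// PT -EFinM; congr (_%:E); rewrite mul1r mulrCA mulrC.
- by move=> z; rewrite lee_fin; case: ug => _ /(_ (x + (z.1 + h z.2)))/andP[].
(* With the n-th variable frozen at [w'], the inner integral is the induction hypothesis started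
   from [x + X0 w']. *)
transitivity (\int[P]_w' (iter n (avg P X0) g (x + X0 w') *
   \prod_(n.+1 <= i < N) Pr P (O0 @^-1` A i))%:E)%E.
  apply: eq_integral => w' _.
  have := ih _ (mA' _ measurableT) (ltnW nN) g (x + X0 w') ug.
  rewrite prodA' PT mul1r => <-; rewrite -EFin_Ex.
    apply: eq_integral => w _; rewrite tailA' preimage_setT setTI /= EFinM.
    by congr (_ * (g _)%:E)%E; rewrite /X0; ring.
  apply: L1_indicM_unit => //; last exact: measurable_iid_sum.
  exact/measurable_tail_event/mA'.
rewrite EFin_Ex.
  rewrite iterS /avg; under eq_Ex do rewrite mulrC.
  by rewrite ExZ 1?mulrC//; exact: unit_fun_L1.
under [X in L1 _ X]eq_fun do rewrite mulrC.
by apply: L1Z; exact: unit_fun_L1.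
Qed.

Lemma Ex_iid_sum n g x : unit_fun g ->
  Ex P (fun w => g (x + \sum_(i < n) h (O i w))) = iter n (avg P X0) g x.
Proof.
move=> ug; have := @Ex_iid_sum_tail (fun=> setT) n (fun=> measurableT) n (leqnn n) g x ug.
rewrite big_geq// mulr1 => <-; apply: eq_Ex => w.
by rewrite indicE mem_set ?mul1r// => i.
Qed.

End iid_sums.

(** * Chebyshev's inequality and the weak law of large numbers *)

Section weak_law.
Context {d d1} {T : measurableType d} {S : measurableType d1} {R : realType}
  (P : probability T R).
Variables (O : nat -> T -> S) (O0 : T -> S).
Hypothesis iidO : iid_copies P O O0.

(** The linear term of the expansion has mean zero because [X] is centred; only the remainder
    survives. *)
Lemma dist_avg_id (X : T -> R) (g g1 rho : R -> R) :
  unit_fun g -> L1 P X -> Ex P X = 0 -> L1 P (rho \o X) ->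
  (forall x y, `|g (x + y) - g x - g1 x * y| <= rho y) ->
  forall x, `|avg P X g x - g x| <= Ex P (rho \o X).
Proof.
move=> ug lX X0 lrho H x; have mX := L1_measurable lX.
have lgX := unit_fun_L1 P x mX ug.
have -> : avg P X g x - g x = Ex P (fun w => g (x + X w) - g x - g1 x * X w).
  rewrite ExB; [|by apply: L1B => //; exact: L1_cst|exact: L1Z].
  by rewrite ExB//; [rewrite Ex_cst ExZ// X0 mulr0 subr0|exact: L1_cst].
have lg : L1 P (fun w => g (x + X w) - g x - g1 x * X w).
  by apply: L1B; [apply: L1B => //; exact: L1_cst|exact: L1Z].
apply: (le_trans (norm_Ex lg)); apply: Ex_le => //; first exact: L1_norm.
Qed.

(** Replacement by the zero variable, whose operator is the identity. *)
Lemma Ex_iid_sum_dist (h : S -> R) (g g1 rho : R -> R) n :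
  measurable_fun setT h -> unit_fun g -> L1 P (h \o O0) -> Ex P (h \o O0) = 0 ->
  L1 P (rho \o (h \o O0)) ->
  (forall x y, `|g (x + y) - g x - g1 x * y| <= rho y) ->
  `|Ex P (fun w => g (\sum_(i < n) h (O i w))) - g 0|
    <= n%:R * Ex P (rho \o (h \o O0)).
Proof.
move=> mh ug lX X0 lrho H.
have -> : Ex P (fun w => g (\sum_(i < n) h (O i w))) =
    iter n (avg P (h \o O0)) g 0.
  by rewrite -(Ex_iid_sum iidO)//; apply: eq_Ex => w; rewrite add0r.
have avg0 f : avg P (fun=> 0) f = f.
  by apply/funext => x; rewrite /avg addr0 Ex_cst.
have {2}-> : g = iter n (avg P (fun=> 0)) g by elim: n => //= n <-; rewrite avg0.
apply: dist_iter_avg => //; first exact: L1_measurable lX.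
by move=> x; rewrite avg0; exact: dist_avg_id.
Qed.

(* A bounded smooth substitute for the square. *)
Definition soft_sqr (x : R) : R := x ^+ 2 / (1 + x ^+ 2).

Lemma soft_sqr_unit_fun : unit_fun soft_sqr.
Proof.
have den (x : R) : 1 + x ^+ 2 != 0 by rewrite gt_eqF// ltr_pwDl// sqr_ge0.
split; last first.
  move=> x; have := sqr_ge0 x => x0; apply/andP; split.
    by rewrite divr_ge0// addr_ge0.
  by rewrite ler_pdivrMr; lra.
apply: continuous_measurable_fun => x.
apply: cvgM; first by apply: exprn_continuous.
apply: cvgV; first exact: den.
by apply: cvgD; [exact: cvg_cst|exact: exprn_continuous].
Qed.

(** The coefficient of [y] is the derivative of [soft_sqr]. The quadratic branch of the minimum
    gives Chebyshev's inequality; both branches together allow the weak law to assume a first moment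
    only. *)
Lemma soft_sqr_taylor (x y : R) :
  `|soft_sqr (x + y) - soft_sqr x - 2 * x / (1 + x ^+ 2) ^+ 2 * y|
    <= 2 * Num.min (y ^+ 2) `|y|.
Proof.
have X0 : 1 + x ^+ 2 != 0 by rewrite gt_eqF// ltr_pwDl// sqr_ge0.
have Y0 : 1 + (x + y) ^+ 2 != 0 by rewrite gt_eqF// ltr_pwDl// sqr_ge0.
have Xp : 1 <= 1 + x ^+ 2 by rewrite lerDl sqr_ge0.
have Yp : 1 <= 1 + (x + y) ^+ 2 by rewrite lerDl sqr_ge0.
have D2 : 0 < (1 + x ^+ 2) ^+ 2 * (1 + (x + y) ^+ 2).
  by rewrite mulr_gt0// ?exprn_gt0//; lra.
have D1 : 0 < (1 + x ^+ 2) * (1 + (x + y) ^+ 2) by rewrite mulr_gt0//; lra.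
have b1 : 1 + x ^+ 2 + (x + y) ^+ 2 <= (1 + x ^+ 2) * (1 + (x + y) ^+ 2).
  have := mulr_ge0 (sqr_ge0 x) (sqr_ge0 (x + y)).
  by move: (x ^+ 2) ((x + y) ^+ 2) => a b; lra.
have b2 : 2 * (1 + x ^+ 2 + (x + y) ^+ 2) <=
    2 * ((1 + x ^+ 2) ^+ 2 * (1 + (x + y) ^+ 2)).
  rewrite ler_wpM2l// (le_trans b1)//.
  have B0 : 0 <= 1 + (x + y) ^+ 2 by lra.
  by rewrite (ler_wpM2r B0)// ler_eXnr.
rewrite minr_pMr// le_min; apply/andP; split.
  have -> : soft_sqr (x + y) - soft_sqr x - 2 * x / (1 + x ^+ 2) ^+ 2 * y =
    y ^+ 2 * (1 - x ^+ 2 - 2 * x * (x + y)) /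
      ((1 + x ^+ 2) ^+ 2 * (1 + (x + y) ^+ 2)).
    by rewrite /soft_sqr; field; rewrite X0 Y0.
  rewrite normrM normfV (gtr0_norm D2) ler_pdivrMr// normrM ger0_norm ?sqr_ge0//.
  rewrite -[leRHS]mulrA [leRHS]mulrCA ler_wpM2l ?sqr_ge0// (le_trans _ b2)//.
  rewrite ler_norml; have := sqr_ge0 (x + (x + y)); have := sqr_ge0 (x - (x + y)).
  by have := sqr_ge0 x; have := sqr_ge0 (x + y); move=> *; apply/andP; split; nra.
(* For the linear branch, the increment and the first order term are each bounded by |y|. *)
have -> : soft_sqr (x + y) - soft_sqr x =
    y * (2 * x + y) / ((1 + x ^+ 2) * (1 + (x + y) ^+ 2)).
  by rewrite /soft_sqr; field; rewrite X0 Y0.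
rewrite (le_trans (ler_normB _ _))// [leRHS]mulr_natl mulr2n lerD//.
  rewrite normrM normfV (gtr0_norm D1) ler_pdivrMr// normrM.
  rewrite ler_wpM2l// (le_trans _ b1)// ler_norml; apply/andP.
  have := sqr_ge0 (x + (x + y) + 1); have := sqr_ge0 (x + (x + y) - 1).
  have := sqr_ge0 (x - (x + y)); have := sqr_ge0 (x + (x + y)).
  by move=> *; split; nra.
have Dx : 0 < (1 + x ^+ 2) ^+ 2 by rewrite exprn_gt0//; lra.
rewrite normrM -[leRHS]mul1r ler_wpM2r// normrM normfV (gtr0_norm Dx).
rewrite ler_pdivrMr// mul1r.
have := sqr_ge0 (x + 1); have := sqr_ge0 (x - 1); have := sqr_ge0 (x ^+ 2).
have := sqr_ge0 x => *; rewrite ler_norml; apply/andP; split; nra.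
Qed.

Lemma L1_scaled_sqr (X : T -> R) (a : R) : L1 P (fun w => X w ^+ 2) ->
  L1 P (fun w => (a * X w) ^+ 2).
Proof. by move=> lX; under [X in L1 _ X]eq_fun do rewrite exprMn; exact: L1Z. Qed.

Lemma soft_sqr_ge (x : R) : 1 <= `|x| -> 1 <= 2 * soft_sqr x.
Proof.
move=> x1; have x2 : 1 <= x ^+ 2 by rewrite -real_normK ?num_real// expr_ge1.
by rewrite /soft_sqr mulrA ler_pdivlMr; lra.
Qed.

(** Markov's inequality for [soft_sqr] of the sum divided by c. The 4 is a product of two factors 2:
    [soft_sqr] is at least 1/2 outside the unit interval, and [soft_sqr_taylor] has constant 2. *)
Lemma Pr_iid_sum_ge (h : S -> R) (rho : R -> R) n (c : R) : 0 < c ->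
  measurable_fun setT h -> L1 P (h \o O0) -> Ex P (h \o O0) = 0 ->
  (forall y, Num.min (y ^+ 2) `|y| <= rho y) ->
  L1 P (fun w => rho (c^-1 * h (O0 w))) ->
  Pr P [set w | c <= `|\sum_(i < n) h (O i w)|]
    <= 4 * (n%:R * Ex P (fun w => rho (c^-1 * h (O0 w)))).
Proof.
move=> c0 mh lX X0 Hrho lrho.
pose k s := c^-1 * h s.
have mk : measurable_fun setT k by exact: measurable_funM.
have lk : L1 P (k \o O0) by exact: L1Z.
have k0 : Ex P (k \o O0) = 0 by rewrite /k /comp ExZ// X0 mulr0.
have sumk w : \sum_(i < n) k (O i w) = c^-1 * \sum_(i < n) h (O i w).
  by rewrite mulr_sumr.
have lrho2 : L1 P ((fun y => 2 * rho y) \o (k \o O0)) by exact: L1Z.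
have := Ex_iid_sum_dist n mk soft_sqr_unit_fun lk k0 lrho2
  (fun x y => le_trans (soft_sqr_taylor x y) (ler_wpM2l (ler0n _ 2) (Hrho y))).
rewrite {2}/soft_sqr expr0n mul0r subr0 ExZ// => H.
have ms : measurable_fun setT (fun w => \sum_(i < n) h (O i w)).
  exact: (measurable_iid_sum iidO).
have mS : measurable_fun setT (fun w => \sum_(i < n) k (O i w)).
  exact: (measurable_iid_sum iidO).
have lS : L1 P (fun w => soft_sqr (\sum_(i < n) k (O i w))).
  have := unit_fun_L1 P 0 mS soft_sqr_unit_fun.
  by under [X in L1 _ X]eq_fun do rewrite add0r.
apply: (@le_trans _ _ (Ex P (fun w => 2 * soft_sqr (\sum_(i < n) k (O i w))))).
  apply: Pr_le_Ex.
  - rewrite -[X in measurable X]setTI; apply: measurable_fun_le => //.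
    exact: measurableT_comp.
  - exact: L1Z.
  - move=> w; rewrite mulr_ge0//.
    by have [_ /(_ (\sum_(i < n) k (O i w)))/andP[]] := soft_sqr_unit_fun.
  - move=> w /= cw; apply: soft_sqr_ge.
    by rewrite sumk normrM normfV (gtr0_norm c0) ler_pdivlMl// mulr1.
rewrite ExZ//; apply: (@le_trans _ _ (2 * (n%:R * (2 * Ex P (rho \o (k \o O0)))))).
  by rewrite ler_wpM2l// (le_trans _ H)// ler_norm.
by rewrite (_ : rho \o (k \o O0) = fun w => rho (c^-1 * h (O0 w)))//; lra.
Qed.

(** The case of a quadratic [rho] at threshold c sqrt n, where n cancels. The replacement bound
    takes the place of the variance of the sum, at the price of the factor 4. *)
Lemma chebyshev_iid_sum (h : S -> R) n (c : R) : 0 < c ->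
  measurable_fun setT h -> L1 P (h \o O0) -> Ex P (h \o O0) = 0 ->
  L1 P (fun w => h (O0 w) ^+ 2) ->
  Pr P [set w | c <= `|(Num.sqrt n%:R)^-1 * \sum_(i < n) h (O i w)|]
    <= 4 * Ex P (fun w => h (O0 w) ^+ 2) / c ^+ 2.
Proof.
move=> c0 mh lX X0 l2.
have e0 : 0 <= Ex P (fun w => h (O0 w) ^+ 2) by apply: Ex_ge0 => w; exact: sqr_ge0.
have [->|n0] := eqVneq n 0.
  rewrite [X in Pr _ X](_ : _ = set0).
    by rewrite /Pr measure0 divr_ge0 ?sqr_ge0// mulr_ge0.
  apply/seteqP; split => // w /=; rewrite big_ord0 mulr0 normr0.
  by rewrite leNgt c0.
have sn : 0 < Num.sqrt (n%:R : R) by rewrite sqrtr_gt0 ltr0n lt0n.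
have := @Pr_iid_sum_ge h (fun y => y ^+ 2) n (c * Num.sqrt n%:R) _ mh lX X0 _ _.
rewrite mulr_gt0// => /(_ isT) H.
rewrite [X in Pr _ X](_ : _ =
    [set w | c * Num.sqrt n%:R <= `|\sum_(i < n) h (O i w)|]); last first.
  apply/seteqP; split => w /=; rewrite normrM normfV (gtr0_norm sn).
    by rewrite ler_pdivlMl// mulrC.
  by rewrite ler_pdivlMl// mulrC.
apply: (le_trans (H _ _)).
- by move=> y; rewrite ge_min lexx.
- exact: L1_scaled_sqr.
- under eq_Ex do rewrite exprMn.
  rewrite ExZ// exprVn exprMn sqr_sqrtr ?ler0n// invfM.
  rewrite [leLHS](_ : _ = 4 * Ex P (fun w => h (O0 w) ^+ 2) / c ^+ 2)//.
  by field; rewrite pnatr_eq0 n0/= gt_eqF.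
Qed.

Definition avg_sample (h : S -> R) (n : nat) (w : T) : R :=
  n%:R^-1 * \sum_(i < n) h (O i w).

Lemma measurable_avg_sample h n : measurable_fun setT h ->
  measurable_fun setT (avg_sample h n).
Proof. by move=> mh; apply: measurable_funM => //; exact: (measurable_iid_sum iidO). Qed.

(** At threshold n e the bound is the mean of n rho(k / (n e)). The linear branch of [rho] dominates
    this by |k| / e, the quadratic branch makes it O(1/n) at each point, so dominated convergence
    applies. *)
Lemma weak_law (h : S -> R) (e : R) : 0 < e ->
  measurable_fun setT h -> L1 P (h \o O0) ->
  Pr P [set w | e <= `|avg_sample h n w - Ex P (h \o O0)|] @[n --> \oo] --> (0 : R).
Proof.
move=> e0 mh lX.
pose k s := h s - Ex P (h \o O0).
have mk : measurable_fun setT k by exact: measurable_funB.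
have lk : L1 P (k \o O0) by apply: L1B => //; exact: L1_cst.
have k0 : Ex P (k \o O0) = 0 by rewrite /k /comp ExB ?Ex_cst ?subrr//; exact: L1_cst.
pose rho (y : R) := Num.min (y ^+ 2) `|y|.
have mrho : measurable_fun setT rho.
  by apply: measurable_minr; [exact: measurable_funX|exact: normr_measurable].
have rho0 y : 0 <= rho y by rewrite /rho le_min sqr_ge0 normr_ge0.
pose F n w := n%:R * rho ((n%:R * e)^-1 * k (O0 w)).
have F_le n w : `|F n w| <= e^-1 * `|k (O0 w)|.
  rewrite /F ger0_norm ?mulr_ge0//.
  have [->|n0] := eqVneq n 0; first by rewrite mul0r mulr_ge0// invr_ge0 ltW.
  apply: (@le_trans _ _ (n%:R * `|(n%:R * e)^-1 * k (O0 w)|)).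
    by rewrite ler_wpM2l// /rho ge_min lexx orbT.
  rewrite normrM gtr0_norm; last by rewrite invr_gt0 mulr_gt0// ltr0n lt0n.
  by rewrite invfM !mulrA mulfV ?mul1r// pnatr_eq0.
have mF n : measurable_fun setT (F n).
  apply: measurable_funM => //; apply: (measurableT_comp mrho).
  by apply: measurable_funM => //; exact: L1_measurable lk.
have lF n : L1 P (F n) by apply: (L1_le (mF n) _ (F_le n)); exact/L1Z/L1_norm.
have F0 : (fun n => Ex P (F n)) @ \oo --> Ex P (fun=> 0).
  apply: (cvg_Ex mF _ _ F_le) => //; first exact/L1Z/L1_norm.
  move=> w; apply/cvgrPdist_le => d0 d00.
  have [N _ HN] : \forall n \near \oo, (e^-1 * k (O0 w)) ^+ 2 / d0 <= n%:R.
    exact: nbhs_infty_ger.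
  exists N.+1 => // n /= Nn; rewrite sub0r normrN ger0_norm ?mulr_ge0//.
  have n0 : 0 < n%:R :> R by rewrite ltr0n (leq_trans _ Nn).
  apply: (@le_trans _ _ (n%:R * ((n%:R * e)^-1 * k (O0 w)) ^+ 2)).
    by rewrite ler_wpM2l// /rho ge_min lexx.
  have := HN n (ltnW Nn); rewrite ler_pdivrMr// => Hn.
  rewrite (_ : _ * _ = (e^-1 * k (O0 w)) ^+ 2 / n%:R).
    by rewrite ler_pdivrMr // (le_trans Hn) // mulrC.
  by field; rewrite !gt_eqF.
rewrite Ex_cst in F0.
apply: (@squeeze_cvgr _ _ _ _ (fun=> 0) (fun n => 4 * Ex P (F n))).
- exists 1%N => // n /= n1; rewrite Pr_ge0/=.
  have n0 : 0 < n%:R :> R by rewrite ltr0n.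
  have lr : L1 P (fun w => rho ((n%:R * e)^-1 * k (O0 w))).
    have := L1Z n%:R^-1 (lF n); rewrite /F.
    by under [X in L1 _ X]eq_fun do rewrite mulrA mulVf ?gt_eqF// mul1r.
  have := @Pr_iid_sum_ge k rho n (n%:R * e) _ mk lk k0 (fun=> lexx _).
  rewrite mulr_gt0// => /(_ isT) H.
  rewrite [X in Pr _ X](_ : _ = [set w | n%:R * e <= `|\sum_(i < n) k (O i w)|]).
    by rewrite /F ExZ//; exact: H.
  have sumk w : avg_sample h n w - Ex P (h \o O0) =
      n%:R^-1 * \sum_(i < n) k (O i w).
    rewrite /k sumrB mulrBr sumr_const card_ord -(mulr_natl (Ex P _)).
    by rewrite mulrA mulVf ?mul1r// gt_eqF.
  apply/seteqP; split => w /=; rewrite sumk normrM normfV (gtr0_norm n0);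
    by rewrite ler_pdivlMl.
- exact: cvg_cst.
- by rewrite -[X in _ --> X](mulr0 4); apply: cvgM => //; exact: cvg_cst.
Qed.

End weak_law.

(** * Integration against a measure with a density *)

Section density.
Context {d} {T : measurableType d} {R : realType}.
Variables (mu nu : {measure set T -> \bar R}) (phi : T -> R).
Hypotheses (mphi : measurable_fun setT phi) (phi0 : forall x, 0 <= phi x).
Hypothesis nuE : forall A, measurable A -> nu A = (\int[mu]_(x in A) (phi x)%:E)%E.
Import HBNNSimple.

Let integral_density_nnsfun (f : {nnsfun T >-> R}) :
  (\int[nu]_x (f x)%:E = \int[mu]_x ((f x)%:E * (phi x)%:E))%E.
Proof.
under [LHS]eq_integral do rewrite fimfunE -fsumEFin//.
rewrite [LHS]ge0_integral_fsum//; last 2 first.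
  - by move=> r; exact/measurable_EFinP/measurableT_comp.
  - by move=> n x _; rewrite EFinM nnfun_muleindic_ge0.
under [RHS]eq_integral.
  move=> x xD; rewrite fimfunE -fsumEFin// ge0_mule_fsuml; last first.
    by move=> r; rewrite EFinM nnfun_muleindic_ge0.
  over.
rewrite [RHS]ge0_integral_fsum//; last 2 first.
  - move=> r; apply: emeasurable_funM; last exact/measurable_EFinP.
    by apply/measurable_EFinP; exact: measurableT_comp.
  - move=> n x _; apply: mule_ge0; last by rewrite lee_fin.
    by rewrite EFinM nnfun_muleindic_ge0.
apply: eq_fsbigr => r _.
rewrite integralZl_indic_nnsfun// integral_indic//= setIT nuE//.
transitivity (\int[mu]_x (r%:E * ((\1_(f @^-1` [set r]) x)%:E * (phi x)%:E)))%E; last first.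
  by apply: eq_integral => x _; rewrite EFinM muleA.
(* The sum over the values of [f] formally runs over all reals; a negative value has an empty
   preimage and contributes zero on both sides. *)
have [r0|r0] := leP 0 r.
  rewrite ge0_integralZl//; last 2 first.
  - by apply: emeasurable_funM; exact/measurable_EFinP.
  - by move=> x _; rewrite mule_ge0 ?lee_fin.
  congr (_ * _)%E; rewrite integral_mkcond epatch_indic.
  by apply: eq_integral => x _; rewrite muleC.
rewrite (_ : f @^-1` [set r] = set0); last exact: preimage_nnfun0.
rewrite integral_set0 mule0; apply/esym; apply: integral0_eq => x _.
by rewrite indic0 mul0e mule0.
Qed.

Lemma ge0_integral_density (f : T -> \bar R) :
  measurable_fun setT f -> (forall x, 0 <= f x)%E ->
  (\int[nu]_x f x = \int[mu]_x (f x * (phi x)%:E))%E.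
Proof.
move=> mf f0.
pose f_ := nnsfun_approx measurableT mf.
transitivity (lim (\int[nu]_x (f_ n x)%:E @[n --> \oo])%E).
  rewrite -monotone_convergence//=.
  - apply: eq_integral => ? /[!inE] xD; apply/esym/cvg_lim => //=.
    exact: cvg_nnsfun_approx.
  - by move=> n; exact/measurable_EFinP/measurable_funTS.
  - by move=> n ? _; rewrite lee_fin.
  - by move=> ? _ ? ? mn; rewrite lee_fin; exact/lefP/nd_nnsfun_approx.
transitivity (lim (\int[mu]_x ((f_ n x)%:E * (phi x)%:E) @[n --> \oo])%E).
  by apply: congr_lim; apply/funext => n /=; exact: integral_density_nnsfun.
rewrite -monotone_convergence//=.
- apply: eq_integral => x _; apply/cvg_lim => //; apply: cvgeZr => //.
  exact: cvg_nnsfun_approx.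
- by move=> n; apply: emeasurable_funM; exact/measurable_EFinP.
- by move=> n x _; rewrite mule_ge0// lee_fin.
- move=> x _ m n mn; rewrite lee_wpmul2r ?lee_fin//.
  exact/lefP/nd_nnsfun_approx.
Qed.

End density.

(** * Translation invariance of the Lebesgue integral *)

Section translation.
Context {R : realType}.
Local Notation mu := (@lebesgue_measure R).

Lemma lebesgue_measure_shift (y : R) (A : set R) : measurable A ->
  pushforward mu ((fun x => x + y) : _ -> measurableTypeR R) A = mu A.
Proof.
have my : measurable_fun setT (fun x : R => x + y) by exact: measurable_funD.
move=> mA; apply/esym/lebesgue_measure_unique => //= _ [[a b]] _ <-.
rewrite /pushforward (_ : _ @^-1` _ = `](a - y), (b - y)]%classic); last first.
  by apply/seteqP; split => x /=; rewrite !in_itv/= ltrBlDr lerBrDr.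
by rewrite !lebesgue_measure_itv/= !lte_fin ltrD2r -!EFinB opprB addrA subrK.
Qed.

Lemma ge0_integral_shift (y : R) (f : R -> \bar R) :
  measurable_fun setT f -> (forall r, 0 <= f r)%E ->
  (\int[mu]_x f (x + y)%R = \int[mu]_x f x)%E.
Proof.
move=> mf f0.
have my : measurable_fun setT ((fun x => x + y) : R -> measurableTypeR R).
  exact: measurable_funD.
transitivity (\int[pushforward mu ((fun x => (x + y)%R) : _ -> measurableTypeR R)]_x f x)%E.
  by rewrite ge0_integral_pushforward//= preimage_setT.
by apply: eq_measure_integral => A mA _; exact: lebesgue_measure_shift.
Qed.

End translation.

(** * Stability and exponential moments of the centred Gaussian law *)

Section gaussian.
Context {R : realType}.
Local Notation mu := (@lebesgue_measure R).
Implicit Types (g : R -> R) (a b s t : R).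

Lemma ge0_integral_normal_prob m s (f : R -> \bar R) :
  measurable_fun setT f -> (forall x, 0 <= f x)%E ->
  (\int[normal_prob m s]_x f x = \int[mu]_x (f x * (normal_pdf m s x)%:E))%E.
Proof.
move=> mf f0; apply: ge0_integral_density => //; first exact: measurable_normal_pdf.
exact: normal_pdf_ge0.
Qed.

Lemma EFin_avg_normal s g x : unit_fun g ->
  ((avg (normal_prob 0 s) id g x)%:E =
  \int[mu]_y ((g (x + y))%:E * (normal_pdf 0 s y)%:E))%E.
Proof.
move=> ug; have mid : measurable_fun setT (@id R) by exact: measurable_id.
rewrite -ge0_integral_normal_prob; last 2 first.
- apply/measurable_EFinP; apply: measurableT_comp; last exact: measurable_funD.
  by case: ug.
- by move=> y; rewrite lee_fin; case: ug => _ /(_ (x + y))/andP[].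
exact: (esym (EFin_Ex (unit_fun_L1 (normal_prob 0 s) x mid ug))).
Qed.

(* Completing the square. *)
Lemma normal_pdf_conv a b (y v : R) : 0 < a -> 0 < b ->
  normal_pdf 0 b (v - y) * normal_pdf 0 a y =
  normal_pdf 0 (Num.sqrt (a ^+ 2 + b ^+ 2)) v *
  normal_pdf (v * a ^+ 2 / (a ^+ 2 + b ^+ 2)) (a * b / Num.sqrt (a ^+ 2 + b ^+ 2)) y.
Proof.
move=> a0 b0; have c0 : 0 < a ^+ 2 + b ^+ 2 by rewrite addr_gt0// exprn_gt0.
have s0 : 0 < Num.sqrt (a ^+ 2 + b ^+ 2) by rewrite sqrtr_gt0.
have ss : Num.sqrt (a ^+ 2 + b ^+ 2) ^+ 2 = a ^+ 2 + b ^+ 2 by rewrite sqr_sqrtr// ltW.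
rewrite !normal_pdfE ?gt_eqF ?divr_gt0 ?mulr_gt0// /normal_fun.
rewrite mulrACA [RHS]mulrACA -!expRD; congr (_ * expR _).
  rewrite /normal_peak -!invfM; congr (_^-1).
  rewrite -!sqrtrM ?mulrn_wge0 ?mulr_ge0 ?sqr_ge0 ?pi_ge0 ?(ltW b0)//.
  apply: (congr1 Num.sqrt).
  rewrite !mulr2n !exprMn !exprVn ss; move: (pi : R) => p.
  by field; rewrite gt_eqF.
rewrite !exprMn !exprVn ss.
by field; rewrite !gt_eqF.
Qed.

(** After exchanging the integrals and completing the square, what depends on the first increment is
    a normal density, of integral 1. *)
Lemma avg_normal_conv a b g : 0 < a -> 0 < b -> unit_fun g ->
  avg (normal_prob 0 a) id (avg (normal_prob 0 b) id g) =
  avg (normal_prob 0 (Num.sqrt (a ^+ 2 + b ^+ 2))) id g.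
Proof.
move=> a0 b0 ug; have [mg g01] := ug.
set c := Num.sqrt _.
have mid : measurable_fun setT (@id R) by exact: measurable_id.
have mpdf m s : measurable_fun setT (fun y : R => (normal_pdf m s y)%:E).
  by apply/measurable_EFinP; exact: measurable_normal_pdf.
have mgx x : measurable_fun setT (fun y : R => (g (x + y))%:E).
  by apply/measurable_EFinP; apply: measurableT_comp => //; exact: measurable_funD.
have g0 x : (0 <= (g x)%:E)%E by have /andP[] := g01 x.
apply/funext => x; apply: EFin_inj.
apply: (etrans (EFin_avg_normal a x (avg_unit_fun (normal_prob 0 b) mid ug))).
apply: (etrans _ (esym (EFin_avg_normal c x ug))).
(* Coordinates: [z.1] is the first increment and [z.2] the sum of both, which is why the inner
   integral is shifted by [- y]. *)
pose F (z : R * R) := ((g (x + z.2))%:E *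
   (normal_pdf 0 b (z.2 - z.1) * normal_pdf 0 a z.1)%:E)%E.
transitivity (\int[mu]_y \int[mu]_v F (y, v))%E.
  apply: eq_integral => y _; rewrite (EFin_avg_normal b (x + y) ug).
  rewrite -(ge0_integral_shift (- y))//; last 2 first.
  - exact: emeasurable_funM.
  - by move=> r; rewrite mule_ge0// lee_fin normal_pdf_ge0.
  rewrite -ge0_integralZr//; last 3 first.
  - apply: emeasurable_funM.
      apply/measurable_EFinP; apply: measurableT_comp => //.
      by apply: measurable_funD => //; exact: measurable_funD.
    apply/measurable_EFinP; apply: measurableT_comp; last exact: measurable_funD.
    exact: measurable_normal_pdf.
  - by move=> r _; rewrite mule_ge0// lee_fin normal_pdf_ge0.
  - by rewrite lee_fin normal_pdf_ge0.
  apply: eq_integral => v _; rewrite /F /= EFinM muleA.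
  by congr ((g _)%:E * _ * _)%E; ring.
rewrite fubini_tonelli//; last 2 first.
- apply: emeasurable_funM.
    apply/measurable_EFinP; apply: measurableT_comp => //.
    by apply: measurable_funD => //; exact: measurable_snd.
  apply/measurable_EFinP; apply: measurable_funM.
    apply: measurableT_comp; first exact: measurable_normal_pdf.
    by apply: measurable_funB; [exact: measurable_snd|exact: measurable_fst].
  apply: measurableT_comp; first exact: measurable_normal_pdf.
  exact: measurable_fst.
- move=> z; rewrite mule_ge0// lee_fin mulr_ge0// normal_pdf_ge0//.
apply: eq_integral => v _.
under eq_integral do rewrite /F /= normal_pdf_conv// EFinM muleA.
rewrite ge0_integralZl//; last 2 first.
- by move=> y _; rewrite lee_fin normal_pdf_ge0.
- by rewrite mule_ge0// lee_fin normal_pdf_ge0.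
by rewrite integral_normal_pdf mule1.
exact: mpdf.
Qed.

Lemma iter_avg_normal s n g : 0 < s -> unit_fun g ->
  iter n.+1 (avg (normal_prob 0 s) id) g =
  avg (normal_prob 0 (Num.sqrt n.+1%:R * s)) id g.
Proof.
move=> s0 ug; elim: n => [|n ih].
  have -> : Num.sqrt 1 * s = s by rewrite sqrtr1 mul1r.
  exact: erefl.
apply: (etrans (congr1 (avg (normal_prob 0 s) id) ih)).
have n0 : 0 < Num.sqrt n.+1%:R * s by rewrite mulr_gt0 ?sqrtr_gt0.
apply: (etrans (avg_normal_conv s0 n0 ug)).
have -> : Num.sqrt (s ^+ 2 + (Num.sqrt n.+1%:R * s) ^+ 2) = Num.sqrt n.+2%:R * s.
  have e : s ^+ 2 + (Num.sqrt n.+1%:R * s) ^+ 2 = n.+2%:R * s ^+ 2.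
    have -> : n.+2%:R = 1 + n.+1%:R :> R by rewrite nat1r.
    have n1 : 0 <= n.+1%:R :> R by [].
    by rewrite exprMn (sqr_sqrtr n1) mulrDl mul1r.
  have n2 : 0 <= n.+2%:R :> R by [].
  by rewrite e (sqrtrM _ n2) sqrtr_sqr (gtr0_norm s0).
exact: erefl.
Qed.

(** The tilt exp(t x) turns the centred density into a multiple of the density with mean t s^2. *)
Lemma integral_expR_normal s t : 0 < s ->
  (\int[normal_prob 0 s]_x (expR (t * x))%:E = (expR (t ^+ 2 * s ^+ 2 / 2))%:E)%E.
Proof.
move=> s0; have sn0 : s != 0 by rewrite gt_eqF.
rewrite ge0_integral_normal_prob; last 2 first.
- by apply/measurable_EFinP; apply: measurableT_comp => //; exact: measurable_funM.
- by move=> x; rewrite lee_fin expR_ge0.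
transitivity (\int[mu]_x ((expR (t ^+ 2 * s ^+ 2 / 2))%:E *
    (normal_pdf (t * s ^+ 2) s x)%:E))%E.
  apply: eq_integral => x _; rewrite -!EFinM !normal_pdfE// mulrCA [in RHS]mulrCA.
  congr (_ * _)%:E; rewrite -!expRD; congr expR; field.
  exact: sn0.
have mpdf : measurable_fun setT (fun x => (normal_pdf (t * s ^+ 2) s x)%:E).
  by apply/measurable_EFinP; exact: measurable_normal_pdf.
have pdf0 x : setT x -> (0 <= (normal_pdf (t * s ^+ 2) s x)%:E)%E.
  by move=> _; rewrite lee_fin normal_pdf_ge0.
have e0 : (0 <= (expR (t ^+ 2 * s ^+ 2 / 2))%:E)%E by rewrite lee_fin expR_ge0.
by rewrite (ge0_integralZl mu measurableT mpdf pdf0 e0) integral_normal_pdf mule1.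
Qed.

Lemma L1_expR_normal s t : 0 < s -> L1 (normal_prob 0 s) (fun x => expR (t * x)).
Proof.
move=> s0; apply/integrableP; split.
  by apply/measurable_EFinP; apply: measurableT_comp => //; exact: measurable_funM.
under eq_integral do rewrite /= ger0_norm ?expR_ge0//.
by rewrite integral_expR_normal// ltry.
Qed.

Lemma Ex_expR_normal s t : 0 < s ->
  Ex (normal_prob 0 s) (fun x => expR (t * x)) = expR (t ^+ 2 * s ^+ 2 / 2).
Proof. by move=> s0; rewrite /Ex /Rintegral integral_expR_normal. Qed.

End gaussian.

(** * Taylor bounds in one variable *)

Section taylor.
Context {R : realType}.
Implicit Types (f : R -> R) (x h K : R).

Lemma mean_value_bound f f1 x h K :
  (forall y, `|y| <= `|h| -> is_derive (x + y) 1 f (f1 (x + y))) ->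
  (forall y, `|y| <= `|h| -> `|f1 (x + y)| <= K) ->
  `|f (x + h) - f x| <= K * `|h|.
Proof.
move=> df f1K.
have H a b : a <= b -> (forall y, a <= y <= b -> `|y - x| <= `|h|) ->
    `|f b - f a| <= K * (b - a).
  move=> ab Hy.
  have D y : y \in `]a, b[ -> is_derive y 1 f (f1 y).
    rewrite in_itv/= => /andP[ay yb]; have -> : y = x + (y - x) by ring.
    by apply: df; apply: Hy; rewrite !ltW.
  have C : {within `[a, b], continuous f}.
    apply: continuous_in_subspaceT => y; rewrite inE/= in_itv/= => yab.
    apply: differentiable_continuous; apply/derivable1_diffP.
    have -> : y = x + (y - x) by ring.
    by have := df _ (Hy y yab); case.
  have [c cab ->] := MVT_segment ab D C.
  rewrite normrM (ger0_norm (_ : 0 <= b - a)) ?subr_ge0// ler_wpM2r ?subr_ge0//.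
  have -> : c = x + (c - x) by ring.
  by apply: f1K; apply: Hy; rewrite in_itv/= in cab.
have [h0|h0] := leP 0 h.
  have := H x (x + h); rewrite [x + h - x]addrAC subrr add0r (ger0_norm h0).
  apply; first by rewrite lerDl.
  by move=> y /andP[xy yh]; rewrite ger0_norm; lra.
have := H (x + h) x; rewrite opprD addrA subrr add0r (ltr0_norm h0) distrC.
apply; first by lra.
by move=> y /andP[xy yh]; rewrite ler0_norm; lra.
Qed.

(** The constant is K instead of K/2 because the mean value bound is used twice, on [f] minus its
    tangent and then on [f1]. *)
Lemma taylor1_bound f f1 f2 x h K :
  (forall y, `|y| <= `|h| -> is_derive (x + y) 1 f (f1 (x + y))) ->
  (forall y, `|y| <= `|h| -> is_derive (x + y) 1 f1 (f2 (x + y))) ->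
  (forall y, `|y| <= `|h| -> `|f2 (x + y)| <= K) ->
  `|f (x + h) - f x - f1 x * h| <= K * h ^+ 2.
Proof.
move=> df df1 f2K.
pose g y := f y - f1 x * y; pose g1 y := f1 y - f1 x.
have -> : f (x + h) - f x - f1 x * h = g (x + h) - g x by rewrite /g; ring.
have -> : K * h ^+ 2 = K * `|h| * `|h|.
  by rewrite -mulrA -expr2 real_normK ?num_real.
apply: (@mean_value_bound g g1).
  move=> y yh; have := df y yh => d.
  have : is_derive (x + y) 1 g (f1 (x + y) - f1 x *: 1).
    by apply: is_deriveB.
  by rewrite /g1 scaler1.
move=> y yh; apply: (le_trans (@mean_value_bound f1 f2 x y K _ _)).
- by move=> z zy; apply: df1; exact: le_trans yh.
- by move=> z zy; apply: f2K; exact: le_trans yh.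
- rewrite ler_wpM2l//; apply: le_trans (f2K 0 _) => //.
  by rewrite normr0.
Qed.

Lemma taylor2_bound f f1 f2 f3 x h K :
  (forall y, `|y| <= `|h| -> is_derive (x + y) 1 f (f1 (x + y))) ->
  (forall y, `|y| <= `|h| -> is_derive (x + y) 1 f1 (f2 (x + y))) ->
  (forall y, `|y| <= `|h| -> is_derive (x + y) 1 f2 (f3 (x + y))) ->
  (forall y, `|y| <= `|h| -> `|f3 (x + y)| <= K) ->
  `|f (x + h) - f x - f1 x * h - f2 x * h ^+ 2 / 2| <= K * `|h| ^+ 3.
Proof.
move=> df df1 df2 f3K.
pose g y := f y - f1 x * y - (f2 x / 2) * (y - x) ^+ 2.
pose g1 y := f1 y - f1 x - f2 x * (y - x).
have -> : f (x + h) - f x - f1 x * h - f2 x * h ^+ 2 / 2 = g (x + h) - g x.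
  by rewrite /g; ring.
have -> : K * `|h| ^+ 3 = K * `|h| ^+ 2 * `|h| by ring.
apply: (@mean_value_bound g g1).
  move=> y yh; have := df y yh => d.
  have : is_derive (x + y) 1 g
      (f1 (x + y) - f1 x *: 1 - (f2 x / 2) *: ((2 * (x + y - x)) *: (1 - 0))).
    apply: is_deriveB; apply: is_deriveZ.
    have dz : is_derive (x + y) 1 (fun z => z - x) (1 - 0) by exact: is_deriveB.
    by apply: (is_derive_eq (is_deriveX 2 dz)); rewrite expr1.
  rewrite /g1 [X in is_derive _ _ _ X -> _](_ : _ =
    f1 (x + y) - f1 x - f2 x * (x + y - x))//.
  by rewrite /GRing.scale/=; field.
move=> y yh; rewrite /g1 (_ : x + y - x = y); last by ring.
apply: (le_trans (@taylor1_bound f1 f2 f3 x y K _ _ _)).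
- by move=> z zy; apply: df1; exact: le_trans yh.
- by move=> z zy; apply: df2; exact: le_trans yh.
- by move=> z zy; apply: f3K; exact: le_trans yh.
- rewrite ler_wpM2l//; first by apply: le_trans (f3K 0 _) => //; rewrite normr0.
  by rewrite -(@real_normK _ y) ?num_real// lerXn2r ?nnegrE.
Qed.

End taylor.

(** * A smooth approximation of the indicator of a half-line *)

Section logistic.
Context {R : realType}.
Implicit Types (l t x h : R).

(** Decreasing in x for positive [l], a substitute for the indicator of x <= t that sharpens as [l]
    grows. Since s' = l (s^2 - s), every derivative is a polynomial in s and so bounded uniformly in
    x. *)
Definition logistic l t x := (1 + expR (l * (x - t)))^-1.

Local Notation s := logistic.

Lemma logistic_gt0 l t x : 0 < logistic l t x.
Proof. by rewrite invr_gt0 addr_gt0// expR_gt0. Qed.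

Lemma logistic_le1 l t x : logistic l t x <= 1.
Proof. by rewrite invf_le1 ?addr_gt0 ?expR_gt0// lerDl expR_ge0. Qed.

Lemma is_derive_logistic l t x :
  is_derive x 1 (logistic l t) (l * (s l t x ^+ 2 - s l t x)).
Proof.
have E0 : 1 + expR (l * (x - t)) != 0 by rewrite gt_eqF// addr_gt0// expR_gt0.
have d1 : is_derive x 1 (fun y => l * (y - t)) (l *: (1 - 0)).
  by apply: is_deriveZ.
have d2 : is_derive x 1 (fun y => expR (l * (y - t)))
    (expR (l * (x - t)) * (l *: (1 - 0))).
  exact: (@is_derive1_comp _ expR (fun y => l * (y - t))).
have d3 : is_derive x 1 (fun y => 1 + expR (l * (y - t)))
    (0 + expR (l * (x - t)) * (l *: (1 - 0))).
  by apply: is_deriveD.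
have := @is_deriveV _ (fun y => 1 + expR (l * (y - t))) x _ 1 E0 d3; rewrite /logistic => d.
apply: (is_derive_eq d); rewrite /logistic /GRing.scale/= subr0 mulr1 add0r.
by move: E0; move: (expR _) => E E0; field.
Qed.

Lemma is_derive_logistic1 l t x :
  is_derive x 1 (fun y => l * (s l t y ^+ 2 - s l t y))
   (l ^+ 2 * ((2 * s l t x - 1) * (s l t x ^+ 2 - s l t x))).
Proof.
have d := is_derive_logistic l t x.
have dd : is_derive x 1 (fun y => l * (logistic l t y ^+ 2 - logistic l t y))
    (l *: ((2 * logistic l t x ^+ 1) *: (l * (s l t x ^+ 2 - s l t x))
       - l * (s l t x ^+ 2 - s l t x))).
  apply: is_deriveZ; apply: is_deriveB.
  by have := is_deriveX 2 d.
by apply: (is_derive_eq dd); rewrite /GRing.scale/=; ring.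
Qed.

Lemma is_derive_logistic2 l t x :
  is_derive x 1 (fun y => l ^+ 2 * ((2 * s l t y - 1) * (s l t y ^+ 2 - s l t y)))
   (l ^+ 3 * ((6 * s l t x ^+ 2 - 6 * s l t x + 1) * (s l t x ^+ 2 - s l t x))).
Proof.
have d := is_derive_logistic l t x.
set D := l * _ in d.
have dX : is_derive x 1 (fun y => logistic l t y ^+ 2 - logistic l t y)
    ((2 * logistic l t x ^+ 1) *: D - D).
  by apply: is_deriveB; have := is_deriveX 2 d.
have dL : is_derive x 1 (fun y => 2 * logistic l t y - 1) (2 *: D - 0).
  by apply: is_deriveB; apply: is_deriveZ.
have dd := is_deriveZ (l ^+ 2) (is_deriveM dL dX).
by apply: (is_derive_eq dd); rewrite /D /GRing.scale/=; ring.
Qed.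

(** The cubic branch bounds the third derivative; the quadratic one bounds the first order remainder
    and the second order term separately. [1 <= l] lets l^3 dominate l^2, so that one constant
    serves both. *)
Lemma logistic_taylor l t x h : 1 <= l ->
  `|logistic l t (x + h) - logistic l t x - l * (s l t x ^+ 2 - s l t x) * h
    - l ^+ 2 * ((2 * s l t x - 1) * (s l t x ^+ 2 - s l t x)) * h ^+ 2 / 2|
  <= 2 * l ^+ 3 * Num.min (h ^+ 2) (`|h| ^+ 3).
Proof.
move=> l1; have l0 : 0 <= l by lra.
have b0 y : `|s l t y ^+ 2 - s l t y| <= 1.
  have := logistic_gt0 l t y; have := logistic_le1 l t y; rewrite -/(logistic l t y).
  by move=> *; rewrite ler_norml; apply/andP; split; nra.
have b1 y : `|(2 * s l t y - 1) * (s l t y ^+ 2 - s l t y)| <= 1.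
  rewrite normrM -[leRHS]mulr1 ler_pM//.
  have := logistic_gt0 l t y; have := logistic_le1 l t y; rewrite -/(logistic l t y).
  by move=> *; rewrite ler_norml; apply/andP; split; lra.
have b2 y : `|(6 * s l t y ^+ 2 - 6 * s l t y + 1) * (s l t y ^+ 2 - s l t y)| <= 1.
  rewrite normrM -[leRHS]mulr1 ler_pM//.
  have := logistic_gt0 l t y; have := logistic_le1 l t y; rewrite -/(logistic l t y).
  move=> *; rewrite ler_norml; have := sqr_ge0 (2 * s l t y - 1).
  by move=> *; apply/andP; split; nra.
have l23 : l ^+ 2 <= l ^+ 3 by rewrite [leRHS]exprS ler_peMl// exprn_ge0.
rewrite minr_pMr; last by rewrite mulr_ge0// exprn_ge0.
rewrite le_min; apply/andP; split.
  apply: (@le_trans _ _ (l ^+ 2 * h ^+ 2 + l ^+ 2 * h ^+ 2)); last first.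
    by have := sqr_ge0 h; nra.
  rewrite (le_trans (ler_normB _ _))// lerD//.
    apply: (@taylor1_bound _ (logistic l t) (fun y => l * (s l t y ^+ 2 - s l t y))
     (fun y => l ^+ 2 * ((2 * s l t y - 1) * (s l t y ^+ 2 - s l t y)))).
    - by move=> y _; exact: is_derive_logistic.
    - by move=> y _; exact: is_derive_logistic1.
    - move=> y _; rewrite normrM ger0_norm ?exprn_ge0// -[leRHS]mulr1.
      by rewrite ler_wpM2l// exprn_ge0.
  have -> : l ^+ 2 * ((2 * s l t x - 1) * (s l t x ^+ 2 - s l t x)) * h ^+ 2 / 2
    = l ^+ 2 * (h ^+ 2 * ((2 * s l t x - 1) * (s l t x ^+ 2 - s l t x) / 2)) by ring.
  have l20 : 0 <= l ^+ 2 by rewrite exprn_ge0.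
  rewrite normrM (ger0_norm l20) ler_wpM2l// normrM (ger0_norm (sqr_ge0 h)).
  rewrite -[leRHS]mulr1 ler_wpM2l ?sqr_ge0// normrM normfV.
  have -> : `|2 : R| = 2 by rewrite ger0_norm.
  by rewrite ler_pdivrMr// mul1r (le_trans (b1 x))// ler1n.
apply: (@le_trans _ _ (l ^+ 3 * `|h| ^+ 3)); last first.
  by rewrite ler_wpM2r ?exprn_ge0// ler_peMl ?exprn_ge0// ler1n.
apply: (@taylor2_bound _ (logistic l t) (fun y => l * (s l t y ^+ 2 - s l t y))
  (fun y => l ^+ 2 * ((2 * s l t y - 1) * (s l t y ^+ 2 - s l t y)))
  (fun y => l ^+ 3 * ((6 * s l t y ^+ 2 - 6 * s l t y + 1) * (s l t y ^+ 2 - s l t y)))).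
- by move=> y _; exact: is_derive_logistic.
- by move=> y _; exact: is_derive_logistic1.
- by move=> y _; exact: is_derive_logistic2.
- move=> y _; rewrite normrM ger0_norm ?exprn_ge0// -[leRHS]mulr1.
  by rewrite ler_wpM2l// exprn_ge0.
Qed.

Lemma logistic_unit_fun l t : unit_fun (logistic l t).
Proof.
split; last by move=> x; rewrite ltW ?logistic_gt0//= logistic_le1.
apply: continuous_measurable_fun => x.
apply: differentiable_continuous; apply/derivable1_diffP.
by have [] := is_derive_logistic l t x.
Qed.

End logistic.

(** * Inequalities for the exponential *)

Section exponential_bounds.
Context {R : realType}.
Implicit Types (u z t : R).

Lemma expR_taylor1 u : `|expR u - 1 - u| <= expR `|u| * u ^+ 2.
Proof.
have := @taylor1_bound R expR expR expR 0 u (expR `|u|).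
rewrite add0r expR0 mul1r; apply=> y yu; rewrite add0r ger0_norm ?expR_ge0// ler_expR.
by rewrite (le_trans (ler_norm y)).
Qed.

Lemma expR_taylor2 u : `|expR u - 1 - u - u ^+ 2 / 2| <= expR `|u| * `|u| ^+ 3.
Proof.
have := @taylor2_bound R expR expR expR expR 0 u (expR `|u|).
rewrite add0r expR0 !mul1r; apply=> y yu; rewrite add0r ger0_norm ?expR_ge0// ler_expR.
by rewrite (le_trans (ler_norm y)).
Qed.

Lemma expR_norm_le z : expR `|z| <= expR z + expR (- z).
Proof.
by have [z0|z0] := leP 0 z; [rewrite ger0_norm// lerDl|rewrite ltr0_norm// lerDr]; exact: expR_ge0.
Qed.

(** The inequality |z| / n <= exp(|z| / n), raised to the power n. *)
Lemma powX_le_expR n z : `|z| ^+ n <= n%:R ^+ n * expR `|z|.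
Proof.
case: n => [|n]; first by rewrite !expr0 mul1r -expR0 ler_expR.
have n0 : 0 < n.+1%:R :> R by rewrite ltr0n.
have -> : expR `|z| = expR (`|z| / n.+1%:R) ^+ n.+1.
  by rewrite -expRM_natl mulrC divfK// gt_eqF.
rewrite -exprMn lerXn2r ?nnegrE ?mulr_ge0 ?expR_ge0//.
rewrite mulrC -ler_pdivrMr//; apply: le_trans (expR_ge1Dx _).
by rewrite lerDr.
Qed.

End exponential_bounds.

Lemma eq0_of_le_linear {R : realType} (a C : R) :
  (forall t, 0 < t <= 1 -> `|a| <= C * t) -> a = 0.
Proof.
move=> H; apply/eqP; rewrite -normr_le0; apply/ler_addgt0Pl => e e0.
rewrite addr0; have C0 : 0 <= `|C| by [].
pose t := Num.min 1 (e / (1 + `|C|)).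
have D0 : 0 < 1 + `|C| by lra.
have t0 : 0 < t by rewrite /t lt_min ltr01 divr_gt0.
have t1 : t <= 1 by rewrite /t ge_min lexx.
apply: (le_trans (H t _)); first by rewrite t0.
apply: (@le_trans _ _ ((1 + `|C|) * t)).
  by rewrite ler_wpM2r ?(ltW t0)// (le_trans (ler_norm C))//; lra.
by rewrite mulrC -ler_pdivlMr// /t ge_min lexx orbT.
Qed.

(** * Moments of the centred Gaussian law *)

Section gaussian_moments.
Context {R : realType} (s : R).
Hypothesis s0 : 0 < s.
Let N := normal_prob 0 s.

Let mid : measurable_fun setT (fun z : measurableTypeR R => z : R). Proof. exact: measurable_id. Qed.

Lemma L1_expR_norm_normal t : L1 N (fun z => expR (t * z) + expR (- (t * z))).
Proof.
apply: L1D; first exact: L1_expR_normal.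
have := @L1_expR_normal R s (- t) s0.
by under [X in L1 _ X -> _]eq_fun do rewrite mulNr.
Qed.

Lemma L1_pow_normal n : L1 N (fun z => `|z| ^+ n).
Proof.
have mf : measurable_fun setT (fun z : measurableTypeR R => `|z : R| ^+ n).
  by apply: measurable_funX; exact: normr_measurable.
have lg := L1Z (n%:R ^+ n) (L1_expR_norm_normal 1).
apply: (L1_le mf lg) => z; rewrite ger0_norm ?exprn_ge0// (le_trans (powX_le_expR n z))// mul1r.
by rewrite ler_wpM2l ?exprn_ge0// expR_norm_le.
Qed.

Lemma L1_id_normal : L1 N id.
Proof.
by apply: (L1_le mid (L1_pow_normal 1)) => z; rewrite expr1.
Qed.

Lemma L1_sqr_normal : L1 N (fun z => z ^+ 2).
Proof.
have mf : measurable_fun setT (fun z : measurableTypeR R => (z : R) ^+ 2).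
  exact: measurable_funX.
by apply: (L1_le mf (L1_pow_normal 2)) => z; rewrite normrX.
Qed.

(** Read off the moment generating function. Expanding both sides of E exp(t N) = exp(t^2 s^2 / 2)
    to second order gives t m1 + t^2 (m2 - s^2) / 2 = O(|t|^3), which forces both coefficients to
    vanish. *)
Lemma normal_moments : Ex N id = 0 /\ Ex N (fun z => z ^+ 2) = s ^+ 2.
Proof.
set m1 := Ex N id; set m2 := Ex N _.
have lE := L1_expR_norm_normal 2.
(* 27 = 3^3 comes from [powX_le_expR] for the cube. The exponent is doubled because exp|z| occurs
   twice: in the bound of the cube and in the Taylor remainder of exp(t z). *)
pose C := 27 * Ex N (fun z => expR (2 * z) + expR (- (2 * z))).
pose C' := expR (s ^+ 2 / 2) * (s ^+ 2 / 2) ^+ 2.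
have H t : `|t| <= 1 ->
    `|t * m1 + t ^+ 2 * ((m2 - s ^+ 2) / 2)| <= (C + C') * `|t| ^+ 3.
  move=> t1.
  have l1 : L1 N (fun z => t * z) by apply: L1Z; exact: L1_id_normal.
  have l2 : L1 N (fun z => t ^+ 2 / 2 * z ^+ 2) by apply: L1Z; exact: L1_sqr_normal.
  have le := L1_expR_normal t s0.
  have lc : L1 N (fun=> 1) by exact: L1_cst.
  have lr : L1 N (fun z => expR (t * z) - 1 - t * z - t ^+ 2 / 2 * z ^+ 2).
    by apply: L1B => //; apply: L1B => //; exact: L1B.
  have A : `|expR (t ^+ 2 * s ^+ 2 / 2) - 1 - t * m1 - t ^+ 2 / 2 * m2|
      <= C * `|t| ^+ 3.
    have -> : expR (t ^+ 2 * s ^+ 2 / 2) - 1 - t * m1 - t ^+ 2 / 2 * m2 =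
        Ex N (fun z => expR (t * z) - 1 - t * z - t ^+ 2 / 2 * z ^+ 2).
      rewrite (ExB (L1B (L1B le lc) l1) l2) (ExB (L1B le lc) l1) (ExB le lc).
      rewrite (ExZ t L1_id_normal) (ExZ (t ^+ 2 / 2) L1_sqr_normal).
      by rewrite (Ex_expR_normal t s0) Ex_cst.
    apply: (le_trans (norm_Ex lr)).
    have -> : C * `|t| ^+ 3 =
      Ex N (fun z => 27 * `|t| ^+ 3 * (expR (2 * z) + expR (- (2 * z)))).
      by rewrite (ExZ _ lE) /C; ring.
    apply: Ex_le; [exact: L1_norm|exact: L1Z|] => z.
    have -> : t ^+ 2 / 2 * z ^+ 2 = (t * z) ^+ 2 / 2 by rewrite exprMn; ring.
    apply: (le_trans (expR_taylor2 (t * z))).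
    rewrite normrM exprMn.
    have e1 : expR (`|t| * `|z|) <= expR `|z| by rewrite ler_expR ler_piMl.
    have e2 : `|z| ^+ 3 <= 27 * expR `|z|.
      by rewrite (le_trans (powX_le_expR 3 z))// -natrX.
    have e3 : expR `|z| * expR `|z| <= expR (2 * z) + expR (- (2 * z)).
      rewrite -expRD; apply: le_trans (expR_norm_le (2 * z)).
      have n2 : `|2 : R| = 2 by rewrite ger0_norm.
      by rewrite normrM n2 ler_expR; lra.
    apply: (@le_trans _ _ (expR `|z| * (`|t| ^+ 3 * (27 * expR `|z|)))).
      have p0 : 0 <= `|t| ^+ 3 * `|z| ^+ 3 by rewrite mulr_ge0 ?exprn_ge0.
      have q : `|t| ^+ 3 * `|z| ^+ 3 <= `|t| ^+ 3 * (27 * expR `|z|).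
        by rewrite ler_wpM2l ?exprn_ge0.
      exact: ler_pM (expR_ge0 _) p0 e1 q.
    have -> : expR `|z| * (`|t| ^+ 3 * (27 * expR `|z|)) =
      27 * `|t| ^+ 3 * (expR `|z| * expR `|z|) by ring.
    by rewrite ler_wpM2l// mulr_ge0 ?exprn_ge0.
  have B : `|expR (t ^+ 2 * s ^+ 2 / 2) - 1 - t ^+ 2 * s ^+ 2 / 2| <= C' * `|t| ^+ 3.
    apply: (le_trans (expR_taylor1 _)).
    have t2 : t ^+ 2 <= 1 by rewrite -real_normK ?num_real// exprn_ile1.
    have a0 : 0 <= t ^+ 2 * s ^+ 2 / 2 by rewrite divr_ge0// mulr_ge0// sqr_ge0.
    rewrite (ger0_norm a0) /C' -[leRHS]mulrA; apply: ler_pM.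
    - exact: expR_ge0.
    - exact: sqr_ge0.
    - by rewrite ler_expR -mulrA ler_piMl// divr_ge0// sqr_ge0.
    have -> : (t ^+ 2 * s ^+ 2 / 2) ^+ 2 = (s ^+ 2 / 2) ^+ 2 * (`|t| ^+ 3 * `|t|).
      by rewrite -(@real_normK _ t) ?num_real//; ring.
    by rewrite ler_wpM2l ?sqr_ge0// ler_piMr// exprn_ge0.
  have -> : t * m1 + t ^+ 2 * ((m2 - s ^+ 2) / 2) =
    (expR (t ^+ 2 * s ^+ 2 / 2) - 1 - t ^+ 2 * s ^+ 2 / 2) -
    (expR (t ^+ 2 * s ^+ 2 / 2) - 1 - t * m1 - t ^+ 2 / 2 * m2) by field.
  by rewrite (le_trans (ler_normB _ _))// mulrDl addrC lerD.
(* Subtracting the bounds at [t] and [- t] eliminates the quadratic term. *)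
have m10 : m1 = 0.
  apply: (@eq0_of_le_linear _ _ (C + C')) => t /andP[t0 t1].
  have := H t; have := H (- t); rewrite normrN (gtr0_norm t0) => /(_ t1) + /(_ t1).
  rewrite sqrrN mulNr !ler_norml => /andP[a b] /andP[c d].
  have K0 : (C + C') * t ^+ 3 <= (C + C') * t * t.
    have -> : (C + C') * t ^+ 3 = (C + C') * t * t * t by ring.
    rewrite ler_piMr//; have : 0 <= (C + C') * t ^+ 3 by lra.
    rewrite pmulr_lge0 ?exprn_gt0// => K; by rewrite !mulr_ge0// ltW.
  by apply/andP; split; rewrite -(ler_pM2r t0) ?mulNr; lra.
split=> //; apply/eqP; rewrite -subr_eq0; apply/eqP.
suff : (m2 - s ^+ 2) / 2 = 0 by lra.
apply: (@eq0_of_le_linear _ _ (C + C')) => t /andP[t0 t1].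
have := H t; rewrite (gtr0_norm t0) m10 mulr0 add0r normrM => /(_ t1).
have t20 : 0 < t ^+ 2 by rewrite exprn_gt0.
rewrite (gtr0_norm t20) => h; rewrite -(ler_pM2l t20) (le_trans h)//.
by have -> : t ^+ 2 * ((C + C') * t) = (C + C') * t ^+ 3 by ring.
Qed.

(** Exponential moments are taken of N / s so that the bound scales like s^3: for n summands of
    deviation s / sqrt n the total is O(1 / sqrt n). 54 is twice 27, one for each sign in the
    exponential. *)
Lemma Ex_norm3_normal : Ex N (fun z => `|z| ^+ 3) <= 54 * expR (1 / 2) * s ^+ 3.
Proof.
have lE : L1 N (fun z => expR (s^-1 * z) + expR (- (s^-1 * z))).
  exact: L1_expR_norm_normal.
apply: (@le_trans _ _ (Ex N (fun z => s ^+ 3 * 27 *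
   (expR (s^-1 * z) + expR (- (s^-1 * z)))))).
  apply: Ex_le; [exact: L1_pow_normal|exact: L1Z|] => z.
  have -> : `|z| ^+ 3 = s ^+ 3 * `|s^-1 * z| ^+ 3.
    rewrite normrM exprMn mulrA -exprMn gtr0_norm ?invr_gt0// mulfV ?gt_eqF//.
    by rewrite expr1n mul1r.
  rewrite -mulrA ler_wpM2l ?exprn_ge0 ?(ltW s0)//.
  apply: (le_trans (powX_le_expR 3 _)).
  by rewrite -natrX ler_wpM2l// expR_norm_le.
have e1 : Ex N (fun z => expR (s^-1 * z)) = expR (1 / 2).
  rewrite (Ex_expR_normal _ s0); congr expR.
  by rewrite -exprMn mulVf ?gt_eqF// expr1n.
have e2 : Ex N (fun z => expR (- (s^-1 * z))) = expR (1 / 2).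
  have -> : (fun z => expR (- (s^-1 * z))) = (fun z => expR (- s^-1 * z)).
    by apply/funext => z; rewrite mulNr.
  rewrite (Ex_expR_normal _ s0); congr expR.
  by rewrite sqrrN -exprMn mulVf ?gt_eqF// expr1n.
have l2 : L1 N (fun z => expR (- (s^-1 * z))).
  have := @L1_expR_normal R s (- s^-1) s0.
  by under [X in L1 _ X -> _]eq_fun do rewrite mulNr.
by rewrite (ExZ _ lE) (ExD (L1_expR_normal s^-1 s0) l2) e1 e2; lra.
Qed.

End gaussian_moments.

(** * The central limit theorem for logistic test functions *)

Section central_limit.
Context {d d1} {T : measurableType d} {S : measurableType d1} {R : realType}
  (P : probability T R).

(** Up to the remainder, one step depends on the law of [X] only through its mean and variance,
    hence is the same for a summand and for the matching Gaussian. *)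
Lemma avg_taylor2 (X : T -> R) (g g1 g2 rho : R -> R) x :
  unit_fun g -> L1 P X -> Ex P X = 0 -> L1 P (fun w => X w ^+ 2) ->
  L1 P (rho \o X) ->
  (forall y, `|g (x + y) - g x - g1 x * y - g2 x * y ^+ 2 / 2| <= rho y) ->
  `|avg P X g x - (g x + g2 x / 2 * Ex P (fun w => X w ^+ 2))| <= Ex P (rho \o X).
Proof.
move=> ug lX X0 lX2 lrho H; have mX := L1_measurable lX.
have lgX := unit_fun_L1 P x mX ug.
have l1 : L1 P (fun w => g1 x * X w) by exact: L1Z.
have l2 : L1 P (fun w => g2 x / 2 * X w ^+ 2) by exact: L1Z.
have lc : L1 P (fun=> g x) by exact: L1_cst.
have lr : L1 P (fun w => g (x + X w) - g x - g1 x * X w - g2 x / 2 * X w ^+ 2).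
  by apply: L1B => //; apply: L1B => //; exact: L1B.
have -> : avg P X g x - (g x + g2 x / 2 * Ex P (fun w => X w ^+ 2)) =
    Ex P (fun w => g (x + X w) - g x - g1 x * X w - g2 x / 2 * X w ^+ 2).
  rewrite (ExB (L1B (L1B lgX lc) l1) l2) (ExB (L1B lgX lc) l1) (ExB lgX lc).
  rewrite (ExZ (g1 x) lX) (ExZ (g2 x / 2) lX2) X0 Ex_cst mulr0 subr0 opprD addrA.
  by [].
apply: (le_trans (norm_Ex lr)); apply: Ex_le => //; first exact: L1_norm.
move=> w; apply: le_trans (H (X w)).
by rewrite (_ : g2 x / 2 * X w ^+ 2 = g2 x * X w ^+ 2 / 2)//; ring.
Qed.

End central_limit.

Lemma cvg_inv_sqrt {R : realType} : (fun n => (Num.sqrt n%:R)^-1 : R) @ \oo --> (0 : R).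
Proof.
apply/cvgrPdist_le => e e0.
have [N _ HN] : \forall n \near \oo, (e^-1) ^+ 2 <= n%:R :> R by exact: nbhs_infty_ger.
exists N.+1 => // n /= Nn; have n0 : 0 < n%:R :> R by rewrite ltr0n (leq_trans _ Nn).
rewrite sub0r normrN ger0_norm ?invr_ge0 ?sqrtr_ge0//.
rewrite -[leRHS]invrK lef_pV2 ?posrE ?sqrtr_gt0 ?invr_gt0//.
rewrite -(ger0_norm (_ : 0 <= e^-1)) ?invr_ge0 ?(ltW e0)// -sqrtr_sqr.
by rewrite ler_wsqrtr//; apply: HN; exact: ltnW Nn.
Qed.

Section central_limit_theorem.
Context {d d1} {T : measurableType d} {S : measurableType d1} {R : realType}
  (P : probability T R).
Variables (O : nat -> T -> S) (O0 : T -> S).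
Hypothesis iidO : iid_copies P O O0.
Variable h : S -> R.
Hypotheses (mh : measurable_fun setT h) (lX : L1 P (h \o O0))
  (X0 : Ex P (h \o O0) = 0) (lX2 : L1 P (fun w => h (O0 w) ^+ 2)).
Variable s : R.
Hypotheses (s0 : 0 < s) (Es : Ex P (fun w => h (O0 w) ^+ 2) = s ^+ 2).

Definition clt_sum n w := (Num.sqrt n%:R)^-1 * \sum_(i < n) h (O i w).

Lemma measurable_clt_sum n : measurable_fun setT (clt_sum n).
Proof. by apply: measurable_funM => //; exact: (measurable_iid_sum iidO). Qed.

Let rho (l y : R) := 2 * l ^+ 3 * Num.min (y ^+ 2) (`|y| ^+ 3).

Let rho_ge0 l y : 1 <= l -> 0 <= rho l y.
Proof.
move=> l1; rewrite mulr_ge0// ?le_min ?sqr_ge0 ?exprn_ge0//.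
by rewrite mulr_ge0// exprn_ge0//; lra.
Qed.

Let measurable_rho l : measurable_fun setT (rho l).
Proof.
apply: measurable_funM => //; apply: measurable_minr; first exact: measurable_funX.
by apply: measurable_funX; exact: normr_measurable.
Qed.

(** This is n times [rho l] of the summand h / sqrt n. It is dominated by a multiple of h^2 and
    tends to 0 at each point, so no third moment of h enters. *)
Let F l n w := 2 * l ^+ 3 *
  Num.min (h (O0 w) ^+ 2) ((Num.sqrt n%:R)^-1 * `|h (O0 w)| ^+ 3).

Let F_le l n w : 1 <= l -> `|F l n w| <= 2 * l ^+ 3 * h (O0 w) ^+ 2.
Proof.
move=> l1; have l3 : 0 <= 2 * l ^+ 3 by rewrite mulr_ge0// exprn_ge0//; lra.
rewrite ger0_norm; last first.
  by rewrite mulr_ge0// le_min sqr_ge0 mulr_ge0 ?invr_ge0 ?sqrtr_ge0 ?exprn_ge0.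
by rewrite ler_wpM2l// ge_min lexx.
Qed.

Let measurable_F l n : measurable_fun setT (F l n).
Proof.
have mX := L1_measurable lX.
apply: measurable_funM => //; apply: measurable_minr; first exact: L1_measurable lX2.
apply: measurable_funM => //; apply: measurable_funX.
by apply: measurableT_comp mX; exact: normr_measurable.
Qed.

Let L1_F l n : 1 <= l -> L1 P (F l n).
Proof.
move=> l1; apply: (L1_le (measurable_F l n) (L1Z (2 * l ^+ 3) lX2)) => w.
exact: F_le.
Qed.

Let cvg_F l : 1 <= l -> (fun n => Ex P (F l n)) @ \oo --> (0 : R).
Proof.
move=> l1; rewrite -(Ex_cst P 0).
apply: (cvg_Ex (measurable_F l) _ (L1Z (2 * l ^+ 3) lX2)) => //.
  by move=> n w; exact: F_le.
move=> w.
apply: (@squeeze_cvgr _ _ _ _ (fun=> 0)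
  (fun n => 2 * l ^+ 3 * ((Num.sqrt n%:R)^-1 * `|h (O0 w)| ^+ 3))).
- near=> n; have l3 : 0 <= 2 * l ^+ 3 by rewrite mulr_ge0// exprn_ge0//; lra.
  rewrite /F mulr_ge0//=; last first.
    by rewrite le_min sqr_ge0 mulr_ge0 ?invr_ge0 ?sqrtr_ge0 ?exprn_ge0.
  by rewrite ler_wpM2l// ge_min lexx orbT.
- exact: cvg_cst.
- have : (fun n => 2 * l ^+ 3 * ((Num.sqrt n%:R)^-1 * `|h (O0 w)| ^+ 3)) @ \oo -->
      2 * l ^+ 3 * (0 * `|h (O0 w)| ^+ 3).
    apply: cvgM; first exact: cvg_cst.
    by apply: cvgM; [exact: cvg_inv_sqrt|exact: cvg_cst].
  by rewrite mul0r mulr0.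
Unshelve. all: by end_near. Qed.

Let C := 54 * expR (1 / 2) * s ^+ 3.

Lemma dist_clt_logistic l t n : 1 <= l -> (0 < n)%N ->
  `|Ex P (fun w => logistic l t (clt_sum n w)) - Ex (normal_prob 0 s) (logistic l t)|
    <= Ex P (F l n) + 2 * l ^+ 3 * C * (Num.sqrt n%:R)^-1.
Proof.
move=> l1 n0; have l3 : 0 <= 2 * l ^+ 3 by rewrite mulr_ge0// exprn_ge0//; lra.
have nr0 : 0 < n%:R :> R by rewrite ltr0n.
have q0 : 0 < Num.sqrt n%:R :> R by rewrite sqrtr_gt0.
have c0 : 0 < (Num.sqrt n%:R)^-1 :> R by rewrite invr_gt0.
have cc : n%:R * (Num.sqrt n%:R)^-1 ^+ 2 = 1 :> R.
  by rewrite exprVn sqr_sqrtr ?ler0n// mulfV// gt_eqF.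
have cq : Num.sqrt n%:R * (Num.sqrt n%:R)^-1 = 1 :> R by rewrite mulfV// gt_eqF.
rewrite /clt_sum.
set c := (Num.sqrt n%:R)^-1 in c0 cc cq *.
have ec : (Num.sqrt n%:R)^-1 = c by [].
clearbody c.
have ug := logistic_unit_fun l t.
pose k x := c * h x.
have mk : measurable_fun setT k by exact: measurable_funM.
have lk : L1 P (k \o O0) by exact: L1Z.
have k0 : Ex P (k \o O0) = 0 by rewrite /k /comp ExZ// X0 mulr0.
have lk2 : L1 P (fun w => k (O0 w) ^+ 2).
  by rewrite /k; under [X in L1 _ X]eq_fun do rewrite exprMn; exact: L1Z.
have Ek2 : Ex P (fun w => k (O0 w) ^+ 2) = (c * s) ^+ 2.
  by rewrite /k; under eq_Ex do rewrite exprMn; rewrite ExZ// Es exprMn.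
have cs0 : 0 < c * s by rewrite mulr_gt0.
have mrhok : measurable_fun setT (rho l \o (k \o O0)).
  by apply: measurableT_comp => //; exact: L1_measurable lk.
have lrhok : L1 P (rho l \o (k \o O0)).
  apply: (L1_le mrhok (L1Z (2 * l ^+ 3) lk2)) => w /=.
  by rewrite ger0_norm ?rho_ge0// /rho ler_wpM2l// ge_min lexx.
have [m1 m2] := normal_moments cs0.
have mrhoN : measurable_fun setT (fun z : measurableTypeR R => rho l z).
  exact: measurable_rho.
have lrhoN : L1 (normal_prob 0 (c * s)) (fun z : measurableTypeR R => rho l z).
  apply: (L1_le mrhoN (L1Z (2 * l ^+ 3) (L1_sqr_normal cs0))) => w /=.
  by rewrite ger0_norm ?rho_ge0// /rho ler_wpM2l// ge_min lexx.
pose e := Ex P (rho l \o (k \o O0)) + Ex (normal_prob 0 (c * s)) (rho l).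
have step x : `|avg P (k \o O0) (logistic l t) x -
    avg (normal_prob 0 (c * s)) id (logistic l t) x| <= e.
  pose f := logistic l t.
  pose g1 x := l * (f x ^+ 2 - f x).
  pose g2 x := l ^+ 2 * ((2 * f x - 1) * (f x ^+ 2 - f x)).
  have tay y : `|f (x + y) - f x - g1 x * y - g2 x * y ^+ 2 / 2| <= rho l y.
    exact: logistic_taylor.
  have A := avg_taylor2 ug lk k0 lk2 lrhok tay.
  have B := avg_taylor2 ug (L1_id_normal cs0) m1 (L1_sqr_normal cs0) lrhoN tay.
  rewrite Ek2 in A; rewrite m2 distrC in B.
  by rewrite (le_trans (ler_distD _ _ _) (lerD A B)).
have mid : measurable_fun setT (fun z : measurableTypeR R => z : R).
  exact: measurable_id.
have D := dist_iter_avg (L1_measurable lk) mid ug step n 0.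
have E1 : Ex P (fun w => logistic l t (c * \sum_(i < n) h (O i w))) =
    iter n (avg P (k \o O0)) (logistic l t) 0.
  rewrite -(Ex_iid_sum iidO mk n 0 ug); apply: eq_Ex => w.
  by rewrite add0r mulr_sumr.
(* The Gaussian limit is itself a sum of n independent Gaussians of deviation s / sqrt n, so both
   sides are n-fold iterates. *)
have E2 : Ex (normal_prob 0 s) (logistic l t) =
    iter n (avg (normal_prob 0 (c * s)) id) (logistic l t) 0.
  have it := iter_avg_normal n.-1 cs0 ug.
  have es : Num.sqrt n%:R * (c * s) = s by rewrite mulrA cq mul1r.
  rewrite (prednK n0) es in it.
  apply: (etrans _ (esym (congr1 (fun f => f 0) it))).
  by apply: eq_Ex => z; rewrite add0r.
rewrite E1 E2; apply: (le_trans D).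
rewrite /e mulrDr; apply: lerD.
  rewrite -ExZ//; apply: Ex_le => //; [exact: L1Z|exact: L1_F|] => w.
  rewrite /rho /F /= /k ec mulrCA ler_wpM2l// minr_pMr ?ler0n//.
  rewrite exprMn mulrA cc mul1r le_min ge_min lexx/= ge_min.
  rewrite normrM (gtr0_norm c0) exprMn (exprS c 2).
  have -> : n%:R * (c * c ^+ 2 * `|h (O0 w)| ^+ 3) = n%:R * c ^+ 2 * (c * `|h (O0 w)| ^+ 3).
    by ring.
  by rewrite cc mul1r lexx orbT.
apply: (@le_trans _ _ (n%:R * (2 * l ^+ 3 * (54 * expR (1 / 2) * (c * s) ^+ 3)))).
  rewrite ler_wpM2l ?ler0n//.
  apply: (@le_trans _ _ (2 * l ^+ 3 * Ex (normal_prob 0 (c * s)) (fun z => `|z| ^+ 3))).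
    rewrite -(ExZ (2 * l ^+ 3) (L1_pow_normal cs0 3)).
    apply: (Ex_le lrhoN (L1Z (2 * l ^+ 3) (L1_pow_normal cs0 3))) => z.
    by rewrite /rho ler_wpM2l// ge_min lexx orbT.
  by rewrite ler_wpM2l//; exact: Ex_norm3_normal.
have -> : n%:R * (2 * l ^+ 3 * (54 * expR (1 / 2) * (c * s) ^+ 3)) =
  n%:R * c ^+ 2 * (2 * l ^+ 3 * C * c) by rewrite /C; ring.
by rewrite cc mul1r.
Qed.

Lemma clt_logistic l t : 1 <= l ->
  Ex P (fun w => logistic l t (clt_sum n w)) @[n --> \oo] -->
  Ex (normal_prob 0 s) (logistic l t).
Proof.
move=> l1; apply/subr_cvg0/norm_cvg0P.
apply: (@squeeze_cvgr _ _ _ _ (fun=> 0)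
  (fun n => Ex P (F l n) + 2 * l ^+ 3 * C * (Num.sqrt n%:R)^-1)).
- by exists 1%N => // n /= n1; rewrite normr_ge0/= dist_clt_logistic.
- exact: cvg_cst.
- have : (fun n => Ex P (F l n) + 2 * l ^+ 3 * C * (Num.sqrt n%:R)^-1) @ \oo -->
      0 + 2 * l ^+ 3 * C * 0.
    apply: cvgD; first exact: cvg_F.
    by apply: cvgM; [exact: cvg_cst|exact: cvg_inv_sqrt].
  by rewrite mulr0 addr0.
Qed.

End central_limit_theorem.

(** * Distribution functions sandwiched between logistic expectations *)

Section logistic_sandwich.
Context {d} {T : measurableType d} {R : realType} (P : probability T R).
Implicit Types (l t e : R).

Lemma measurable_le_cst (W : T -> R) t : measurable_fun setT W ->
  measurable [set w | W w <= t].
Proof.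
move=> mW; rewrite -[X in measurable X]setTI.
exact: measurable_fun_le.
Qed.

Lemma measurable_norm_ge (W : T -> R) t : measurable_fun setT W ->
  measurable [set w | t <= `|W w|].
Proof.
move=> mW; rewrite -[X in measurable X]setTI.
apply: measurable_fun_le => //.
by apply: measurableT_comp mW; exact: normr_measurable.
Qed.

Lemma logistic_L1 l t (W : T -> R) : measurable_fun setT W ->
  L1 P (fun w => logistic l t (W w)).
Proof.
move=> mW; have := unit_fun_L1 P 0 mW (logistic_unit_fun l t).
by under [X in L1 _ X -> _]eq_fun do rewrite add0r.
Qed.

(** With q = exp(- l e), the logistic function centred at t + e is at least 1 / (1 + q), hence at
    least 1 - q, on the event W <= t. *)
Lemma Pr_le_logistic l e t (W : T -> R) : 0 <= l -> measurable_fun setT W ->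
  Pr P [set w | W w <= t] <= Ex P (fun w => logistic l (t + e) (W w)) + expR (- (l * e)).
Proof.
move=> l0 mW; have lf := logistic_L1 l (t + e) mW.
rewrite -[X in _ <= _ + X](Ex_cst P) -(ExD lf (L1_cst P _)).
apply: Pr_le_Ex; first exact: measurable_le_cst.
- by apply: L1D => //; exact: L1_cst.
- by move=> w; rewrite addr_ge0 ?expR_ge0// ltW// logistic_gt0.
move=> w /= Wt; set q := expR (- (l * e)); have q0 : 0 < q by exact: expR_gt0.
have H : expR (l * (W w - (t + e))) <= q.
  rewrite ler_expR -mulrN ler_wpM2l//; lra.
have E0 := expR_gt0 (l * (W w - (t + e))).
rewrite /logistic -lerBlDr -[leLHS]invrK.
have [q1|q1] := leP 1 q.
  by rewrite invrK (@le_trans _ _ 0)// ?invr_ge0; lra.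
rewrite lef_pV2 ?posrE ?invr_gt0; [|lra|lra].
rewrite -[leRHS]mul1r ler_pdivlMr; last lra.
by have := mulr_ge0 (ltW E0) (ltW q0); nra.
Qed.

(** Beyond t + e the logistic function centred at t is at most exp(- l e). *)
Lemma logistic_le_Pr l e t (W : T -> R) : 0 <= l -> measurable_fun setT W ->
  Ex P (fun w => logistic l t (W w)) <= Pr P [set w | W w <= t + e] + expR (- (l * e)).
Proof.
move=> l0 mW; have lf := logistic_L1 l t mW.
rewrite -lerBlDr -[X in _ - X](Ex_cst P) -(ExB lf (L1_cst P _)).
apply: Ex_le_Pr; first exact: measurable_le_cst.
- by apply: L1B => //; exact: L1_cst.
- move=> w; rewrite lerBlDr (le_trans (logistic_le1 _ _ _))//.
  by rewrite lerDl expR_ge0.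
move=> w /= /negP; rewrite -ltNge => Wt; rewrite subr_le0 /logistic.
rewrite expRN lef_pV2 ?posrE ?expR_gt0 ?addr_gt0 ?expR_gt0//.
apply: (@le_trans _ _ (expR (l * (W w - t)))); last by rewrite lerDr.
by rewrite ler_expR ler_wpM2l//; lra.
Qed.

End logistic_sandwich.

(** * Continuity of the normal distribution function *)

Section normal_cdf.
Context {R : realType} (s : R).
Hypothesis s0 : 0 < s.

Let mid : measurable_fun setT (fun z : measurableTypeR R => z : R).
Proof. exact: measurable_id. Qed.

Definition normal_Pr_le (t : R) := Pr (normal_prob 0 s) [set z | z <= t].

Lemma normal_cdfE t : normal_cdf (s ^+ 2) t = normal_Pr_le t.
Proof. by rewrite /normal_cdf sqrtr_sqr gtr0_norm. Qed.

(** The density is bounded by its peak. This absorbs the shifts of the threshold made by the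
    sandwich. *)
Lemma normal_Pr_le_lipschitz a b : a <= b ->
  normal_Pr_le b <= normal_Pr_le a + normal_peak s * (b - a).
Proof.
move=> ab; have mI : measurable (`]a, b]%classic : set (measurableTypeR R)) by [].
have mA : measurable ([set z | z <= a] : set (measurableTypeR R)).
  exact: (measurable_le_cst a mid).
have mB : measurable ([set z | z <= b] : set (measurableTypeR R)).
  exact: (measurable_le_cst b mid).
apply: (@le_trans _ _ (Pr (normal_prob 0 s) ([set z | z <= a] `|` `]a, b]%classic))).
  apply: le_Pr => //; first exact: measurableU.
  move=> z /= zb; have [za|za] := leP z a; first by left.
  by right; rewrite in_itv/= za.
apply: (le_trans (PrU _ mA mI)); apply: lerD => //.
rewrite -lee_fin -(EFin_Pr _ mI).
apply: (@le_trans _ _ (\int[lebesgue_measure]_(x in `]a, b]) (normal_peak s)%:E)%E).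
  apply: ge0_le_integral => //.
  - by move=> x _; rewrite lee_fin normal_pdf_ge0.
  - by apply/measurable_EFinP/measurable_funTS; exact: measurable_normal_pdf.
  - by move=> x _; rewrite lee_fin normal_pdf_ub// gt_eqF.
rewrite integral_cst//= lebesgue_measure_itv/= lte_fin.
by case: ltP => ab'; [rewrite -EFinB -EFinM|
  rewrite mule0 lee_fin mulr_ge0 ?subr_ge0 ?normal_peak_ge0].
Qed.

End normal_cdf.

Lemma ler_dist_le {R : realType} (a b c e : R) :
  a <= c -> `|a - b| < e -> b <= c + e.
Proof. by move=> ac; rewrite ltr_norml => /andP[? ?]; lra. Qed.

(** * Convergence in distribution up to a vanishing perturbation *)

Section slutsky.
Context {d d1} {T : measurableType d} {S : measurableType d1} {R : realType}
  (P : probability T R).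
Variables (O : nat -> T -> S) (O0 : T -> S).
Hypothesis iidO : iid_copies P O O0.
Variable h : S -> R.
Hypotheses (mh : measurable_fun setT h) (lX : L1 P (h \o O0))
  (X0 : Ex P (h \o O0) = 0) (lX2 : L1 P (fun w => h (O0 w) ^+ 2)).
Variable s : R.
Hypotheses (s0 : 0 < s) (Es : Ex P (fun w => h (O0 w) ^+ 2) = s ^+ 2).
Variable V : nat -> T -> R.
Hypothesis mV : forall n, measurable_fun setT (V n).
Hypothesis VW : forall e, 0 < e ->
  Pr P [set w | e <= `|V n w - clt_sum O h n w|] @[n --> \oo] --> (0 : R).

Lemma clt_slutsky : cvg_in_dist_normal P V (s ^+ 2).
Proof.
move=> t; rewrite (normal_cdfE s0).
set Phi := normal_Pr_le s.
change ((fun n => Pr P [set w | V n w <= t]) @ \oo --> Phi t).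
apply/cvgrPdist_le => eps eps0.
have pk0 : 0 < normal_peak s by rewrite normal_peak_gt0// gt_eqF.
(* Five errors share [eps]: two logistic tails, the convergence of the logistic mean, the event that
   [V] is at least [e] away from the sum, and the variation of [Phi] over 3 e. The threshold moves
   by [e] three times: from [V] to the sum, into the logistic mean and out of it. *)
pose e := eps / 5 / (3 * normal_peak s).
have e0 : 0 < e by apply: divr_gt0; [exact: divr_gt0|exact: mulr_gt0].
have pe : normal_peak s * (3 * e) = eps / 5.
  by rewrite /e; field; rewrite gt_eqF.
(* Steep enough for exp(- l e) <= eps / 5, by exp u >= 1 + u, and at least 1 as [clt_logistic]
   demands. *)
pose l := Num.max 1 (5 / (eps * e)).
have l1 : 1 <= l by rewrite le_max lexx.
have l0 : 0 <= l by lra.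
have q5 : expR (- (l * e)) <= eps / 5.
  have le5 : 5 / eps <= l * e.
    rewrite -ler_pdivrMr// (_ : 5 / eps / e = 5 / (eps * e)) ?le_max ?lexx ?orbT//.
    by field; rewrite !gt_eqF.
  have u0 : 0 < 5 / eps by rewrite divr_gt0.
  rewrite expRN -[leRHS]invrK lef_pV2 ?posrE ?expR_gt0 ?invr_gt0 ?divr_gt0//.
  rewrite invf_div (le_trans le5)//.
  by apply: le_trans (expR_ge1Dx _); rewrite lerDr.
set q := expR (- (l * e)) in q5.
have mid : measurable_fun setT (fun z : measurableTypeR R => z : R).
  exact: measurable_id.
have mW n := measurable_clt_sum iidO mh n.
have cu := clt_logistic iidO mh lX X0 lX2 s0 Es (t := t + 2 * e) l1.
have cl := clt_logistic iidO mh lX X0 lX2 s0 Es (t := t - 2 * e) l1.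
have eps5 : 0 < eps / 5 by rewrite divr_gt0.
move/cvgrPdist_le : (cu) => /(_ _ eps5) [N1 _ HN1].
move/cvgrPdist_le : (cl) => /(_ _ eps5) [N2 _ HN2].
move/cvgrPdist_le : (VW e0) => /(_ _ eps5) [N3 _ HN3].
exists (N1 + N2 + N3)%N => // n /= Nn.
have := HN1 n (leq_trans (leq_trans (leq_addr _ _) (leq_addr _ _)) Nn) => /= H1.
have := HN2 n (leq_trans (leq_trans (leq_addl _ _) (leq_addr _ _)) Nn) => /= H2.
have := HN3 n (leq_trans (leq_addl _ _) Nn) => /=.
set p := Pr P [set w | e <= _] => H3.
have p5 : p <= eps / 5 by rewrite sub0r normrN in H3; rewrite (le_trans (ler_norm p)).
have mD : measurable_fun setT (fun w => V n w - clt_sum O h n w).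
  exact: measurable_funB.
have up : Pr P [set w | V n w <= t] <= Phi (t + 3 * e) + q + q + eps / 5 + p.
  apply: (@le_trans _ _ (Pr P ([set w | clt_sum O h n w <= t + e] `|`
     [set w | e <= `|V n w - clt_sum O h n w|]))).
    apply: le_Pr; [exact: measurable_le_cst| |].
      apply: measurableU; [exact: measurable_le_cst|exact: measurable_norm_ge].
    move=> w /= Vt; have [|ew] := leP e `|V n w - clt_sum O h n w|; first by right.
    by left; exact: ler_dist_le Vt ew.
  apply: (le_trans (PrU _ (measurable_le_cst _ (mW n)) (measurable_norm_ge _ mD))).
  rewrite lerD//.
  have A := Pr_le_logistic P e (t + e) l0 (mW n).
  have B := logistic_le_Pr (normal_prob 0 s) e (t + 2 * e) l0 mid.
  rewrite (_ : t + e + e = t + 2 * e) in A; last by ring.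
  rewrite (_ : t + 2 * e + e = t + 3 * e) in B; last by ring.
  move: H1; rewrite ler_distl => /andP[H1 _].
  rewrite -/q in A B; rewrite -/(Phi _).
  by move: A B H1; rewrite /Phi /normal_Pr_le; lra.
have lo : Phi (t - 3 * e) <= Pr P [set w | V n w <= t] + q + q + eps / 5 + p.
  have A : Pr P [set w | clt_sum O h n w <= t - e] <=
     Pr P [set w | V n w <= t] + p.
    apply: (@le_trans _ _ (Pr P ([set w | V n w <= t] `|`
       [set w | e <= `|V n w - clt_sum O h n w|]))).
      apply: le_Pr; [exact: measurable_le_cst| |].
        apply: measurableU; [exact: measurable_le_cst|exact: measurable_norm_ge].
      move=> w /= Wt; have [|ew] := leP e `|V n w - clt_sum O h n w|; first by right.
      by left; rewrite -(subrK e t); apply: ler_dist_le Wt _; rewrite distrC.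
    exact: (PrU _ (measurable_le_cst _ (mV n)) (measurable_norm_ge _ mD)).
  have B := logistic_le_Pr P e (t - 2 * e) l0 (mW n).
  have D := Pr_le_logistic (normal_prob 0 s) e (t - 3 * e) l0 mid.
  rewrite (_ : t - 2 * e + e = t - e) in B; last by ring.
  rewrite (_ : t - 3 * e + e = t - 2 * e) in D; last by ring.
  move: H2; rewrite ler_distl => /andP[_ H2].
  rewrite -/q in B D.
  by move: A B D H2; rewrite /Phi /normal_Pr_le; lra.
have U : Phi (t + 3 * e) <= Phi t + eps / 5.
  have := @normal_Pr_le_lipschitz _ _ s0 t (t + 3 * e).
  by rewrite addrAC subrr add0r pe; apply; rewrite lerDl mulr_ge0// ltW.
have L : Phi t <= Phi (t - 3 * e) + eps / 5.
  have := @normal_Pr_le_lipschitz _ _ s0 (t - 3 * e) t.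
  have -> : t - (t - 3 * e) = 3 * e by ring.
  by rewrite pe; apply; rewrite gerBl mulr_ge0// ltW.
rewrite ler_distl; apply/andP; split; lra.
Qed.

End slutsky.

(** * The sup norm and deterministic bounds for linearized estimating equations *)

Section row_vector_norm.
Context {R : realType} {n : nat}.
Implicit Types (x : 'rV[R]_n).

Lemma norm_rV_le x c : 0 <= c -> (forall k, `|x ord0 k| <= c) -> `|x| <= c.
Proof.
move=> c0 xc; rewrite /Num.norm/= mx_normrE; apply/bigmax_leP; split=> // -[i k] _ /=.
by rewrite ord1.
Qed.

Lemma coord_norm_le x k : `|x ord0 k| <= `|x|.
Proof.
rewrite [leRHS]/Num.norm/= mx_normrE.
exact: (le_bigmax _ (fun ij => `|x ij.1 ij.2|) (ord0, k)).
Qed.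

End row_vector_norm.

Section linearized_system.
Context {R : realType} {D : nat}.
Variables (d c a p rho : 'I_D -> R) (m : 'I_D -> 'I_D -> R) (x rhoH g nd : R).
Hypotheses (dn : forall k, `|d k| <= nd) (nd0 : 0 <= nd) (g0 : 0 <= g).
Hypotheses (rhoHg : `|rhoH| <= nd ^+ 2 * g) (rhog : forall j, `|rho j| <= nd ^+ 2 * g).
Hypothesis score : forall j, p j + \sum_k m j k * d k + rho j = 0.

(** The score equation eliminates [p], so the linear part becomes (a + c m) d. In the application m
    tends to - J and a to h, and c = h J^-1 makes these coefficients vanish in the limit; the rest
    is quadratic in [nd]. *)
Lemma linearized_statistic :
  x = \sum_k a k * d k + rhoH - \sum_j c j * p j ->
  `|x| <= nd * (\sum_k `|a k + \sum_j c j * m j k| + (1 + \sum_j `|c j|) * (nd * g)).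
Proof.
move=> ->.
have -> : \sum_j c j * p j = - \sum_k (\sum_j c j * m j k) * d k - \sum_j c j * rho j.
  have -> : \sum_k (\sum_j c j * m j k) * d k = \sum_j c j * \sum_k m j k * d k.
    under eq_bigr do rewrite mulr_suml.
    rewrite exchange_big/=; apply: eq_bigr => j _; rewrite mulr_sumr.
    by apply: eq_bigr => k _; rewrite mulrA.
  rewrite -sumrN -sumrB; apply: eq_bigr => j _.
  have -> : p j = - (\sum_k m j k * d k) - rho j by have := score j; lra.
  by rewrite mulrBr mulrN.
have -> : \sum_k a k * d k + rhoH - (- \sum_k (\sum_j c j * m j k) * d k - \sum_j c j * rho j)
    = \sum_k (a k + \sum_j c j * m j k) * d k + (rhoH + \sum_j c j * rho j).
  under [in RHS]eq_bigr do rewrite mulrDl.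
  by rewrite big_split/=; ring.
rewrite mulrDr; apply: (le_trans (ler_normD _ _)); apply: lerD.
  apply: (le_trans (ler_norm_sum _ _ _)); rewrite mulr_sumr; apply: ler_sum => k _.
  by rewrite normrM mulrC ler_wpM2r.
apply: (le_trans (ler_normD _ _)).
have -> : nd * ((1 + \sum_j `|c j|) * (nd * g)) = nd ^+ 2 * g +
    \sum_j `|c j| * (nd ^+ 2 * g) by rewrite -mulr_suml; ring.
apply: lerD => //; apply: (le_trans (ler_norm_sum _ _ _)); apply: ler_sum => j _.
by rewrite normrM ler_wpM2l.
Qed.

(** The score equation reads J d = (m + J) d + p + rho. Inverting the fixed matrix [J] leaves at
    most nd / 2 from the terms in [d], which is absorbed on the left and gives the factor 2. In this
    way consistency is upgraded to the rate of the average score. *)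
Lemma linearized_estimator (J : 'M[R]_D) (kappa : R) : J \in unitmx ->
  kappa = \sum_l \sum_j `|invmx J l j| ->
  (forall e, 0 <= e -> (forall k, `|d k| <= e) -> nd <= e) ->
  kappa * (\sum_j \sum_k `|m j k + J j k| + nd * g) <= 1 / 2 ->
  nd <= 2 * kappa * \sum_j `|p j|.
Proof.
move=> Ju kE ndP small.
pose y j := \sum_k (m j k + J j k) * d k + p j + rho j.
have yE j : \sum_k J j k * d k = y j.
  rewrite /y; under [in RHS]eq_bigr do rewrite mulrDl.
  by rewrite big_split/=; have := score j; lra.
have dE l : d l = \sum_j invmx J l j * y j.
  have : invmx J *m (J *m \col_k d k) = \col_k d k by rewrite mulKmx.
  move/matrixP => /(_ l ord0); rewrite !mxE => <-; apply: eq_bigr => j _.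
  by rewrite -yE !mxE; congr (_ * _); apply: eq_bigr => k _; rewrite mxE.
set eta := \sum_j \sum_k `|m j k + J j k| + nd * g in small.
set sp := \sum_j `|p j|.
have yb j : `|y j| <= sp + nd * eta.
  rewrite /y; apply: (le_trans (ler_normD _ _)).
  have A : `|\sum_k (m j k + J j k) * d k| <= nd * \sum_i \sum_k `|m i k + J i k|.
    apply: (le_trans (ler_norm_sum _ _ _)).
    apply: (@le_trans _ _ (\sum_k `|m j k + J j k| * nd)).
      by apply: ler_sum => k _; rewrite normrM ler_wpM2l.
    rewrite -mulr_suml mulrC ler_wpM2l// [leRHS](bigD1 j)//= lerDl.
    by apply: sumr_ge0 => i _; apply: sumr_ge0.
  have B : `|p j| <= sp by rewrite /sp (bigD1 j)//= lerDl; apply: sumr_ge0.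
  have C := rhog j.
  have -> : sp + nd * eta =
      nd * \sum_i \sum_k `|m i k + J i k| + sp + nd ^+ 2 * g by rewrite /eta; ring.
  exact: lerD (le_trans (ler_normD _ _) (lerD A B)) C.
have k0 : 0 <= kappa by rewrite kE; apply: sumr_ge0 => l _; apply: sumr_ge0.
have sp0 : 0 <= sp by apply: sumr_ge0.
have eta0 : 0 <= eta.
  by rewrite addr_ge0 ?mulr_ge0//; apply: sumr_ge0 => i _; apply: sumr_ge0.
have Y0 : 0 <= sp + nd * eta by rewrite addr_ge0// mulr_ge0.
have : nd <= kappa * (sp + nd * eta).
  apply: ndP; first exact: mulr_ge0.
  move=> l; rewrite dE; apply: (le_trans (ler_norm_sum _ _ _)).
  apply: (@le_trans _ _ (\sum_j `|invmx J l j| * (sp + nd * eta))).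
    by apply: ler_sum => j _; rewrite normrM ler_wpM2l.
  rewrite -mulr_suml ler_wpM2r// kE [leRHS](bigD1 l)//= lerDl.
  by apply: sumr_ge0 => i _; apply: sumr_ge0.
have := ler_wpM2l nd0 small.
by rewrite mulrA mulrCA => s1 s2; lra.
Qed.

End linearized_system.

(** * Events of vanishing outer probability *)

Section vanishing_events.
Context {d} {T : measurableType d} {R : realType} (P : probability T R).
Implicit Types (A B : set T).

(** Stated through a measurable cover because the events to be bounded, such as the estimator lying
    in an arbitrary set, may fail to be measurable. *)
Definition outer_le A (x : R) :=
  exists B, [/\ measurable B, A `<=` B & Pr P B <= x].

Definition vanishing (A : nat -> set T) :=
  forall z, 0 < z -> \forall n \near \oo, outer_le (A n) z.

Lemma outer_leW A x : measurable A -> Pr P A <= x -> outer_le A x.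
Proof. by move=> mA Ax; exists A; split. Qed.

Lemma outer_le_sub A B x : A `<=` B -> outer_le B x -> outer_le A x.
Proof. by move=> AB [C [mC BC Cx]]; exists C; split=> //; exact: subset_trans BC. Qed.

Lemma outer_leU A B x y : outer_le A x -> outer_le B y -> outer_le (A `|` B) (x + y).
Proof.
move=> [A' [mA AA Ax]] [B' [mB BB By]]; exists (A' `|` B'); split.
- exact: measurableU.
- exact: setUSS.
- by rewrite (le_trans (PrU P mA mB))// lerD.
Qed.

Lemma outer_le_exists (I : finType) (A : I -> set T) (x : I -> R) :
  (forall i, outer_le (A i) (x i)) ->
  outer_le [set w | exists i, A i w] (\sum_i x i).
Proof.
move=> H.
suff G (s : seq I) : outer_le [set w | exists2 i, i \in s & A i w] (\sum_(i <- s) x i).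
  apply: outer_le_sub (G (index_enum I)) => w [i Aiw].
  by exists i => //; rewrite mem_index_enum.
elim: s => [|i s ih].
  rewrite big_nil; exists set0; split => //; last by rewrite /Pr measure0.
  by move=> w [].
rewrite big_cons; apply: outer_le_sub (outer_leU (H i) ih).
move=> w [j]; rewrite inE => /predU1P[->|js] Ajw; first by left.
by right; exists j.
Qed.

Lemma vanishing_sub (A B : nat -> set T) :
  (\forall n \near \oo, A n `<=` B n) -> vanishing B -> vanishing A.
Proof.
move=> AB vB z z0; near=> n; apply: (@outer_le_sub _ (B n)).
  by near: n.
by near: n; exact: vB.
Unshelve. all: by end_near. Qed.

Lemma vanishingU (A B : nat -> set T) :
  vanishing A -> vanishing B -> vanishing (fun n => A n `|` B n).
Proof.
move=> vA vB z z0; have z2 : 0 < z / 2 by rewrite divr_gt0.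
near=> n; rewrite (_ : z = z / 2 + z / 2); last by rewrite -splitr.
by apply: outer_leU; near: n; [exact: vA|exact: vB].
Unshelve. all: by end_near. Qed.

Lemma vanishing0 : vanishing (fun=> set0).
Proof. by move=> z z0; apply: nearW => n; exists set0; split=> //; rewrite /Pr measure0 ltW. Qed.

Lemma vanishing_exists (I : finType) (A : I -> nat -> set T) :
  (forall i, vanishing (A i)) -> vanishing (fun n => [set w | exists i, A i n w]).
Proof.
move=> H.
suff G (s : seq I) : vanishing (fun n => [set w | exists2 i, i \in s & A i n w]).
  apply: vanishing_sub (G (index_enum I)); apply: nearW => n w [i Aiw].
  by exists i => //; rewrite mem_index_enum.
elim: s => [|i s ih].
  by apply: vanishing_sub vanishing0; apply: nearW => n w [].
apply: vanishing_sub (vanishingU (H i) ih); apply: nearW => n w [j].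
rewrite inE => /predU1P[->|js] Ajw; first by left.
by right; exists j.
Qed.

Lemma vanishing_cvg (A : nat -> set T) : (forall n, measurable (A n)) ->
  Pr P (A n) @[n --> \oo] --> (0 : R) -> vanishing A.
Proof.
move=> mA /cvgrPdist_le H z z0; have := H z z0; apply: filterS => n /=.
rewrite sub0r normrN => Hn; apply: outer_leW => //.
by rewrite (le_trans (ler_norm _)).
Qed.

Lemma cvg_vanishing (A : nat -> set T) : (forall n, measurable (A n)) ->
  vanishing A -> Pr P (A n) @[n --> \oo] --> (0 : R).
Proof.
move=> mA vA; apply/cvgrPdist_le => z z0; have := vA z z0; apply: filterS => n /=.
move=> [B [mB AB Bz]]; rewrite sub0r normrN ger0_norm ?Pr_ge0//.
by rewrite (le_trans (le_Pr P (mA n) mB AB)).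
Qed.

End vanishing_events.

(** * Asymptotic normality from an estimating equation *)

Section estimating_equation.
Context {d d1} {T : measurableType d} {S : measurableType d1} {R : realType}
  (P : probability T R).
Variables (O : nat -> T -> S) (O0 : T -> S).
Hypothesis iidO : iid_copies P O O0.
Variable D : nat.
Variables (H : S -> 'rV[R]_D -> R) (psi : 'I_D -> S -> 'rV[R]_D -> R).
Variables (dH : 'I_D -> S -> R) (dpsi : 'I_D -> 'I_D -> S -> R) (G : S -> R).
Variables (ths : 'rV[R]_D) (thh : nat -> T -> 'rV[R]_D) (eps : R).
Hypothesis eps0 : 0 < eps.
Hypotheses (mH : measurable_fun setT (H ^~ ths))
  (mpsi : forall j, measurable_fun setT ((psi j) ^~ ths))
  (mdH : forall k, measurable_fun setT (dH k))
  (mdpsi : forall j k, measurable_fun setT (dpsi j k))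
  (mG : measurable_fun setT G) (G0 : forall s, 0 <= G s).
Hypotheses (lH2 : L1 P (fun w => H (O0 w) ths ^+ 2))
  (lpsi2 : forall j, L1 P (fun w => psi j (O0 w) ths ^+ 2))
  (ldH : forall k, L1 P (dH k \o O0)) (ldpsi : forall j k, L1 P (dpsi j k \o O0))
  (lG : L1 P (G \o O0)).
Hypotheses (HG : forall s v, `|v| <= eps ->
    `|H s (ths + v) - H s ths - \sum_k dH k s * v ord0 k| <= `|v| ^+ 2 * G s)
  (psiG : forall j s v, `|v| <= eps ->
    `|psi j s (ths + v) - psi j s ths - \sum_k dpsi j k s * v ord0 k|
      <= `|v| ^+ 2 * G s).
Hypothesis score : forall n w, `|thh n w - ths| < eps ->
  forall j, \sum_(i < n) psi j (O i w) (thh n w) = 0.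
Hypothesis mthh : forall n, measurable_fun setT (fun w => `|thh n w - ths|).
Hypothesis consistent : forall e, 0 < e ->
  Pr P [set w | e <= `|thh n w - ths|] @[n --> \oo] --> (0 : R).
Hypothesis Epsi : forall j, Ex P (fun w => psi j (O0 w) ths) = 0.
Variables (J : 'M[R]_D) (hv : 'rV[R]_D).
Hypotheses (Ju : J \in unitmx) (JE : forall j k, J j k = - Ex P (dpsi j k \o O0))
  (hvE : forall k, hv ord0 k = Ex P (dH k \o O0)).

Lemma L1_of_sqr (X : T -> R) : measurable_fun setT X -> L1 P (fun w => X w ^+ 2) ->
  L1 P X.
Proof.
move=> mX lX; apply: (L1_le mX (L1D (L1_cst P 1) lX)) => w.
have := sqr_ge0 (`|X w| - 1); rewrite -(@real_normK _ (X w)) ?num_real//.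
by have := normr_ge0 (X w); nra.
Qed.

Let mO0 := iid_copies_measurable0 iidO.
Let lH : L1 P (fun w => H (O0 w) ths).
Proof. by apply: L1_of_sqr => //; exact: (measurableT_comp mH mO0). Qed.
Let lpsi j : L1 P (fun w => psi j (O0 w) ths).
Proof. by apply: L1_of_sqr => //; exact: (measurableT_comp (mpsi j) mO0). Qed.

Let Delta := Ex P (fun w => H (O0 w) ths).
Let c j : R := (hv *m invmx J) ord0 j.

Definition influence (s : S) := H s ths - Delta + \sum_j c j * psi j s ths.

Definition statistic n w := (Num.sqrt n%:R)^-1 * \sum_(i < n) H (O i w) (thh n w)
  - Num.sqrt n%:R * Delta.

Let cJ k : \sum_j c j * J j k = hv ord0 k.
Proof.
have : hv *m invmx J *m J = hv by rewrite mulmxKV.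
by move=> /matrixP/(_ ord0 k); rewrite mxE.
Qed.

Lemma measurable_influence : measurable_fun setT influence.
Proof.
rewrite /influence; apply: measurable_funD; first exact: measurable_funB.
by apply: measurable_sum => j; apply: measurable_funM => //; exact: mpsi.
Qed.

Lemma L1_influence : L1 P (influence \o O0).
Proof.
apply: L1D; first by apply: L1B => //; exact: L1_cst.
by apply: L1_sum => j; exact: L1Z.
Qed.

Lemma Ex_influence : Ex P (influence \o O0) = 0.
Proof.
rewrite /influence /comp ExD; last 2 first.
- by apply: L1B => //; exact: L1_cst.
- by apply: L1_sum => j; exact: L1Z.
rewrite ExB//; last exact: L1_cst.
rewrite Ex_cst subrr add0r Ex_sum; last by move=> j; exact: L1Z.
by apply: big1 => j _; rewrite ExZ// Epsi mulr0.
Qed.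

Let Av (f : S -> R) := avg_sample O f.
Let b k s := dH k s + \sum_j c j * dpsi j k s.
Let K1 := \sum_l \sum_j `|invmx J l j|.
Let C1 := 1 + \sum_j `|c j|.
Let g := Ex P (G \o O0) + 1.

Let AvE f n w : (0 < n)%N -> \sum_(i < n) f (O i w) = n%:R * Av f n w.
Proof.
by move=> n0; rewrite /Av /avg_sample mulrA mulfV ?mul1r// pnatr_eq0 -lt0n.
Qed.

Let root_norm n (t : R) : (0 < n)%N ->
  (Num.sqrt n%:R)^-1 * (n%:R * t) = Num.sqrt n%:R * t.
Proof.
move=> n0; have r0 : 0 < Num.sqrt n%:R :> R by rewrite sqrtr_gt0 ltr0n.
have -> : n%:R * t = Num.sqrt n%:R * (Num.sqrt n%:R * t).
  by rewrite mulrA -expr2 sqr_sqrtr ?ler0n.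
by rewrite mulKf// gt_eqF.
Qed.

(** A pointwise statement on a good event: [linearized_estimator] bounds the estimation error by the
    average score, and [linearized_statistic] multiplies it by a small factor. The sqrt n goes to
    the score, whose normalized sums are bounded in probability. *)
Lemma statistic_bound n w : (0 < n)%N -> `|thh n w - ths| < eps ->
  Av G n w <= g ->
  K1 * (\sum_j \sum_k `|Av (dpsi j k) n w + J j k| + `|thh n w - ths| * g) <= 1 / 2 ->
  `|statistic n w - clt_sum O influence n w| <=
  2 * K1 * (\sum_j `|clt_sum O (fun s => psi j s ths) n w|) *
  (\sum_k `|Av (b k) n w| + C1 * (`|thh n w - ths| * g)).
Proof.
move=> n0 de Gg small.
set v := thh n w - ths; have thhE : thh n w = ths + v by rewrite addrC subrK.
have nr0 : 0 < n%:R :> R by rewrite ltr0n.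
have r0 : 0 < Num.sqrt n%:R :> R by rewrite sqrtr_gt0.
have g0 : 0 <= g.
  apply: le_trans Gg; rewrite mulr_ge0 ?invr_ge0 ?ler0n//.
  by apply: sumr_ge0 => i _; exact: G0.
have quad (f : S -> 'rV[R]_D -> R) (df : 'I_D -> S -> R) :
    (forall s v, `|v| <= eps ->
      `|f s (ths + v) - f s ths - \sum_k df k s * v ord0 k| <= `|v| ^+ 2 * G s) ->
    `|Av (f ^~ (ths + v)) n w - Av (f ^~ ths) n w - \sum_k Av (df k) n w * v ord0 k|
      <= `|v| ^+ 2 * g.
  move=> Hf.
  have -> : Av (f ^~ (ths + v)) n w - Av (f ^~ ths) n w - \sum_k Av (df k) n w * v ord0 k
    = n%:R^-1 * \sum_(i < n) (f (O i w) (ths + v) - f (O i w) ths -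
        \sum_k df k (O i w) * v ord0 k).
    rewrite !sumrB !mulrBr /Av /avg_sample; congr (_ - _).
    rewrite exchange_big mulr_sumr; apply: eq_bigr => k _.
    by rewrite -mulrA mulr_suml.
  rewrite normrM ger0_norm ?invr_ge0 ?ler0n//.
  apply: (@le_trans _ _ (`|v| ^+ 2 * Av G n w)); last first.
    by rewrite ler_wpM2l ?exprn_ge0.
  rewrite /Av /avg_sample mulrCA ler_wpM2l ?invr_ge0 ?ler0n// mulr_sumr.
  apply: (le_trans (ler_norm_sum _ _ _)); apply: ler_sum => i _.
  by apply: Hf; rewrite ltW.
have QH := quad H dH HG.
have Qpsi j := quad (psi j) (dpsi j) (psiG j).
have sc j : Av ((psi j) ^~ (ths + v)) n w = 0.
  by rewrite /Av /avg_sample -thhE score// mulr0.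
set rhoH := (X in `|X| <= _) in QH.
pose rho j := Av ((psi j) ^~ (ths + v)) n w - Av ((psi j) ^~ ths) n w -
  \sum_k Av (dpsi j k) n w * v ord0 k.
have score' j : Av ((psi j) ^~ ths) n w + \sum_k Av (dpsi j k) n w * v ord0 k + rho j = 0.
  by rewrite /rho sc; ring.
have dn k : `|v ord0 k| <= `|v| by exact: coord_norm_le.
have N2 := linearized_estimator dn (normr_ge0 v) g0 Qpsi score' Ju erefl
  (fun e e0 h => norm_rV_le e0 h) small.
pose x := Av (H ^~ (ths + v)) n w - Av (H ^~ ths) n w - \sum_j c j * Av ((psi j) ^~ ths) n w.
have N1 := @linearized_statistic R D (fun k => v ord0 k) c (fun k => Av (dH k) n w)
  (fun j => Av ((psi j) ^~ ths) n w) rho (fun j k => Av (dpsi j k) n w) x rhoH g `|v|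
  dn QH Qpsi score'.
have xE : statistic n w - clt_sum O influence n w = Num.sqrt n%:R * x.
  rewrite /statistic /clt_sum thhE (AvE (H ^~ (ths + v)))// (AvE influence)//.
  rewrite !root_norm// /x.
  have -> : Av influence n w = Av (H ^~ ths) n w - Delta +
      \sum_j c j * Av ((psi j) ^~ ths) n w.
    rewrite /influence /Av /avg_sample big_split/= sumrB mulrDr mulrBr.
    rewrite sumr_const card_ord -(mulr_natl Delta) mulrA mulVf ?gt_eqF// mul1r.
    congr (_ + _); rewrite exchange_big mulr_sumr; apply: eq_bigr => j _.
    by rewrite -mulr_sumr mulrCA.
  by ring.
have psiE : \sum_j `|clt_sum O (fun s => psi j s ths) n w| =
    Num.sqrt n%:R * \sum_j `|Av ((psi j) ^~ ths) n w|.
  rewrite mulr_sumr; apply: eq_bigr => j _.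
  by rewrite /clt_sum (AvE (fun s => psi j s ths))// root_norm// normrM (gtr0_norm r0).
have bE k : Av (b k) n w = Av (dH k) n w + \sum_j c j * Av (dpsi j k) n w.
  rewrite /b /Av /avg_sample big_split/= mulrDr; congr (_ + _).
  by rewrite exchange_big mulr_sumr; apply: eq_bigr => j _; rewrite -mulr_sumr mulrCA.
set q := (X in _ <= _ * X).
have qE : q = \sum_k `|Av (dH k) n w + \sum_j c j * Av (dpsi j k) n w| + C1 * (`|v| * g).
  by congr (_ + _); apply: eq_bigr => k _; rewrite bE.
have q0 : 0 <= q.
  rewrite addr_ge0//; first by apply: sumr_ge0.
  by rewrite !mulr_ge0// addr_ge0//; apply: sumr_ge0.
have A : `|x| <= `|v| * q by rewrite qE; apply: N1; rewrite /x /rhoH; ring.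
rewrite xE psiE normrM (gtr0_norm r0).
rewrite (mulrCA (2 * K1)) -mulrA ler_wpM2l ?(ltW r0)// (le_trans A)//.
by rewrite ler_wpM2r.
Qed.

Lemma vanishing_weak_law f e : 0 < e -> measurable_fun setT f -> L1 P (f \o O0) ->
  vanishing P (fun n => [set w | e <= `|Av f n w - Ex P (f \o O0)|]).
Proof.
move=> e0 mf lf; apply: vanishing_cvg; last exact: (weak_law iidO).
move=> n; apply: measurable_norm_ge; apply: measurable_funB => //.
exact: (measurable_avg_sample iidO).
Qed.

Lemma vanishing_statistic e : 0 < e ->
  vanishing P (fun n => [set w | e <= `|statistic n w - clt_sum O influence n w|]).
Proof.
move=> e0 z z0.
have mb k : measurable_fun setT (b k).
  rewrite /b; apply: measurable_funD => //.
  by apply: measurable_sum => j; apply: measurable_funM => //; exact: mdpsi.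
have lb k : L1 P (b k \o O0).
  rewrite /b /comp; apply: L1D; first exact: ldH.
  by apply: L1_sum => j; apply: L1Z; exact: ldpsi.
(* The choice c = h J^-1 centres [b k]: its mean is h - h J^-1 J in coordinate k. *)
have Eb k : Ex P (b k \o O0) = 0.
  rewrite /b /comp ExD; [|exact: ldH|by apply: L1_sum => j; apply: L1Z; exact: ldpsi].
  rewrite Ex_sum; last by move=> j; apply: L1Z; exact: ldpsi.
  rewrite -/(Ex P (dH k \o O0)) -hvE -cJ -big_split/=; apply: big1 => j _.
  rewrite ExZ; last exact: ldpsi.
  by rewrite -/(Ex P (dpsi j k \o O0)) JE mulrN addNr.
have g0 : 0 <= g by rewrite addr_ge0// Ex_ge0// => w; exact: G0.
have K10 : 0 <= K1 by apply: sumr_ge0 => l _; apply: sumr_ge0.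
have C10 : 0 <= C1 by rewrite addr_ge0//; apply: sumr_ge0.
pose SV := \sum_j 4 * Ex P (fun w => psi j (O0 w) ths ^+ 2).
have SV0 : 0 <= SV.
  by apply: sumr_ge0 => j _; rewrite mulr_ge0// Ex_ge0// => w; exact: sqr_ge0.
(* Chosen so that Chebyshev's inequality bounds the probability that some normalized score reaches K
   by SV / K^2 <= z / 2, for every n. *)
pose K := 1 + SV / (z / 2).
have z2 : 0 < z / 2 by rewrite divr_gt0.
have Kge1 : 1 <= K by rewrite lerDl divr_ge0// ltW.
have K0 : 0 < K by lra.
have SVK : SV / K ^+ 2 <= z / 2.
  rewrite ler_pdivrMr ?exprn_gt0// mulrC -ler_pdivrMr//.
  apply: (@le_trans _ _ K); first by rewrite /K lerDr.
  by rewrite expr2 ler_peMr// ltW.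
pose Q := K1 * (D%:R * D%:R + g).
pose Q' := 2 * K1 * (D%:R * K) * (D%:R + C1 * g).
have Q0 : 0 <= Q by rewrite mulr_ge0// addr_ge0// mulr_ge0.
have Q'0 : 0 <= Q'.
  by apply: mulr_ge0; [rewrite !mulr_ge0// ltW|rewrite addr_ge0// mulr_ge0].
(* The three terms keep the estimator in the range of the Taylor bounds, ensure the smallness
   condition of [linearized_estimator], and bring the final product below [e]. [Q] and [Q'] collect
   the constants when all deviations are at most [del]. *)
pose del := Num.min eps (Num.min (1 / (2 * (Q + 1))) (e / (2 * (Q' + 1)))).
have del0 : 0 < del.
  by rewrite !lt_min eps0 !divr_gt0// mulr_gt0// ltr_wpDl.
have delQ : Q * del <= 1 / 2.
  apply: (@le_trans _ _ ((Q + 1) * (1 / (2 * (Q + 1))))).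
    by apply: ler_pM => //; [exact: ltW|rewrite lerDl|rewrite /del !ge_min lexx !orbT].
  have Q1 : 0 < Q + 1 by rewrite ltr_wpDl.
  by rewrite [leLHS](_ : _ = 1 / 2)//; field; rewrite gt_eqF.
have delQ' : Q' * del < e.
  have Q1 : 0 < Q' + 1 by rewrite ltr_wpDl.
  apply: (@le_lt_trans _ _ ((Q' + 1) * (e / (2 * (Q' + 1))))).
    by apply: ler_pM => //; [exact: ltW|rewrite lerDl|rewrite /del !ge_min lexx !orbT].
  rewrite (_ : (Q' + 1) * (e / (2 * (Q' + 1))) = e / 2); first by rewrite ltr_pdivrMr// ltr_pMr// ltr1n.
  by field; rewrite gt_eqF.
(* [B0] does not vanish, but has probability at most z / 2 uniformly in n because [K] depends on z.
   The other four bad events vanish as n grows. *)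
pose B0 n := [set w | exists j, K <= `|clt_sum O (fun s => psi j s ths) n w|].
pose B1 n := [set w | del <= `|thh n w - ths|].
pose B2 n := [set w | 1 <= `|Av G n w - Ex P (G \o O0)|].
pose B3 n := [set w | exists k, del <= `|Av (b k) n w - Ex P (b k \o O0)|].
pose B4 n := [set w | exists jk : 'I_D * 'I_D,
  del <= `|Av (dpsi jk.1 jk.2) n w - Ex P (dpsi jk.1 jk.2 \o O0)|].
have v1 : vanishing P B1.
  apply: vanishing_cvg; last exact: consistent.
  by move=> n; rewrite -[X in measurable X]setTI; apply: measurable_fun_le.
have v2 : vanishing P B2 by exact: vanishing_weak_law.
have v3 : vanishing P B3.
  by apply: vanishing_exists => k; exact: vanishing_weak_law.
have v4 : vanishing P B4.
  by apply: vanishing_exists => jk; apply: vanishing_weak_law => //; exact: ldpsi.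
have B0z n : outer_le P (B0 n) (z / 2).
  have := @outer_le_exists _ _ _ P 'I_D
    (fun j => [set w | K <= `|clt_sum O (fun s => psi j s ths) n w|])
    (fun j => 4 * Ex P (fun w => psi j (O0 w) ths ^+ 2) / K ^+ 2).
  rewrite -mulr_suml => /(_ _)/wrap[].
    move=> j; apply: outer_leW.
      by apply: measurable_norm_ge; exact: (measurable_clt_sum iidO (mpsi j)).
    exact: (chebyshev_iid_sum iidO n K0 (mpsi j) (lpsi j) (Epsi j) (lpsi2 j)).
  by move=> [C [mC CC Cz]]; exists C; split => //; exact: le_trans SVK.
have V := vanishingU (vanishingU v1 v2) (vanishingU v3 v4).
have := V _ z2; apply: filterS2; last exact: (nbhs_infty_gt 0).
move=> n n0 VB; rewrite (splitr z).
apply: outer_le_sub (outer_leU (B0z n) VB) => w /= ew.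
apply: contrapT => nB.
have h0 j : `|clt_sum O (fun s => psi j s ths) n w| < K.
  by rewrite ltNge; apply/negP => h; apply: nB; left; exists j.
have h1 : `|thh n w - ths| < del.
  by rewrite ltNge; apply/negP => h; apply: nB; right; left; left.
have h2 : `|Av G n w - Ex P (G \o O0)| < 1.
  by rewrite ltNge; apply/negP => h; apply: nB; right; left; right.
have h3 k : `|Av (b k) n w| < del.
  rewrite -(subr0 (Av _ _ _)) -(Eb k) ltNge; apply/negP => h.
  by apply: nB; right; right; left; exists k.
have h4 j k : `|Av (dpsi j k) n w + J j k| < del.
  rewrite JE ltNge; apply/negP => h.
  by apply: nB; right; right; right; exists (j, k).
have sumD (F : 'I_D -> R) x : (forall i, F i <= x) -> \sum_i F i <= D%:R * x.
  move=> Fx; apply: (@le_trans _ _ (\sum_(i < D) x)); first exact: ler_sum.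
  by rewrite sumr_const card_ord mulr_natl.
have Gg : Av G n w <= g.
  by move: h2; rewrite ltr_distl /g => /andP[_ /ltW]; rewrite addrC.
have dg : `|thh n w - ths| * g <= del * g by rewrite ler_wpM2r// ltW.
have de : `|thh n w - ths| < eps by rewrite (lt_le_trans h1)// /del ge_min lexx.
have sm : K1 * (\sum_j \sum_k `|Av (dpsi j k) n w + J j k| + `|thh n w - ths| * g)
    <= 1 / 2.
  apply: le_trans delQ; rewrite /Q -mulrA ler_wpM2l// mulrDl (mulrC g) lerD//.
  by rewrite -mulrA; apply: (sumD) => j; apply: (sumD) => k; exact/ltW/h4.
have st := statistic_bound n0 de Gg sm.
move: ew; apply/negP; rewrite -ltNge; apply: le_lt_trans delQ'.
apply: (le_trans st); rewrite /Q' -[leRHS]mulrA.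
apply: ler_pM.
- by rewrite !mulr_ge0//; apply: sumr_ge0.
- rewrite addr_ge0//; first by apply: sumr_ge0.
  by rewrite !mulr_ge0.
- by rewrite ler_wpM2l ?mulr_ge0//; apply: (sumD) => j; exact/ltW/h0.
- rewrite [leRHS]mulrDl; apply: lerD; first by apply: (sumD) => k; exact/ltW/h3.
  by rewrite -[leRHS]mulrA (mulrC g) ler_wpM2l.
Qed.

Lemma estimating_equation_clt (s : R) : 0 < s ->
  (forall n, measurable_fun setT (statistic n)) ->
  L1 P (fun w => influence (O0 w) ^+ 2) ->
  Ex P (fun w => influence (O0 w) ^+ 2) = s ^+ 2 ->
  cvg_in_dist_normal P statistic (s ^+ 2).
Proof.
move=> s0 mV l2 Es.
apply: (clt_slutsky iidO measurable_influence L1_influence Ex_influence l2 s0 Es mV).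
move=> e e0; apply: cvg_vanishing; last exact: vanishing_statistic.
move=> n; apply: measurable_norm_ge; apply: measurable_funB => //.
exact: (measurable_clt_sum iidO measurable_influence).
Qed.

End estimating_equation.

(** * Dense sequences, measurable suprema and compactness *)

Section dense_sequences.
Context {R : realType} {n : nat}.

Lemma rational_approximation (x : 'rV[R]_n) (e : R) : 0 < e ->
  exists z : 'rV[rat]_n, `|x - map_mx (@ratr R) z| < e.
Proof.
move=> e0; have e2 : 0 < e / 2 by rewrite divr_gt0.
have H k : exists q : rat, ratr q \in `](x ord0 k - e / 2), (x ord0 k + e / 2)[.
  have lt : x ord0 k - e / 2 < x ord0 k + e / 2 by lra.
  by have [q qin] := rat_in_itvoo lt; exists q.
pose z : 'rV[rat]_n := \row_k projT1 (cid (H k)).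
exists z; apply: (@le_lt_trans _ _ (e / 2)); last by rewrite ltr_pdivrMr// ltr_pMr// ltr1n.
apply: norm_rV_le => [|k]; first exact: ltW.
rewrite !mxE; have := projT2 (cid (H k)); rewrite in_itv/= => /andP[a b].
by rewrite ler_norml; apply/andP; split; lra.
Qed.

(** Rational points may all miss [A], so for each rational point and each radius 1 / (k + 1) one
    picks a point of [A] that close, when there is one. *)
Lemma dense_sequence (A : set 'rV[R]_n) : A !=set0 ->
  exists q : nat -> 'rV[R]_n, (forall i, A (q i)) /\
    forall x e, A x -> 0 < e -> exists i, `|x - q i| < e.
Proof.
move=> [a0 Aa0].
pose near_pt (zk : 'rV[rat]_n * nat) a :=
  A a /\ `|a - map_mx (@ratr R) zk.1| < zk.2.+1%:R^-1.
pose pt zk : 'rV[R]_n := if pselect (exists a, near_pt zk a) is left h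
  then projT1 (cid h) else a0.
pose q i := if unpickle i is Some zk then pt zk else a0.
exists q; split.
  move=> i; rewrite /q; case: unpickle => // zk; rewrite /pt.
  by case: pselect => // h; have [] := projT2 (cid h).
move=> x e Ax e0; have e2 : 0 < e / 2 by rewrite divr_gt0.
have [k ke] : exists k, k.+1%:R^-1 < e / 2.
  have [N _ HN] := near_infty_natSinv_lt (PosNum e2).
  by exists N; apply: (HN N); rewrite /= leqnn.
have k0 : 0 < k.+1%:R^-1 :> R by rewrite invr_gt0.
have [z xz] := rational_approximation x k0.
exists (pickle (z, k)); rewrite /q pickleK /pt.
case: pselect => [h|]; last by case; exists x.
case: (cid h) => y [_ /= yz].
apply: (le_lt_trans (ler_distD (map_mx (@ratr R) z) _ _)).
rewrite (splitr e) ltrD//; first exact: lt_trans ke.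
by rewrite distrC; exact: lt_trans ke.
Qed.

End dense_sequences.

Section measurable_supremum.
Context {d} {S : measurableType d} {R : realType} {n : nat}.

(** By continuity the supremum over [A] equals the one over a dense sequence of [A], a countable and
    hence measurable supremum. *)
Lemma measurable_supremum (f : S -> 'rV[R]_n -> R) (A : set 'rV[R]_n) :
  A !=set0 ->
  (forall a, A a -> measurable_fun setT (f ^~ a)) ->
  (forall s a, A a -> {for a, continuous (f s)}) ->
  (forall s, exists c, forall a, A a -> f s a <= c) ->
  exists phi : S -> R, [/\ measurable_fun setT phi,
    (forall s a, A a -> f s a <= phi s) &
    (forall s c, (forall a, A a -> f s a <= c) -> phi s <= c)].
Proof.
move=> A0 mf cf bf; have [q [Aq dq]] := dense_sequence A0.
pose phi s := sups (fun i => f s (q i)) 0.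
have phiE s : phi s = sup (range (fun i => f s (q i))).
  congr (sup _); apply/seteqP; split=> [_ [k _ <-]|_ [k _ <-]]; first by exists k.
  by exists k.
have ub s : has_ubound (range (fun i => f s (q i))).
  by have [c fc] := bf s; exists c => _ [i _ <-]; exact: fc.
have hs s : has_sup (range (fun i => f s (q i))).
  by split => //; exists (f s (q 0)), 0%N.
exists phi; split.
- by apply: measurable_fun_sups => // i; exact: mf.
- move=> s a Aa; rewrite phiE; apply/ler_addgt0Pr => e e0.
  have /cvgrPdist_lt/(_ _ e0)/nbhs_ballP[r r0 Hr] := cf s a Aa.
  have [i ai] := dq a r Aa r0.
  have := Hr (q i); rewrite -ball_normE /= => /(_ ai).
  rewrite ltr_distl => /andP[_ /ltW/le_trans]; apply; rewrite lerD2r.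
  by move/ubP: (sup_upper_bound (hs s)); apply; exists i.
- move=> s c fc; rewrite phiE; apply: ge_sup; first by exists (f s (q 0)), 0%N.
  by move=> _ [i _ <-]; exact: fc.
Qed.

End measurable_supremum.

(** Compactness as an induction principle for ideals of sets. If Q K failed, the sets B with Q (K
    minus B) would form a proper filter containing [K]; a cluster point of it contradicts the local
    hypothesis. *)
Lemma compact_ideal {T : topologicalType} (K : set T) (Q : set (set T)) :
  compact K -> Q set0 -> (forall A B, A `<=` B -> Q B -> Q A) ->
  (forall A B, Q A -> Q B -> Q (A `|` B)) ->
  (forall x, K x -> exists2 V, nbhs x V & Q (K `&` V)) -> Q K.
Proof.
move=> cK Q0 Qsub QU Qloc; apply: contrapT => nQ.
pose F := [set B | Q (K `\` B)].
have FF : ProperFilter F.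
  apply: Build_ProperFilter_ex; last first.
    split.
    - by rewrite /F/= setDT.
    - move=> A B; rewrite /F/= => QA QB; apply: Qsub (QU _ _ QA QB) => x [Kx].
      by rewrite -setDIr.
    - move=> A B AB; rewrite /F/=; apply: Qsub => x [Kx nB]; split => // /AB.
      exact.
  move=> B FB; apply: contrapT => nB; apply: nQ; apply: Qsub FB => x Kx; split => // Bx.
  by apply: nB; exists x.
have FK : F K by rewrite /F/= setDv.
have [x [Kx clx]] := cK F FF FK.
have [V Vx QV] := Qloc x Kx.
have FV : F (~` V) by rewrite /F/= setDE setCK.
by have [y [/= nVy Vy]] := clx _ _ FV Vx.
Qed.

Lemma compact_bounded_above {R : realType} {n : nat} (K : set 'rV[R]_n) (g : 'rV[R]_n -> R) :
  compact K -> (forall a, K a -> {for a, continuous g}) ->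
  exists c, forall a, K a -> g a <= c.
Proof.
move=> cK cg; have cont : {within K, continuous g}.
  apply: continuous_in_subspaceT => th /set_mem; exact: cg.
have [M [_ HM]] := compact_bounded (continuous_compact cont cK).
have M1 : M < M + 1 by rewrite ltrDl.
exists (M + 1) => a Ka; rewrite (le_trans (ler_norm _))//.
by apply: (HM (M + 1) M1); exists a.
Qed.

(** * Wald's consistency argument *)

Section argmax_consistency.
Context {d d1} {T : measurableType d} {S : measurableType d1} {R : realType}
  (P : probability T R).
Variables (O : nat -> T -> S) (O0 : T -> S).
Hypothesis iidO : iid_copies P O O0.
Variable D : nat.
Variables (l : S -> 'rV[R]_D -> R) (Theta : set 'rV[R]_D) (ths : 'rV[R]_D).
Variable thh : nat -> T -> 'rV[R]_D.
Hypotheses (cTheta : compact Theta) (Tths : Theta ths).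
Hypothesis ml : forall th, Theta th -> measurable_fun setT (l ^~ th).
Hypothesis cl : forall s th, Theta th -> {for th, continuous (l s)}.
Hypothesis dom : forall th, Theta th -> exists rho b, [/\ 0 < rho, L1 P b,
  forall w, 0 <= b w &
  forall w th', Theta th' -> `|th' - th| < rho -> l (O0 w) th' <= b w].
Hypothesis lths : L1 P (fun w => l (O0 w) ths).
Hypothesis ident : forall th, Theta th -> th != ths ->
  (\int[P]_w (l (O0 w) th)%:E < \int[P]_w (l (O0 w) ths)%:E)%E.
Hypothesis thhT : forall n w, Theta (thh n w).
Hypothesis thh_max : forall n w,
  \sum_(i < n) l (O i w) ths <= \sum_(i < n) l (O i w) (thh n w).
Hypothesis mthh : forall n, measurable_fun setT (fun w => `|thh n w - ths|).

Let mO0 := iid_copies_measurable0 iidO.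

(* Fatou's lemma for b - max(sup over a shrinking ball, -N). *)
Lemma local_domination th : Theta th -> th != ths ->
  exists r phi, [/\ 0 < r, measurable_fun setT phi, L1 P (phi \o O0),
    Ex P (phi \o O0) < Ex P (fun w => l (O0 w) ths) &
    forall s th', Theta th' -> `|th' - th| < r -> l s th' <= phi s].
Proof.
move=> Tth thn; have [rho [b [rho0 lb b0 lleb]]] := dom Tth.
pose r N : R := rho / N.+1%:R.
have r0 N : 0 < r N by rewrite divr_gt0.
pose A N := [set th' | Theta th' /\ `|th' - th| < r N].
have HA N : exists phi : S -> R, [/\ measurable_fun setT phi,
    (forall s a, A N a -> l s a <= phi s) &
    (forall s c, (forall a, A N a -> l s a <= c) -> phi s <= c)].
  apply: measurable_supremum.
  - by exists th; split => //; rewrite subrr normr0.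
  - by move=> a [Ta _]; exact: ml.
  - by move=> s a [Ta _]; exact: cl.
  - by move=> s; have [c Hc] := compact_bounded_above cTheta (@cl s); exists c => a [Ta _]; exact: Hc.
pose phi N := projT1 (cid (HA N)).
have phiP N := projT2 (cid (HA N)); rewrite -/(phi _) in phiP.
(* Bounded below by truncation and above by [b], [m N] is integrable although the supremum itself
   may not be. *)
pose m N s := Num.max (phi N s) (- N%:R).
have mphi N : measurable_fun setT (phi N) by case: (phiP N).
have mm N : measurable_fun setT (m N) by apply: measurable_maxr.
have mb := L1_measurable lb.
have mlb N w : m N (O0 w) <= b w.
  rewrite ge_max; apply/andP; split; last by rewrite (le_trans _ (b0 w))// oppr_le0.
  have [_ _ H] := phiP N; apply: H => a [Ta aN]; apply: lleb => //.
  by rewrite (lt_le_trans aN)// ler_pdivrMr// ler_peMr ?ler1n// ltW.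
have lm N : L1 P (m N \o O0).
  apply: (@L1_le _ _ _ _ _ (fun w => b w + N%:R)).
  - exact: measurableT_comp.
  - by apply: L1D => //; exact: L1_cst.
  - move=> w; rewrite ler_norml; apply/andP; split; last first.
      by rewrite (le_trans (mlb N w))// lerDl.
    have h : - N%:R <= m N (O0 w) by rewrite le_max lexx orbT.
    by have := b0 w; rewrite /=; lra.
have ml0 : measurable_fun setT (fun w => l (O0 w) th).
  exact: (measurableT_comp (ml Tth) mO0).
suff [N HN] : exists N, Ex P (m N \o O0) < Ex P (fun w => l (O0 w) ths).
  exists (r N), (m N); split => // s th' Tth' th'N.
  by have [_ H _] := phiP N; rewrite le_max H.
apply: contrapT => nN.
have Hge N : Ex P (fun w => l (O0 w) ths) <= Ex P (m N \o O0).
  by rewrite leNgt; apply/negP => h; apply: nN; exists N.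
pose F N w := (b w - m N (O0 w))%:E.
have mF N : measurable_fun setT (F N).
  by apply/measurable_EFinP; apply: measurable_funB => //; exact: measurableT_comp.
have F0 N w : setT w -> (0 <= F N w)%E by move=> _; rewrite lee_fin subr_ge0.
have := fatou P measurableT mF F0.
have limF w : F ^~ w @ \oo --> (b w - l (O0 w) th)%:E.
  apply: cvg_EFin; first exact: nearW.
  apply: (@cvgB _ R^o); first exact: cvg_cst.
  set s := O0 w.
  apply/cvgrPdist_le => e e0.
  have /cvgrPdist_le/(_ _ e0)/nbhs_ballP[t t0 Ht] := @cl s th Tth.
  have [N1 _ HN1] : \forall N \near \oo, rho / t <= N%:R by exact: nbhs_infty_ger.
  have [N2 _ HN2] : \forall N \near \oo, - l s th <= N%:R by exact: nbhs_infty_ger.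
  exists (N1 + N2)%N => // N /= NN.
  have rt : r N <= t.
    rewrite ler_pdivrMr// mulrC -ler_pdivrMr//.
    rewrite (le_trans (HN1 N (leq_trans (leq_addr _ _) NN)))// ler_nat//.
  have up : phi N s <= l s th + e.
    have [_ _ H] := phiP N; apply: H => a [Ta aN].
    have := Ht a; rewrite -ball_normE /= distrC => /(_ (lt_le_trans aN rt)).
    by rewrite ler_distl => /andP[+ _]; rewrite lerBlDr.
  have lo : l s th <= phi N s.
    by have [_ H _] := phiP N; apply: H; split => //; rewrite subrr normr0.
  have Nl : - N%:R <= l s th.
    by have := HN2 N (leq_trans (leq_addl _ _) NN); lra.
  rewrite distrC ger0_norm; last by rewrite subr_ge0 le_max lo.
  by rewrite lerBlDl ge_max up/= (le_trans Nl)// lerDl ltW.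
have -> : (\int[P]_x limn_einf (F ^~ x) = \int[P]_w (b w - l (O0 w) th)%:E)%E.
  apply: eq_integral => w _; have := limF w => h.
  by rewrite is_cvg_limn_einfE; [apply/cvg_lim|apply/cvg_ex; eexists; exact: h].
have EF N : (\int[P]_x F N x = (Ex P b - Ex P (m N \o O0))%:E)%E.
  by rewrite -(ExB lb (lm N)); exact: (EFin_Ex (L1B lb (lm N))).
have bd : (limn_einf (fun N => \int[P]_x F N x) <=
   (Ex P b - Ex P (fun w => l (O0 w) ths))%:E)%E.
  rewrite limn_einf_lim; apply: lime_le; first exact: is_cvg_einfs.
  apply: nearW => N; apply: (@le_trans _ _ (\int[P]_x F N x)%E).
    by apply: ereal_inf_lbound; exists N => //=.
  by rewrite EF lee_fin lerD2l lerN2.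
move=> /le_trans/(_ bd) H.
have bl0 w : 0 <= b w - l (O0 w) th.
  by rewrite subr_ge0; apply: lleb => //; rewrite subrr normr0.
(* The bound from Fatou's lemma is finite, so [l] is integrable at [th] too and [ident] becomes a
   strict inequality between real means. *)
have lbl : L1 P (fun w => b w - l (O0 w) th).
  apply/integrableP; split; first by apply/measurable_EFinP; exact: measurable_funB.
  under eq_integral do rewrite /= ger0_norm//.
  by rewrite (le_lt_trans H)// ltry.
have ll : L1 P (fun w => l (O0 w) th).
  have := L1B lb lbl; congr (L1 P _); apply/funext => w; lra.
have := ident Tth thn; rewrite (EFin_Ex ll) (EFin_Ex lths) lte_fin => lt.
move: H; rewrite (EFin_Ex lbl) lee_fin (ExB lb ll) => H; lra.
Qed.

Lemma argmax_consistency e : 0 < e ->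
  Pr P [set w | e <= `|thh n w - ths|] @[n --> \oo] --> (0 : R).
Proof.
move=> e0; apply: cvg_vanishing.
  move=> n; have := measurable_norm_ge e (mthh n).
  by under eq_set do rewrite normr_id.
pose K := Theta `&` [set th | e <= `|th - ths|].
pose Q (A : set 'rV[R]_D) := vanishing P (fun n => [set w | A (thh n w)]).
suff : Q K.
  by apply: vanishing_sub; apply: nearW => n w /= ew; split.
apply: compact_ideal.
- apply: (subclosed_compact _ cTheta); last by move=> ? [].
  apply: closedI; first exact: compact_closed.
  rewrite (_ : [set th | _] = ~` ball ths e); last first.
    apply/seteqP; split => th; rewrite -ball_normE /= distrC leNgt => /negP//.
  by apply: open_closedC; exact: ball_open.
- by move=> z z0; apply: nearW => n; exists set0; split=> //; rewrite /Pr measure0 ltW.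
- by move=> A B AB; apply: vanishing_sub; apply: nearW => n w /=; exact: AB.
- by move=> A B QA QB; exact: vanishingU.
move=> th [Tth eth].
have thn : th != ths.
  by apply/eqP => thE; move: eth; rewrite thE /= subrr normr0 leNgt e0.
have [r [phi [r0 mphi lphi Ephi phiP]]] := local_domination Tth thn.
exists (ball th r); first exact: nbhsx_ballx.
pose h s := phi s - l s ths.
have mh : measurable_fun setT h by apply: measurable_funB => //; exact: ml.
have lh : L1 P (h \o O0) by exact: L1B.
have Eh : Ex P (h \o O0) = Ex P (phi \o O0) - Ex P (fun w => l (O0 w) ths).
  by rewrite -ExB.
have h0 : 0 < - Ex P (h \o O0) by rewrite Eh; lra.
(* If the estimator lies in the ball, the sample mean of [h] is nonnegative, whereas its expectation
   is negative: the weak law rules this out in the limit. *)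
apply: vanishing_sub (vanishing_weak_law iidO h0 mh lh).
apply: nearW => n w /= [[Tn _]]; rewrite -ball_normE /= distrC => nr.
have : 0 <= avg_sample O h n w.
  rewrite mulr_ge0 ?invr_ge0// /h sumrB subr_ge0.
  apply: (le_trans (thh_max n w)); apply: ler_sum => i _; exact: phiP.
by move=> a0; rewrite (le_trans _ (ler_norm _))//; lra.
Qed.

End argmax_consistency.

(** * Calculus from partial derivatives along coordinate axes *)

Section partial_derivatives.
Context {R : realType} {D : nat}.
Implicit Types (f g : 'rV[R]_D -> R) (a d q : 'rV[R]_D) (k : 'I_D) (U : set 'rV[R]_D).

Let e k : 'rV[R]_D := delta_mx 0 k.

Let scale_one (h : R) : h *: (1 : R) = h.
Proof. by rewrite /GRing.scale/= mulr1. Qed.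

Lemma is_derive_line g a k (t : R) : derivable g (t *: e k + a) (e k) ->
  is_derive t 1 (fun t => g (t *: e k + a)) (pd k g (t *: e k + a)).
Proof.
have E : (fun h : R => h^-1 *: (((fun t => g (t *: e k + a)) \o shift t) (h *: 1)
      - g (t *: e k + a))) =
    (fun h => h^-1 *: ((g \o shift (t *: e k + a)) (h *: e k) - g (t *: e k + a))).
  apply/funext => h; congr (_ *: (g _ - _)).
  by rewrite /shift/= scale_one scalerDl addrA.
move=> dg; apply: DeriveDef; first by rewrite /derivable E.
by rewrite /derive E.
Qed.

Lemma is_derive_pd g a k (df : R) :
  is_derive (0 : R) 1 (fun t : R => g (t *: e k + a)) df ->
  derivable g a (e k) /\ pd k g a = df.
Proof.
have E : (fun h : R => h^-1 *: (((fun t => g (t *: e k + a)) \o shift (0 : R)) (h *: 1)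
      - g ((0 : R) *: e k + a))) =
    (fun h => h^-1 *: ((g \o shift a) (h *: e k) - g a)).
  apply/funext => h; rewrite /shift/= scale0r add0r; congr (_ *: (g _ - _)).
  by rewrite scale_one addr0.
by case; rewrite /derivable /derive E => ? ?; split.
Qed.

Lemma is_derive_line0 g a k : derivable g a (e k) ->
  is_derive (0 : R) 1 (fun t => g (t *: e k + a)) (pd k g a).
Proof.
have z : (0 : R) *: e k + a = a by rewrite scale0r add0r.
by rewrite -{1 3}z => /is_derive_line.
Qed.

Lemma norm_delta_le (t : R) k : `|t *: e k| = `|t|.
Proof.
apply/eqP; rewrite eq_le; apply/andP; split.
  apply: norm_rV_le => // j; rewrite !mxE eqxx/= normrM.
  by case: (j == k); rewrite ?normr1 ?normr0 ?mulr1 ?mulr0.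
by have := coord_norm_le (t *: e k) k; rewrite !mxE !eqxx mulr1.
Qed.

Lemma pd_comp g (phi phi1 : R -> R) a k : derivable g a (e k) ->
  (forall x : R, is_derive x 1 phi (phi1 x)) ->
  derivable (phi \o g) a (e k) /\ pd k (phi \o g) a = phi1 (g a) * pd k g a.
Proof.
move=> dg dphi; apply: is_derive_pd.
have dl : is_derive (0 : R) 1 (fun t => g (t *: e k + a)) (pd k g a).
  exact: is_derive_line0.
have := @is_derive1_comp _ phi (fun t => g (t *: e k + a)) 0 (phi1 (g a)) (pd k g a).
by rewrite scale0r add0r; apply.
Qed.

Lemma pd_mul f g a k : derivable f a (e k) -> derivable g a (e k) ->
  derivable (fun x => f x * g x) a (e k) /\
  pd k (fun x => f x * g x) a = f a * pd k g a + g a * pd k f a.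
Proof.
move=> df dg; apply: is_derive_pd.
apply: (is_derive_eq (is_deriveM (is_derive_line0 df) (is_derive_line0 dg))).
by rewrite scale0r add0r.
Qed.

(* Changing one coordinate at a time keeps the path inside the ball of radius |d|. *)
Lemma telescoping_bound g a d (L : 'I_D -> R) (M : R) :
  (forall k q, `|q - a| <= `|d| -> derivable g q (e k)) ->
  (forall k q, `|q - a| <= `|d| -> `|pd k g q - L k| <= M) ->
  `|g (a + d) - g a - \sum_k L k * d ord0 k| <= D%:R * (M * `|d|).
Proof.
move=> dg gM.
pose p (i : nat) : 'rV[R]_D := \row_k (a ord0 k + (if (k < i)%N then d ord0 k else 0)).
have p0 : p 0%N = a by apply/rowP => k; rewrite mxE ltn0 addr0.
have pD : p D = a + d by apply/rowP => k; rewrite !mxE ltn_ord.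
have pS (i : 'I_D) : p i.+1 = d ord0 i *: e i + p i.
  apply/rowP => k; rewrite !mxE ltnS leq_eqVlt (inj_eq val_inj) eqxx/=.
  by case: eqVneq => [->|ki]; rewrite ?ltnn/=; ring.
have inb (i : 'I_D) t : `|t| <= `|d ord0 i| -> `|t *: e i + p i - a| <= `|d|.
  move=> td; apply: norm_rV_le => // k; rewrite !mxE eqxx/=.
  case: eqVneq => [->|ki].
    rewrite ltnn mulr1 addr0 addrK; exact: le_trans td (coord_norm_le d i).
  rewrite mulr0 add0r addrAC subrr add0r.
  by case: ifP => _; [exact: coord_norm_le|rewrite normr0].
have -> : g (a + d) - g a = \sum_(i < D) (g (p i.+1) - g (p i)).
  by rewrite -pD -p0 -(telescope_sumr (g \o p)) ?leq0n// big_mkord.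
rewrite -sumrB; apply: (le_trans (ler_norm_sum _ _ _)).
apply: (@le_trans _ _ (\sum_(i < D) M * `|d|)); last first.
  by rewrite sumr_const card_ord mulr_natl.
apply: ler_sum => i _.
pose f t := g (t *: e i + p i) - L i * t.
pose f1 t := pd i g (t *: e i + p i) - L i.
have : `|f (0 + d ord0 i) - f 0| <= M * `|d ord0 i|.
  apply: (@mean_value_bound _ f f1); move=> t td; rewrite add0r.
    have dl : is_derive t 1 (fun t => g (t *: e i + p i)) (pd i g (t *: e i + p i)).
      by apply: is_derive_line; apply: dg; exact: inb.
    have dL : is_derive t 1 (fun t => L i * t) (L i *: 1) by apply: is_deriveZ.
    by apply: (is_derive_eq (is_deriveB dl dL)); rewrite /f1 /GRing.scale/= mulr1.
  by apply: gM; exact: inb.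
rewrite /f add0r scale0r add0r -pS mulr0 subr0 => H.
rewrite (_ : g (p i.+1) - g (p i) - L i * d ord0 i =
  g (p i.+1) - L i * d ord0 i - g (p i)); last by ring.
apply: (le_trans H); rewrite ler_wpM2l ?coord_norm_le//.
by apply: le_trans (gM i a _); rewrite ?subrr ?normr0.
Qed.

Lemma lipschitz_of_partials g a d (K : R) :
  (forall k q, `|q - a| <= `|d| -> derivable g q (e k)) ->
  (forall k q, `|q - a| <= `|d| -> `|pd k g q| <= K) ->
  `|g (a + d) - g a| <= D%:R * (K * `|d|).
Proof.
move=> dg gK; have := @telescoping_bound g a d (fun=> 0) K dg.
rewrite big1 ?subr0; last by move=> k _; rewrite mul0r.
by apply => k q qa; rewrite subr0; exact: gK.
Qed.

(** Each passage through the D coordinates costs a factor D: once for the variation of the partial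
    derivatives, once for [g] itself. *)
Lemma taylor_of_partials g a d (K : R) :
  (forall k q, `|q - a| <= `|d| -> derivable g q (e k)) ->
  (forall j k q, `|q - a| <= `|d| -> derivable (pd k g) q (e j)) ->
  (forall j k q, `|q - a| <= `|d| -> `|pd j (pd k g) q| <= K) ->
  `|g (a + d) - g a - \sum_k pd k g a * d ord0 k| <= `|d| ^+ 2 * (D%:R ^+ 2 * K).
Proof.
move=> dg ddg gK.
have -> : `|d| ^+ 2 * (D%:R ^+ 2 * K) = D%:R * (D%:R * (K * `|d|) * `|d|) by ring.
apply: telescoping_bound => // k q qa.
have -> : q = a + (q - a) by rewrite addrC subrK.
have K0 : 0 <= K.
  by apply: le_trans (gK k k a _); rewrite ?subrr ?normr0.
apply: (@le_trans _ _ (D%:R * (K * `|q - a|))).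
  apply: lipschitz_of_partials => [j q' q'a|j q' q'a].
    by apply: ddg; exact: le_trans qa.
  by apply: gK; exact: le_trans qa.
by rewrite ler_wpM2l// ler_wpM2l.
Qed.

(** Partial derivatives that are bounded near [a] make [g] Lipschitz at [a]. In [C3_on] only the
    third ones are assumed continuous; applied repeatedly, this lemma gives continuity of the lower
    ones. *)
Lemma continuous_of_partials g U a : open U -> U a ->
  (forall k q, U q -> derivable g q (e k)) ->
  (forall k, {for a, continuous (pd k g)}) ->
  {for a, continuous g}.
Proof.
move=> oU Ua dg cg.
have Un : nbhs a U by exact: open_nbhs_nbhs.
have B : nbhs a [set q | U q /\ forall k, `|pd k g a - pd k g q| <= 1].
  apply: filterI => //.
  apply: (@filter_forall _ _ (fun k => [set q | `|pd k g a - pd k g q| <= 1])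
    (nbhs a) (nbhs_filter a)) => k.
  by have /cvgrPdist_le/(_ _ ltr01) := cg k.
have /nbhs_ballP[r r0 Hr] := B.
have Hb q : `|q - a| < r -> U q /\ forall k, `|pd k g a - pd k g q| <= 1.
  by move=> qa; apply: Hr; rewrite -ball_normE /= distrC.
pose C := \sum_k `|pd k g a| + D%:R.
have C0 : 0 <= C by rewrite addr_ge0//; apply: sumr_ge0.
have lip q : `|q - a| < r -> `|g q - g a| <= C * `|q - a|.
  move=> qa.
  have h1 k q' : `|q' - a| <= `|q - a| -> derivable g q' (e k).
    by move=> q'a; apply: dg; have [] := Hb q' (le_lt_trans q'a qa).
  have h2 k q' : `|q' - a| <= `|q - a| -> `|pd k g q' - pd k g a| <= 1.
    by move=> q'a; rewrite distrC; have [_] := Hb q' (le_lt_trans q'a qa).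
  have := telescoping_bound h1 h2.
  have -> : a + (q - a) = q by rewrite addrC subrK.
  rewrite mul1r => H.
  have -> : g q - g a = g q - g a - \sum_k pd k g a * (q - a) ord0 k +
    \sum_k pd k g a * (q - a) ord0 k by rewrite subrK.
  rewrite (le_trans (ler_normD _ _))// /C mulrDl addrC lerD//.
  apply: (le_trans (ler_norm_sum _ _ _)); rewrite mulr_suml; apply: ler_sum => k _.
  by rewrite normrM ler_wpM2l// coord_norm_le.
apply/(@cvgrPdist_le _ _ _ (nbhs a) (nbhs_filter a)) => eps eps0.
apply/nbhs_ballP; exists (Num.min r (eps / (C + 1))).
  by rewrite /= lt_min r0 divr_gt0// ltr_wpDl.
move=> q; rewrite -ball_normE /= distrC lt_min => /andP[qr qe].
rewrite distrC (le_trans (lip q qr))//.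
apply: (@le_trans _ _ ((C + 1) * `|q - a|)); first by rewrite ler_wpM2r// lerDl.
by rewrite mulrC -ler_pdivlMr ?ltr_wpDl// ltW.
Qed.

(** The mean value bound in direction i, applied to the difference of [g] between two parallel
    segments, then in direction j for the derivative. *)
Lemma double_increment g a i j (t c eps : R) :
  (forall q, `|q - a| <= 2 * `|t| -> derivable g q (e i)) ->
  (forall q, `|q - a| <= 2 * `|t| -> derivable (pd i g) q (e j)) ->
  (forall q, `|q - a| <= 2 * `|t| -> `|pd j (pd i g) q - c| <= eps) ->
  `|g (t *: e i + (t *: e j + a)) - g (t *: e i + a)
     - (g (t *: e j + a) - g a) - t ^+ 2 * c| <= eps * t ^+ 2.
Proof.
move=> d1 d2 H.
have inb s s' : `|s| <= `|t| -> `|s'| <= `|t| ->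
    `|s' *: e j + (s *: e i + a) - a| <= 2 * `|t|.
  move=> st s't; rewrite addrA addrK (le_trans (ler_normD _ _))//.
  by rewrite !norm_delta_le mulr_natl mulr2n lerD.
have inb' s s' : `|s| <= `|t| -> `|s'| <= `|t| ->
    `|s *: e i + (s' *: e j + a) - a| <= 2 * `|t|.
  by move=> st s't; rewrite addrCA; exact: inb.
have in0 s : `|s| <= `|t| -> `|s *: e i + a - a| <= 2 * `|t|.
  by move=> st; have := @inb' s 0 st; rewrite scale0r add0r normr0; apply.
pose f s := g (s *: e i + (t *: e j + a)) - g (s *: e i + a) - s * (t * c).
pose f1 s := pd i g (s *: e i + (t *: e j + a)) - pd i g (s *: e i + a) - t * c.
have -> : g (t *: e i + (t *: e j + a)) - g (t *: e i + a)
     - (g (t *: e j + a) - g a) - t ^+ 2 * c = f (0 + t) - f 0.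
  by rewrite /f !add0r !scale0r !add0r; ring.
have -> : eps * t ^+ 2 = eps * `|t| * `|t|.
  by rewrite -mulrA -expr2 real_normK ?num_real.
apply: (@mean_value_bound _ f f1) => s st; rewrite add0r.
  have A : is_derive s 1 (fun s => g (s *: e i + (t *: e j + a)))
      (pd i g (s *: e i + (t *: e j + a))).
    by apply: is_derive_line; apply: d1; exact: inb'.
  have B : is_derive s 1 (fun s => g (s *: e i + a)) (pd i g (s *: e i + a)).
    by apply: is_derive_line; apply: d1; exact: in0.
  have C : is_derive s 1 (fun s => s * (t * c)) (t * c).
    have : is_derive s 1 (fun s => (t * c) * s) ((t * c) *: 1) by apply: is_deriveZ.
    rewrite /GRing.scale/= mulr1; congr (is_derive _ _ _ _).
    by apply/funext => x; rewrite mulrC.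
  exact: is_deriveB.
pose h s' := pd i g (s' *: e j + (s *: e i + a)) - c * s'.
pose h1 s' := pd j (pd i g) (s' *: e j + (s *: e i + a)) - c.
have -> : f1 s = h (0 + t) - h 0.
  by rewrite /f1 /h !add0r scale0r add0r (addrCA (s *: e i)); ring.
apply: (@mean_value_bound _ h h1) => s' s't; rewrite add0r.
  have A : is_derive s' 1 (fun s' => pd i g (s' *: e j + (s *: e i + a)))
      (pd j (pd i g) (s' *: e j + (s *: e i + a))).
    by apply: is_derive_line; apply: d2; exact: inb.
  have B : is_derive s' 1 (fun s' => c * s') (c *: 1) by apply: is_deriveZ.
  by apply: (is_derive_eq (is_deriveB A B)); rewrite /h1 /GRing.scale/= mulr1.
by apply: H; exact: inb.
Qed.

Lemma nbhs_norm_le g a (eps : R) : {for a, continuous g} -> 0 < eps ->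
  nbhs a [set q | `|g a - g q| <= eps].
Proof. by move=> cg eps0; have /cvgrPdist_le/(_ _ eps0) := cg. Qed.

(** Schwarz's theorem. The second difference is symmetric in i and j, and [double_increment]
    compares it with t^2 times either mixed derivative. *)
Lemma partials_commute g U a i j : open U -> U a ->
  (forall k q, U q -> derivable g q (e k)) ->
  (forall k l q, U q -> derivable (pd k g) q (e l)) ->
  (forall k l, {for a, continuous (pd l (pd k g))}) ->
  pd j (pd i g) a = pd i (pd j g) a.
Proof.
move=> oU Ua d1 d2 c2.
set c := pd j (pd i g) a; set c' := pd i (pd j g) a.
apply/eqP; rewrite -subr_eq0 -normr_le0; apply/ler_addgt0Pl => eps eps0.
rewrite addr0; have eps2 : 0 < eps / 2 by rewrite divr_gt0.
have B : nbhs a (U `&` ([set q | `|c - pd j (pd i g) q| <= eps / 2] `&`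
    [set q | `|c' - pd i (pd j g) q| <= eps / 2])).
  apply: filterI; first exact: open_nbhs_nbhs.
  by apply: filterI; [exact: (nbhs_norm_le (c2 i j))|exact: (nbhs_norm_le (c2 j i))].
have /nbhs_ballP[r r0 Hr] := B.
pose t := r / 4; have t0 : 0 < t by rewrite divr_gt0.
have Hb q : `|q - a| <= 2 * `|t| -> [/\ U q, `|c - pd j (pd i g) q| <= eps / 2 &
    `|c' - pd i (pd j g) q| <= eps / 2].
  move=> qa; have /Hr[h1 [h2 h3]] : ball a r q; last exact: (And3 h1 h2 h3).
  rewrite -ball_normE /= distrC (le_lt_trans qa)//.
  by rewrite (gtr0_norm t0) /t; move: (r0 : 0 < r) => r0'; lra.
have A := @double_increment g a i j t c (eps / 2).
have {}A := A (fun q qa => d1 i q (let: And3 u _ _ := Hb q qa in u))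
  (fun q qa => d2 i j q (let: And3 u _ _ := Hb q qa in u)) _.
have A' := @double_increment g a j i t c' (eps / 2).
have {}A' := A' (fun q qa => d1 j q (let: And3 u _ _ := Hb q qa in u))
  (fun q qa => d2 j i q (let: And3 u _ _ := Hb q qa in u)) _.
have {}A : `|g (t *: e i + (t *: e j + a)) - g (t *: e i + a)
     - (g (t *: e j + a) - g a) - t ^+ 2 * c| <= eps / 2 * t ^+ 2.
  apply: A => q qa; rewrite distrC; case: (Hb q qa) => _ hq _; exact: hq.
have {}A' : `|g (t *: e j + (t *: e i + a)) - g (t *: e j + a)
     - (g (t *: e i + a) - g a) - t ^+ 2 * c'| <= eps / 2 * t ^+ 2.
  apply: A' => q qa; rewrite distrC; case: (Hb q qa) => _ _ hq; exact: hq.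
rewrite (addrCA (t *: e j)) distrC in A'.
have t20 : 0 < t ^+ 2 by rewrite exprn_gt0.
rewrite -(ler_pM2l t20) -{1}(gtr0_norm t20) -normrM.
have E (x y z w : R) : t ^+ 2 * (c - c') =
   (t ^+ 2 * c' * (-1) - ((x - y - (z - w)) * (-1))) - (x - z - (y - w) - t ^+ 2 * c).
  by ring.
rewrite (E (g (t *: e i + (t *: e j + a))) (g (t *: e j + a)) (g (t *: e i + a)) (g a)).
rewrite (le_trans (ler_normB _ _))// (_ : t ^+ 2 * eps = eps / 2 * t ^+ 2 + eps / 2 * t ^+ 2).
  apply: lerD => //; apply: le_trans A'.
  by rewrite le_eqVlt; apply/orP; left; apply/eqP; rewrite -normrN; congr (`|_|); ring.
by field.
Qed.

End partial_derivatives.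

Lemma continuous_bigsum {R : realType} {V : topologicalType} {n : nat} (F : 'I_n -> V -> R)
  (v : V) : (forall k, {for v, continuous (F k)}) ->
  {for v, continuous (fun x => \sum_k F k x)}.
Proof.
move=> cF; rewrite (_ : (fun x => _) = \sum_k F k); last first.
  by apply/funext => x; rewrite fct_sumE.
elim/big_ind : _ => [|f g cf cg|k _]; [exact: cst_continuous|exact: continuousD|exact: cF].
Qed.

(** * Measurability of functions that are smooth in a parameter *)

Section measurability_in_parameter.
Context {d} {S : measurableType d} {R : realType} {D : nat}.
Implicit Types (a q : 'rV[R]_D) (U A : set 'rV[R]_D).

(** A limit of difference quotients along a sequence of steps short enough to stay in [U]. *)
Lemma measurable_pd (g : S -> 'rV[R]_D -> R) U a k : open U -> U a ->
  (forall q, U q -> measurable_fun setT (g ^~ q)) ->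
  (forall s, derivable (g s) a (delta_mx 0 k)) ->
  measurable_fun setT (fun s => pd k (g s) a).
Proof.
move=> oU Ua mg dg.
have /nbhs_ballP[r /= r0 Hr] := open_nbhs_nbhs (conj oU Ua).
pose u (n : nat) : R := r / 2 * n.+1%:R^-1.
have u0 n : 0 < u n by rewrite mulr_gt0// ?divr_gt0// invr_gt0 ltr0n.
have ur n : u n < r.
  apply: (@le_lt_trans _ _ (r / 2)); last by lra.
  by rewrite ler_piMr ?divr_ge0 ?(ltW r0)// invf_le1 ?ltr0n// ler1n.
have Uu n : U (u n *: delta_mx 0 k + a).
  by apply: Hr; rewrite -ball_normE /= distrC addrK norm_delta_le gtr0_norm.
have uc : u n @[n --> \oo] --> (0 : R).
  by rewrite -(mulr0 (r / 2)); apply: cvgM; [exact: cvg_cst|exact: cvg_harmonic].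
apply: (@measurable_fun_cvg _ _ _ _
  (fun n s => (u n)^-1 * (g s (u n *: delta_mx 0 k + a) - g s a))).
  by move=> n; apply: measurable_funM => //; apply: measurable_funB; apply: mg.
move=> s _; have /cvgr_dnbhsP h := dg s.
by apply: (h u); split => // n; rewrite gt_eqF.
Qed.

Lemma measurable_normr (h : S -> R) : measurable_fun setT h ->
  measurable_fun setT (fun s => `|h s|).
Proof. by move=> mh; apply: measurableT_comp mh; exact: normr_measurable. Qed.

Lemma measurable_norm_rV (th : S -> 'rV[R]_D) :
  (forall j, measurable_fun setT (fun s => th s ord0 j)) ->
  measurable_fun setT (fun s => `|th s|).
Proof.
move=> mth mD; apply: (measurability _ (RGenOInfty.measurableE R)) => //.
move=> /= _ [_ [c ->] <-]; rewrite preimage_itvoy setTI.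
have [c0|c0] := ltP c 0.
  rewrite (_ : mkset _ = setT)//; apply/seteqP; split => // s _ /=.
  exact: lt_le_trans c0 _.
rewrite (_ : mkset _ = ~` \bigcap_(j in [set: 'I_D]) [set s | `|th s ord0 j| <= c]).
  apply: measurableC; apply: fin_bigcap_measurable => // j _.
  apply: measurable_le_cst; exact: measurable_normr.
apply/seteqP; split => s /=.
  by move=> cs H; have := le_lt_trans (norm_rV_le c0 (fun j => H j I)) cs; rewrite ltxx.
move=> H; rewrite ltNge; apply/negP => sc; apply: H => j _ /=.
exact: le_trans (coord_norm_le _ _) sc.
Qed.

(** For a dense sequence q of [A], continuity gives f s (th s) > c if and only if, for some positive
    e = 1 / (m + 1), every q_i within e of [th s] satisfies f s (q_i) >= c + e. This is a countable
    description. *)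
Lemma measurable_caratheodory (f : S -> 'rV[R]_D -> R) A (th : S -> 'rV[R]_D) :
  (forall q, A q -> measurable_fun setT (f ^~ q)) ->
  (forall s q, A q -> {for q, continuous (f s)}) ->
  (forall s, A (th s)) ->
  (forall j, measurable_fun setT (fun s => th s ord0 j)) ->
  measurable_fun setT (fun s => f s (th s)).
Proof.
move=> mf cf Ath mth.
(* A point of [S] is needed to know that [A] is nonempty and so has a dense sequence. *)
have [[s0 _]|S0] := pselect (exists s : S, True); last first.
  by move=> _ B _; rewrite (_ : _ `&` _ = set0)//; apply/seteqP; split => // s; case: S0; exists s.
have [q [Aq dq]] := @dense_sequence _ _ A (ex_intro _ _ (Ath s0)).
have mdist i : measurable_fun setT (fun s => `|q i - th s|).
  apply: measurable_norm_rV => j.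
  rewrite (_ : (fun s => _) = (fun s => q i ord0 j - th s ord0 j)).
    exact: measurable_funB.
  by apply/funext => s; rewrite !mxE.
move=> mD; apply: (measurability _ (RGenOInfty.measurableE R)) => //.
move=> /= _ [_ [c ->] <-]; rewrite preimage_itvoy setTI.
pose e (m : nat) : R := m.+1%:R^-1.
have e0 m : 0 < e m by rewrite invr_gt0 ltr0n.
have elt x : 0 < x -> exists m, e m < x.
  move=> x0; exists (Num.truncn x^-1); rewrite /e invf_plt ?posrE ?ltr0n//.
  by rewrite truncnS_gt.
rewrite (_ : mkset _ = \bigcup_m \bigcap_i
   ([set s | e m <= `|q i - th s|] `|` [set s | c + e m <= f s (q i)])).
  apply: bigcupT_measurable => m; apply: bigcapT_measurable => i.
  apply: measurableU.
    rewrite -[X in measurable X]setTI; exact: measurable_fun_le.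
  rewrite -[X in measurable X]setTI; apply: measurable_fun_le => //; exact: mf.
apply/seteqP; split => s /=.
  move=> cs; have e1 : 0 < (f s (th s) - c) / 2 by rewrite divr_gt0// subr_gt0.
  have /nbhs_ballP[r /= r0 Hr] := nbhs_norm_le (cf s _ (Ath s)) e1.
  have [m] : exists m, e m < Num.min r ((f s (th s) - c) / 2).
    by apply: elt; rewrite lt_min r0.
  rewrite lt_min => /andP[mr mc]; exists m => // i _.
  have [h|h] := leP (e m) `|q i - th s|; [by left|right => /=].
  have : `|f s (th s) - f s (q i)| <= (f s (th s) - c) / 2.
    by apply: Hr; rewrite -ball_normE /= distrC (lt_trans h).
  by rewrite ler_norml => /andP[_]; move: mc; lra.
move=> [m _ H]; rewrite (@lt_le_trans _ _ (c + e m))// ?ltrDl//.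
apply/ler_addgt0Pr => x x0.
have /nbhs_ballP[r /= r0 Hr] := nbhs_norm_le (cf s _ (Ath s)) x0.
have mr0 : 0 < Num.min r (e m) by rewrite lt_min r0 e0.
have [i] := dq _ _ (Ath s) mr0; rewrite lt_min => /andP[ir im].
have [/=|/= ] := H i I; first by rewrite leNgt distrC im.
have : `|f s (th s) - f s (q i)| <= x by apply: Hr; rewrite -ball_normE.
by rewrite ler_norml => /andP[]; lra.
Qed.

(* The best constant in the second order Taylor bound, as a measurable function of s. *)
Lemma quadratic_remainder (g : S -> 'rV[R]_D -> R) U a eps : (0 < D)%N -> 0 < eps ->
  open U -> (forall q, `|q - a| <= eps -> U q) ->
  (forall q, U q -> measurable_fun setT (g ^~ q)) ->
  (forall s q k, U q -> derivable (g s) q (delta_mx 0 k)) ->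
  (forall s q k j, U q -> derivable (pd k (g s)) q (delta_mx 0 j)) ->
  (forall s q, U q -> {for q, continuous (g s)}) ->
  (forall s, exists K, forall q j k, `|q - a| <= eps -> `|pd j (pd k (g s)) q| <= K) ->
  exists G : S -> R, [/\ measurable_fun setT G, forall s, 0 <= G s,
    forall s v, `|v| <= eps ->
      `|g s (a + v) - g s a - \sum_k pd k (g s) a * v ord0 k| <= `|v| ^+ 2 * G s &
    forall s K, (forall q j k, `|q - a| <= eps -> `|pd j (pd k (g s)) q| <= K) ->
      G s <= D%:R ^+ 2 * K].
Proof.
move=> D0 eps0 oU Ub mg d1 d2 cg bd.
pose rem s v := g s (a + v) - g s a - \sum_k pd k (g s) a * v ord0 k.
pose rat s v := (`|v| ^+ 2)^-1 * `|rem s v|.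
(* The zero increment is left out because the quotient is continuous only away from it; at zero the
   Taylor bound is trivial. *)
pose A : set 'rV[R]_D := [set v | v != 0 /\ `|v| <= eps].
have Ua : U a by apply: Ub; rewrite subrr normr0 ltW.
have Uv v : `|v| <= eps -> U (a + v) by move=> h; apply: Ub; rewrite addrAC subrr add0r.
have ratK s K : (forall q j k, `|q - a| <= eps -> `|pd j (pd k (g s)) q| <= K) ->
    forall v, A v -> rat s v <= D%:R ^+ 2 * K.
  move=> HK v [v0 ve]; rewrite /rat mulrC ler_pdivrMr ?exprn_gt0 ?normr_gt0// mulrC.
  apply: taylor_of_partials => [k q qv|j k q qv|j k q qv].
  - by apply: d1; apply: Ub; exact: le_trans ve.
  - by apply: d2; apply: Ub; exact: le_trans ve.
  - by apply: HK; exact: le_trans ve.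
have [||||G [mG GA GK]] := @measurable_supremum _ S R D rat A.
- exists (eps *: delta_mx 0 (Ordinal D0)); split.
    by rewrite -normr_gt0 norm_delta_le normr_gt0 gt_eqF.
  by rewrite norm_delta_le gtr0_norm.
- move=> v [v0 ve]; apply: measurable_funM => //.
  apply: measurable_normr.
  apply: measurable_funB; first by apply: measurable_funB; apply: mg; [exact: Uv|].
  apply: measurable_sum => k; apply: measurable_funM => //.
  by apply: (measurable_pd oU Ua) => // s; exact: d1.
- move=> s v [v0 ve].
  have cn : {for v, continuous (fun v : 'rV[R]_D => `|v|)} by exact: norm_continuous.
  have c1 : {for v, continuous (fun v : 'rV[R]_D => g s (a + v))}.
    apply: (@continuous_comp _ _ _ (fun v => a + v) (g s)); last exact/cg/Uv.
    by apply: continuousD; [exact: cst_continuous|exact: cvg_id].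
  have c2 : {for v, continuous (fun v : 'rV[R]_D => \sum_k pd k (g s) a * v ord0 k)}.
    apply: continuous_bigsum => k; apply: continuousM; first exact: cst_continuous.
    exact: coord_continuous.
  apply: (@continuousM _ _ (fun v : 'rV[R]_D => (`|v| ^+ 2)^-1) (fun v => `|rem s v|)).
    apply: continuousV; first by rewrite expf_neq0// normr_eq0.
    exact: (@continuousM _ _ (fun v : 'rV[R]_D => `|v|) (fun v : 'rV[R]_D => `|v|)).
  apply: (@continuous_comp _ _ _ (rem s) (fun x => `|x|)); last exact: norm_continuous.
  apply: continuousB => //; apply: continuousB => //; exact: cst_continuous.
- by move=> s; have [K HK] := bd s; exists (D%:R ^+ 2 * K); exact: ratK.
exists (fun s => Num.max 0 (G s)); split.
- exact: measurable_maxr.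
- by move=> s; rewrite le_max lexx.
- move=> s v ve; have [->|v0] := eqVneq v 0.
    rewrite addr0 subrr normr0 expr0n/= mul0r big1 ?subrr ?normr0// => k _.
    by rewrite mxE mulr0.
  have : rat s v <= Num.max 0 (G s) by rewrite le_max GA ?orbT.
  by rewrite /rat mulrC ler_pdivrMr ?exprn_gt0 ?normr_gt0// mulrC.
- move=> s K HK; rewrite ge_max GK ?andbT; last exact: ratK.
  rewrite mulr_ge0 ?exprn_ge0//.
  by apply: le_trans (HK a (Ordinal D0) (Ordinal D0) _); rewrite ?subrr ?normr0 ?(ltW eps0).
Qed.

End measurability_in_parameter.

Lemma ler_norm_shift {R : realDomainType} (x y c c' : R) :
  `|x - y| <= c -> c <= c' -> `|x| <= `|y| + c'.
Proof.
move=> xc cc; rewrite -[x](subrK y) addrC (le_trans (ler_normD _ _))// lerD2l.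
exact: le_trans cc.
Qed.

Lemma ler_norm_affine {R : realDomainType} (x y z c : R) :
  `|x - y - z| <= c -> `|x| <= `|y| + (`|z| + c).
Proof.
rewrite -addrA -opprD => /ler_norm_shift/(_ (lexx c))/le_trans; apply.
by rewrite addrA lerD2r ler_normD.
Qed.

(** * First order conditions at a maximum *)

Section stationarity.
Context {R : realType} {D : nat}.
Implicit Types (a q : 'rV[R]_D).

Lemma interior_max_pd (F : 'rV[R]_D -> R) a k r : 0 < r ->
  (forall q, `|q - a| < r -> F q <= F a) ->
  (forall q, `|q - a| < r -> derivable F q (delta_mx 0 k)) -> pd k F a = 0.
Proof.
move=> r0 Fmax dF.
have a0 : a = (0 : R) *: delta_mx 0 k + a by rewrite scale0r add0r.
have inr t : t \in `](- r), r[ -> `|t *: delta_mx 0 k + a - a| < r.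
  by rewrite in_itv/= addrK norm_delta_le ltr_norml.
have F0 : is_derive (0 : R) 1 (fun t : R => F (t *: delta_mx 0 k + a)) 0.
  apply: (@derive1_at_max _ (fun t : R => F (t *: delta_mx 0 k + a)) (- r) r).
  - by rewrite ge0_cp// ltW.
  - by move=> t /inr h; have [] := is_derive_line (dF _ h).
  - by rewrite in_itv/= oppr_lt0 r0.
  - by move=> t /inr h; rewrite -a0; exact: Fmax.
by have [] := is_derive_pd F0.
Qed.

Lemma pd_sum n (F : 'I_n -> 'rV[R]_D -> R) a k :
  (forall i, derivable (F i) a (delta_mx 0 k)) ->
  derivable (fun q => \sum_i F i q) a (delta_mx 0 k) /\
  pd k (fun q => \sum_i F i q) a = \sum_i pd k (F i) a.
Proof.
move=> dF; have -> : (fun q => \sum_i F i q) = \sum_i F i.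
  by apply/funext => q; rewrite fct_sumE.
rewrite /pd; have [? ->] := is_derive_sum (fun i => derivableP (dF i)).
by split.
Qed.

(** The second derivative on the segment is bounded by its value at [a] plus eps times a bound on
    the third one. For the log-likelihood this makes the coefficient of t^2 integrable. *)
Lemma pd_line_bound (g : 'rV[R]_D -> R) a k (t eps K : R) : `|t| <= eps ->
  (forall q, `|q - a| <= eps -> derivable g q (delta_mx 0 k)) ->
  (forall q, `|q - a| <= eps -> derivable (pd k g) q (delta_mx 0 k)) ->
  (forall q, `|q - a| <= eps -> derivable (pd k (pd k g)) q (delta_mx 0 k)) ->
  (forall q, `|q - a| <= eps -> `|pd k (pd k (pd k g)) q| <= K) ->
  `|g (t *: delta_mx 0 k + a) - g a - pd k g a * t|
    <= (`|pd k (pd k g) a| + eps * K) * t ^+ 2.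
Proof.
move=> te d1 d2 d3 HK.
have inb y : `|y| <= `|t| -> `|y *: delta_mx 0 k + a - a| <= eps.
  by move=> yt; rewrite addrK norm_delta_le (le_trans yt).
have K0 : 0 <= K.
  by apply: le_trans (HK a _); rewrite // subrr normr0 (le_trans _ te).
pose f n := fun y : R => iter n (pd k) g (y *: delta_mx 0 k + a).
have df n : (forall q, `|q - a| <= eps -> derivable (iter n (pd k) g) q (delta_mx 0 k)) ->
    forall y : R, `|y| <= `|t| -> is_derive ((0 : R) + y) 1 (f n) (f n.+1 ((0 : R) + y)).
  by move=> dn y yt; rewrite add0r; apply: is_derive_line; apply: dn; exact: inb.
have f0 n : f n 0 = iter n (pd k) g a by rewrite /f scale0r add0r.
have := @taylor1_bound _ (f 0%N) (f 1%N) (f 2%N) 0 t (`|pd k (pd k g) a| + eps * K)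
  (df 0%N d1) (df 1%N d2).
rewrite add0r !f0 /f/=; apply => y yt; rewrite add0r.
have : `|f 2%N (0 + y) - f 2%N 0| <= K * `|y|.
  apply: (@mean_value_bound _ (f 2%N) (f 3%N)) => z zy.
    by apply: (df 2%N d3); exact: le_trans yt.
  by rewrite add0r; apply: HK; apply: inb; exact: le_trans yt.
rewrite f0 /f add0r/= => H.
apply: (ler_norm_shift H); rewrite mulrC ler_wpM2r//; exact: le_trans te.
Qed.

End stationarity.

Lemma C3_on_continuous {R : realType} {n} (U : set 'rV[R]_n) (g : 'rV[R]_n -> R) a :
  open U -> C3_on U g -> U a ->
  [/\ forall i j, {for a, continuous (pd j (pd i g))},
      forall i, {for a, continuous (pd i g)} & {for a, continuous g}].
Proof.
move=> oU g3 Ua.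
have c2 i j b : U b -> {for b, continuous (pd j (pd i g))}.
  move=> Ub; apply: (continuous_of_partials oU Ub).
    by move=> k q Uq; case: (g3 i j k q Uq) => _ _ h _; exact: h.
  by move=> k; case: (g3 i j k b Ub) => _ _ _ h; exact: h.
have c1 i b : U b -> {for b, continuous (pd i g)}.
  move=> Ub; apply: (continuous_of_partials oU Ub).
    by move=> k q Uq; case: (g3 i k k q Uq) => _ h _ _; exact: h.
  by move=> k; exact: c2.
split => [i j|i|]; [exact: c2|exact: c1|].
apply: (continuous_of_partials oU Ua).
  by move=> k q Uq; case: (g3 k k k q Uq) => h _ _ _; exact: h.
by move=> k; exact: c1.
Qed.

(** * Second moment of a linear combination *)

Section quadratic_mean.
Context {d} {T : measurableType d} {R : realType} (P : probability T R).

Lemma L1_mul_of_sqr (X Y : T -> R) : measurable_fun setT X -> measurable_fun setT Y ->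
  L1 P (fun w => X w ^+ 2) -> L1 P (fun w => Y w ^+ 2) -> L1 P (fun w => X w * Y w).
Proof.
move=> mX mY lX lY; apply: (L1_le _ (L1D lX lY)); first exact: measurable_funM.
move=> w; rewrite normrM.
have := sqr_ge0 (`|X w| - `|Y w|).
rewrite -(@real_normK _ (X w)) ?num_real// -(@real_normK _ (Y w)) ?num_real//.
by have := normr_ge0 (X w); have := normr_ge0 (Y w); nra.
Qed.

Lemma Ex_sqr_linear n (u : 'rV[R]_n) (Z : 'I_n -> T -> R) :
  (forall a, measurable_fun setT (Z a)) -> (forall a, L1 P (fun w => Z a w ^+ 2)) ->
  let V := \matrix_(a, b) (Ex P (fun w => Z a w * Z b w) - Ex P (Z a) * Ex P (Z b)) in
  let X w := \sum_a u ord0 a * (Z a w - Ex P (Z a)) in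
  L1 P (fun w => X w ^+ 2) /\ Ex P (fun w => X w ^+ 2) = (u *m V *m u^T) ord0 ord0.
Proof.
move=> mZ lZ2 V X; have lZ a : L1 P (Z a) by apply: L1_of_sqr.
have lZZ a b : L1 P (fun w => Z a w * Z b w) by apply: L1_mul_of_sqr.
pose C a b w := u ord0 a * u ord0 b * ((Z a w * Z b w - Ex P (Z b) * Z a w)
  - (Ex P (Z a) * Z b w - Ex P (Z a) * Ex P (Z b))).
have l1 a b : L1 P (fun w => Z a w * Z b w - Ex P (Z b) * Z a w).
  by apply: L1B => //; exact: L1Z.
have l2 a b : L1 P (fun w => Ex P (Z a) * Z b w - Ex P (Z a) * Ex P (Z b)).
  by apply: L1B; [exact: L1Z|exact: L1_cst].
have l12 a b : L1 P (fun w => (Z a w * Z b w - Ex P (Z b) * Z a w)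
  - (Ex P (Z a) * Z b w - Ex P (Z a) * Ex P (Z b))) by apply: L1B.
have lC a b : L1 P (C a b) by apply: L1Z.
have EC a b : Ex P (C a b) = u ord0 a * u ord0 b * V a b.
  rewrite /C ExZ// ExB// ExB//; last exact: L1Z.
  rewrite ExZ// ExB//; [|exact: L1Z|exact: L1_cst].
  by rewrite ExZ// Ex_cst mxE; ring.
have XE : (fun w => X w ^+ 2) = (fun w => \sum_a \sum_b C a b w).
  apply/funext => w; rewrite expr2 /X mulr_suml; apply: eq_bigr => a _.
  by rewrite mulr_sumr; apply: eq_bigr => b _; rewrite /C; ring.
rewrite XE; split; first by apply: L1_sum => a; exact: L1_sum.
rewrite Ex_sum; last by move=> a; exact: L1_sum.
rewrite mxE; under [RHS]eq_bigr => b _ do rewrite mxE mulr_suml.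
rewrite exchange_big; apply: eq_bigr => a _; rewrite Ex_sum//; apply: eq_bigr => b _.
by rewrite EC (mxE _ _ b); ring.
Qed.

End quadratic_mean.

(** * M-estimation with a smooth criterion *)

Section smooth_m_estimation.
Context {d d1} {T : measurableType d} {S : measurableType d1} {R : realType}
  (P : probability T R).
Variables (O : nat -> T -> S) (O0 : T -> S).
Hypothesis iidO : iid_copies P O O0.
Variable D : nat.
Hypothesis D0 : (0 < D)%N.
Variables (l H : S -> 'rV[R]_D -> R) (Theta U : set 'rV[R]_D) (ths : 'rV[R]_D).
Variables (thh : nat -> T -> 'rV[R]_D) (eps : R) (M : T -> R).
Let e k : 'rV[R]_D := delta_mx 0 k.
Hypotheses (oU : open U) (TU : Theta `<=` U) (cTheta : compact Theta)
  (Tint : (Theta°) ths).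
Hypotheses (ml : forall q, U q -> measurable_fun setT (l ^~ q))
  (mH : forall q, U q -> measurable_fun setT (H ^~ q)).
Hypothesis l3 : forall s, C3_on U (l s).
Hypotheses (dH1 : forall s q k, U q -> derivable (H s) q (e k))
  (dH2 : forall s q k j, U q -> derivable (pd k (H s)) q (e j))
  (cH : forall s q, U q -> {for q, continuous (H s)}).
Hypothesis eps0 : 0 < eps.
Hypotheses (bd : forall s, exists K, forall i j k q, `|q - ths| <= eps ->
      `|pd k (pd j (pd i (l s))) q| <= K /\ `|pd j (pd i (H s)) q| <= K)
  (lM : L1 P M)
  (bdM : forall w i j k q, `|q - ths| <= eps ->
      `|pd k (pd j (pd i (l (O0 w)))) q| <= M w /\ `|pd j (pd i (H (O0 w))) q| <= M w).
Hypothesis dom : forall th, Theta th -> exists rho b, [/\ 0 < rho, L1 P b,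
  forall w, 0 <= b w &
  forall w th', Theta th' -> `|th' - th| < rho -> l (O0 w) th' <= b w].
Hypothesis lths : L1 P (fun w => l (O0 w) ths).
Hypothesis ident : forall th, Theta th -> th != ths ->
  (\int[P]_w (l (O0 w) th)%:E < \int[P]_w (l (O0 w) ths)%:E)%E.
Hypothesis thhT : forall n w, Theta (thh n w).
Hypothesis thh_max : forall n w th, Theta th ->
  \sum_(i < n) l (O i w) th <= \sum_(i < n) l (O i w) (thh n w).
Hypothesis mthh : forall n j, measurable_fun setT (fun w => thh n w ord0 j).
Hypotheses (lH2 : L1 P (fun w => H (O0 w) ths ^+ 2))
  (lpsi2 : forall j, L1 P (fun w => pd j (l (O0 w)) ths ^+ 2))
  (ldH : forall k, L1 P (fun w => pd k (H (O0 w)) ths))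
  (ldpsi : forall i j, L1 P (fun w => pd i (pd j (l (O0 w))) ths)).
Variables (J : 'M[R]_D) (hv : 'rV[R]_D).
Hypotheses (Ju : J \in unitmx)
  (JE : forall i j, J i j = - Ex P (fun w => pd i (pd j (l (O0 w))) ths))
  (hvE : forall k, hv ord0 k = Ex P (fun w => pd k (H (O0 w)) ths)).

Let mO0 := iid_copies_measurable0 iidO.
Let Tths : Theta ths := interior_subset Tint.
Let Uths : U ths := TU Tths.

Let dl1 s q k : U q -> derivable (l s) q (e k).
Proof. by move=> Uq; case: (l3 s k k k Uq) => h1 h2 h3 _; exact: h1. Qed.
Let dl2 s q k j : U q -> derivable (pd k (l s)) q (e j).
Proof. by move=> Uq; case: (l3 s k j j Uq) => h1 h2 h3 _; exact: h2. Qed.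
Let dl3 s q k j i : U q -> derivable (pd j (pd k (l s))) q (e i).
Proof. by move=> Uq; case: (l3 s k j i Uq) => h1 h2 h3 _; exact: h3. Qed.
Let mpsi q k : U q -> measurable_fun setT (fun s => pd k (l s) q).
Proof. by move=> Uq; apply: (measurable_pd oU Uq ml) => s; exact: dl1. Qed.
Let mdpsi q k j : U q -> measurable_fun setT (fun s => pd j (pd k (l s)) q).
Proof.
move=> Uq; apply: (@measurable_pd _ _ _ _ (fun s => pd k (l s)) U) => //.
  by move=> q' Uq'; exact: mpsi.
by move=> s; exact: dl2.
Qed.

Let small : exists2 r, 0 < r <= eps & forall q, `|q - ths| <= r -> Theta q.
Proof.
have /nbhs_ballP[r /= r0 Hr] := Tint.
exists (Num.min eps (r / 2)).
  by rewrite lt_min eps0 divr_gt0//= ge_min lexx.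
move=> q; rewrite le_min => /andP[_ qr]; apply: Hr; rewrite -ball_normE /= distrC.
by apply: (le_lt_trans qr); rewrite ltr_pdivrMr// ltr_pMr// ltr1n.
Qed.

(** Along coordinate j the criterion equals its tangent up to N t^2 with [N] integrable. Since its
    mean is largest at [ths], t E psi_j <= t^2 E N for all small t of either sign, which forces E
    psi_j = 0. *)
Lemma score_mean_zero j : Ex P (fun w => pd j (l (O0 w)) ths) = 0.
Proof.
have [r /andP[r0 re] rT] := small.
have rU q : `|q - ths| <= r -> U q by move=> /rT/TU.
pose N w := `|pd j (pd j (l (O0 w))) ths| + r * M w.
have lN : L1 P N by apply: L1D; [exact: L1_norm|exact: L1Z].
have lpsi : L1 P (fun w => pd j (l (O0 w)) ths).
  by apply: L1_of_sqr => //; exact: (measurableT_comp (mpsi j Uths) mO0).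
have bnd w t : `|t| <= r ->
    `|l (O0 w) (t *: e j + ths) - l (O0 w) ths - pd j (l (O0 w)) ths * t| <= N w * t ^+ 2.
  move=> tr; apply: pd_line_bound tr _ _ _ _ => q qr.
  - exact/dl1/rU.
  - exact/dl2/rU.
  - exact/dl3/rU.
  - by apply: (bdM w j j j _).1; exact: le_trans re.
have inT t : `|t| <= r -> Theta (t *: e j + ths).
  by move=> tr; apply: rT; rewrite addrK norm_delta_le.
(* The same expansion gives integrability at nearby parameters, so that [ident] can be read as an
   inequality of real means. *)
have lt t : `|t| <= r -> L1 P (fun w => l (O0 w) (t *: e j + ths)).
  move=> tr; pose b w := `|l (O0 w) ths| + (`|t| * `|pd j (l (O0 w)) ths| + t ^+ 2 * N w).
  apply: (@L1_le _ _ _ P _ b).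
  - exact: (measurableT_comp (ml (TU (inT t tr))) mO0).
  - by apply: L1D; [exact: L1_norm|apply: L1D; apply: L1Z => //; exact: L1_norm].
  - move=> w; have := bnd w t tr; rewrite /b (mulrC (t ^+ 2)) (mulrC `|t|) -normrM.
    exact: ler_norm_affine.
have le0 t : `|t| <= r -> t * Ex P (fun w => pd j (l (O0 w)) ths) <= t ^+ 2 * Ex P N.
  move=> tr; rewrite -!ExZ// -subr_ge0 -ExB; [|exact: L1Z|exact: L1Z].
  have [t0|t0] := eqVneq (t *: e j + ths) ths.
    have : t *: e j = 0 by apply: (@addIr _ ths); rewrite add0r.
    move=> /(congr1 (fun x => `|x|)); rewrite norm_delta_le normr0 => /eqP.
    rewrite normr_eq0 => /eqP ->; apply: Ex_ge0 => w; rewrite !mul0r expr0n/= mul0r.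
    by rewrite subrr.
  have := ident (inT t tr) t0; rewrite (EFin_Ex (lt t tr)) (EFin_Ex lths) lte_fin => h.
  have lb : L1 P (fun w => t ^+ 2 * N w - t * pd j (l (O0 w)) ths).
    by apply: L1B; exact: L1Z.
  have lc : L1 P (fun w => l (O0 w) ths - l (O0 w) (t *: e j + ths)).
    by apply: L1B => //; exact: lt.
  apply: (@le_trans _ _ (Ex P (fun w => l (O0 w) ths - l (O0 w) (t *: e j + ths)))).
    by rewrite ExB ?subr_ge0 ?(ltW h)//; exact: lt.
  apply: Ex_le => // w; have := bnd w t tr; rewrite ler_norml => /andP[+ _].
  by lra.
apply: (@eq0_of_le_linear _ _ (r * Ex P N)) => t /andP[t0 t1].
have rt : 0 < r * t by rewrite mulr_gt0.
have rtr : `|r * t| <= r by rewrite gtr0_norm// ler_piMr// ltW.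
rewrite ler_norml -(ler_pM2l rt) -[X in _ && X](ler_pM2l rt); apply/andP; split.
  have := le0 (- (r * t)); rewrite normrN => /(_ rtr).
  by rewrite sqrrN mulNr lerNl; congr (_ <= _); ring.
by have := le0 _ rtr; congr (_ <= _); ring.
Qed.

Let mnorm n : measurable_fun setT (fun w => `|thh n w - ths|).
Proof.
apply: measurable_norm_rV => j.
rewrite (_ : (fun w => _) = (fun w => thh n w ord0 j - ths ord0 j)).
  exact: measurable_funB.
by apply/funext => w; rewrite !mxE.
Qed.

Lemma m_estimator_consistent x : 0 < x ->
  Pr P [set w | x <= `|thh n w - ths|] @[n --> \oo] --> (0 : R).
Proof.
move=> x0; apply: (argmax_consistency iidO cTheta Tths _ _ dom lths ident thhT _ mnorm x0).
- by move=> q /TU; exact: ml.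
- by move=> s q /TU Uq; have [_ _] := C3_on_continuous oU (l3 s) Uq.
- by move=> n w; exact: thh_max.
Qed.

Lemma score_equation r n w j : (forall q, `|q - ths| <= r -> Theta q) ->
  `|thh n w - ths| < r -> \sum_(i < n) pd j (l (O i w)) (thh n w) = 0.
Proof.
move=> rT tr; have Ut := TU (thhT n w).
have [_ <-] := pd_sum (fun i : 'I_n => @dl1 (O i w) _ j Ut).
apply: (@interior_max_pd _ _ _ _ _ (r - `|thh n w - ths|)); rewrite ?subr_gt0//.
  move=> q qr; apply/thh_max/rT; rewrite -(subrK (thh n w) q) -addrA.
  by rewrite (le_trans (ler_normD _ _))// -lerBrDr ltW.
move=> q qr; have Uq : U q.
  apply/TU/rT; rewrite -(subrK (thh n w) q) -addrA.
  by rewrite (le_trans (ler_normD _ _))// -lerBrDr ltW.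
by have [] := pd_sum (fun i : 'I_n => @dl1 (O i w) _ j Uq).
Qed.

Let pd_comm s j k : pd j (pd k (l s)) ths = pd k (pd j (l s)) ths.
Proof.
apply: (@partials_commute R D (l s) U ths k j oU Uths).
- by move=> i q; exact: dl1.
- by move=> i i' q; exact: dl2.
- by move=> i i'; have [h _ _] := C3_on_continuous oU (l3 s) Uths; exact: h.
Qed.

Lemma smooth_estimating_clt (sd : R) : 0 < sd ->
  L1 P (fun w => influence P O0 H (fun j s => pd j (l s)) ths J hv (O0 w) ^+ 2) ->
  Ex P (fun w => influence P O0 H (fun j s => pd j (l s)) ths J hv (O0 w) ^+ 2) = sd ^+ 2 ->
  cvg_in_dist_normal P (statistic P O O0 H ths thh) (sd ^+ 2).
Proof.
move=> sd0 li Ei; have [r /andP[r0 re] rT] := small.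
have rU q : `|q - ths| <= r -> U q by move=> /rT/TU.
have [|GH [mGH GH0 HGH GHK]] := quadratic_remainder D0 r0 oU rU mH dH1 dH2 cH.
  move=> s; have [K HK] := bd s; exists K => q j k qr.
  by case: (HK k j j q (le_trans qr re)) => _ h; exact: h.
have Hpsi (j : 'I_D) : exists G : S -> R, [/\ measurable_fun setT G, forall s, 0 <= G s,
    forall s v, `|v| <= r ->
      `|pd j (l s) (ths + v) - pd j (l s) ths - \sum_k pd k (pd j (l s)) ths * v ord0 k|
        <= `|v| ^+ 2 * G s &
    forall s K, (forall q i k, `|q - ths| <= r -> `|pd i (pd k (pd j (l s))) q| <= K) ->
      G s <= D%:R ^+ 2 * K].
  apply: (quadratic_remainder (g := fun s => pd j (l s)) D0 r0 oU rU).
  - by move=> q; exact: mpsi.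
  - by move=> s q k; exact: dl2.
  - by move=> s q k i; exact: dl3.
  - by move=> s q Uq; have [_ h _] := C3_on_continuous oU (l3 s) Uq; exact: h.
  - move=> s; have [K HK] := bd s; exists K => q i k qr.
    by case: (HK j k i q (le_trans qr re)) => h _; exact: h.
(* The law of large numbers needs a measurable function of the observation. [M] depends on the
   sample point [w], so it only serves to bound the mean of these constants. *)
pose Gp j := projT1 (cid (Hpsi j)); have GpP j := projT2 (cid (Hpsi j)).
have mGp j : measurable_fun setT (Gp j) by case: (GpP j).
have Gp0 j s : 0 <= Gp j s by case: (GpP j) => _ h _ _; exact: h.
pose G s := GH s + \sum_j Gp j s.
have sum0 s : 0 <= \sum_j Gp j s by apply: sumr_ge0 => j _; exact: Gp0.
have mG : measurable_fun setT G by apply: measurable_funD => //; exact: measurable_sum.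
have lG : L1 P (G \o O0).
  pose b w := D%:R ^+ 2 * M w + \sum_(j < D) D%:R ^+ 2 * M w.
  apply: (@L1_le _ _ _ P _ b).
  - exact: (measurableT_comp mG mO0).
  - by apply: L1D; [exact: L1Z|apply: L1_sum => j; exact: L1Z].
  - move=> w; rewrite /= ger0_norm ?addr_ge0//; apply: lerD.
      apply: GHK => q j k qr.
      by case: (bdM w k j j (le_trans qr re)) => _ h; exact: h.
    apply: ler_sum => j _; case: (GpP j) => _ _ _; apply => q i k qr.
    by case: (bdM w j k i (le_trans qr re)) => h _; exact: h.
apply: (@estimating_equation_clt _ _ _ _ _ P O O0 iidO D H (fun j s => pd j (l s))
  (fun k s => pd k (H s) ths) (fun j k s => pd k (pd j (l s)) ths) G ths thh r r0
  _ _ _ _ mG _ lH2 lpsi2 ldH _ lG _ _ _ mnorm m_estimator_consistent score_mean_zero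
  J hv Ju _ _ sd sd0 _ li Ei).
- exact: mH.
- by move=> j; exact: mpsi.
- by move=> k; apply: (measurable_pd oU Uths mH) => s; exact: dH1.
- by move=> j k; exact: mdpsi.
- by move=> s; rewrite addr_ge0.
- by move=> j k; exact: ldpsi.
- by move=> s v vr; rewrite (le_trans (HGH s v vr))// ler_wpM2l// lerDl.
- move=> j s v vr; have [_ _ h _] := GpP j; apply: (le_trans (h s v vr)).
  by rewrite ler_wpM2l// /G (bigD1 j)//= addrCA lerDl addr_ge0//; apply: sumr_ge0 => i _; exact: Gp0.
- by move=> n w tr j; exact: score_equation tr.
(* The Taylor expansion of score j differentiates along j first and k second, the entry of [J] in
   the opposite order. *)
- move=> j k; rewrite JE.
  have E : (fun w => pd j (pd k (l (O0 w))) ths) = (fun w => pd k (pd j (l (O0 w))) ths).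
    by apply/funext => w; exact: pd_comm.
  exact: (congr1 (fun f => - Ex P f) E).
- by move=> k; rewrite hvE.
(* The estimator depends on [w] along with the observation, hence the recourse to
   [measurable_caratheodory]. *)
- move=> n; apply: measurable_funB => //; apply: measurable_funM => //.
  apply: measurable_sum => i.
  apply: (@measurable_caratheodory _ _ _ _ (fun w => H (O i w)) U) => //.
  + move=> q Uq; exact: (measurableT_comp (mH Uq) (iid_copies_measurable iidO i)).
  + by move=> w q Uq; exact: cH.
  + by move=> w; exact/TU.
Qed.

(** As the scores are centred, the influence function is the inner product of u with the centred
    vector z, of variance u V u^T. The leading 1 makes u nonzero, so this variance is positive. *)
Lemma smooth_m_estimation_clt (z : 'I_(1 + D) -> T -> R) :
  (forall a w, z a w =
     row_mx (\row_(_ < 1) H (O0 w) ths) (\row_j pd j (l (O0 w)) ths) ord0 a) ->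
  let V := \matrix_(a, b) (Ex P (fun w => z a w * z b w) - Ex P (z a) * Ex P (z b)) in
  let u := row_mx (1 : 'M[R]_1) (hv *m invmx J) in
  (forall v : 'rV[R]_(1 + D), v != 0 -> 0 < (v *m V *m v^T) ord0 ord0) ->
  cvg_in_dist_normal P (statistic P O O0 H ths thh) ((u *m V *m u^T) ord0 ord0).
Proof.
move=> zE' V u Vpos.
have zl w : z (lshift D ord0) w = H (O0 w) ths by rewrite zE' row_mxEl mxE.
have zr j w : z (rshift 1 j) w = pd j (l (O0 w)) ths by rewrite zE' row_mxEr mxE.
have zE a : a = lshift D ord0 \/ exists j, a = rshift 1 j.
  rewrite -(splitK a); case: (fintype.split a) => [i|j]; last by right; exists j.
  by left; rewrite (ord1 i).
have mz a : measurable_fun setT (z a).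
  case: (zE a) => [->|[j ->]].
    by rewrite (funext zl); exact: (measurableT_comp (mH Uths) mO0).
  by rewrite (funext (zr j)); exact: (measurableT_comp (mpsi j Uths) mO0).
have lz a : L1 P (fun w => z a w ^+ 2).
  case: (zE a) => [->|[j ->]].
    by under [X in L1 _ X]eq_fun do rewrite zl.
  by under [X in L1 _ X]eq_fun do rewrite zr.
have XE : (fun w => (\sum_a u ord0 a * (z a w - Ex P (z a))) ^+ 2) =
    (fun w => influence P O0 H (fun j s => pd j (l s)) ths J hv (O0 w) ^+ 2).
  apply/funext => w; rewrite big_split_ord/= big_ord1 row_mxEl mxE eqxx mul1r.
  rewrite zl (funext zl); congr ((_ + _) ^+ 2); apply: eq_bigr => j _.
  by rewrite row_mxEr zr (funext (zr j)) score_mean_zero subr0.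
have := Ex_sqr_linear u mz lz; rewrite /= XE => -[li Ei].
have u0 : u != 0.
  apply/negP => /eqP/(congr1 lsubmx); rewrite row_mxKl => /matrixP/(_ ord0 ord0).
  by rewrite !mxE eqxx => /eqP; rewrite oner_eq0.
have s0 := Vpos u u0; have sE := sqr_sqrtr (ltW s0).
rewrite -sE; apply: smooth_estimating_clt => //; first by rewrite sqrtr_gt0.
by rewrite sE.
Qed.

End smooth_m_estimation.

(** * Integrals depending measurably on a parameter *)

Section sigma_finite_copy.
Context {d} {B : measurableType d} {R : realType} (nu : {measure set B -> \bar R}).

(* The proof argument makes sigma-finiteness available to structure inference. *)
Definition sigma_finite_copy (sf : sigma_finite setT nu) : set B -> \bar R := nu.

Variable sf : sigma_finite setT nu.

HB.instance Definition _ := Measure.copy (sigma_finite_copy sf) nu.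
HB.instance Definition _ := Measure_isSigmaFinite.Build _ _ _ (sigma_finite_copy sf) sf.

End sigma_finite_copy.

Lemma measurable_parametric_integral {d d'} {A : measurableType d} {B : measurableType d'}
  {R : realType} (nu : {measure set B -> \bar R}) (F : A * B -> \bar R) :
  sigma_finite setT nu -> measurable_fun setT F -> (forall z, (0 <= F z)%E) ->
  measurable_fun setT (fun x => \int[nu]_y F (x, y))%E.
Proof.
move=> sf mF F0.
exact: (@measurable_fun_fubini_tonelli_F _ _ _ _ _ (sigma_finite_copy sf) F mF F0).
Qed.

(** * Measurability in the propensity score model *)

Section propensity_model.
Context {R : realType} {k m p : nat}.
Notation D := (m + p).+2.
Variables (nu : {measure set R -> \bar R}) (f : 'rV[R]_p -> k.-tuple R -> R -> R)
  (rr : k.-tuple R -> 'rV[R]_m).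
Implicit Types (th : 'rV[R]_D) (x : k.-tuple R) (y r u : R).

Let pi := pifun nu f rr.

Lemma pifun_lt1 x th : 0 < pi x th < 1.
Proof.
rewrite /pi /pifun; set u := _ + _ + _; have u0 := expR_gt0 u.
by rewrite invr_gt0 invf_lt1 ?ltrDl ?u0 addr_gt0.
Qed.

(** [H] in the variable u = ln (1 - pi), obtained by expanding (r - pi)^2 - pi (1 - pi) at pi = 1 -
    exp u. It is smooth on the whole line. *)
Definition Hpoly r u := (r - 1) ^+ 2 + (2 * r - 3) * expR u + 2 * expR (2 * u).

Lemma is_derive_Hpoly (a b c x : R) :
  is_derive x 1 (fun u => a + b * expR u + c * expR (2 * u))
    (0 + b * expR x + 2 * c * expR (2 * x)).
Proof.
have h1 : is_derive x 1 (fun u => a + b * expR u) (0 + b *: expR x).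
  by apply: is_deriveD; apply: is_deriveZ.
have h2 : is_derive x 1 (fun u : R => expR (2 * u)) (expR (2 * x) * (2 *: (1 : R))).
  apply: (@is_derive1_comp _ expR (fun u => 2 * u)).
have := is_deriveD h1 (is_deriveZ c h2); rewrite /GRing.scale/= mulr1.
move=> h; apply: (is_derive_eq h); ring.
Qed.

(* With R = 0 the likelihood is 1 - pi, whatever Y. *)
Lemma HfunE x r : Hfun nu f rr x r = Hpoly r \o ell (m := m) nu f rr 0 x 0.
Proof.
apply/funext => th; have /andP[p0 p1] := pifun_lt1 x th.
rewrite /Hfun /Hpoly /ell /= -/(pi x th) !mul0r !add0r subr0 mul1r.
rewrite [2 * ln _]mulr_natl mulr2n expRD lnK ?posrE ?subr_gt0//.
by ring.
Qed.

Lemma ell_missing y y' x : ell nu f rr y x 0 = ell (m := m) nu f rr y' x 0.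
Proof. by apply/funext => th; rewrite /ell !mul0r. Qed.

Variable U : set 'rV[R]_D.
Hypotheses (sf : sigma_finite setT nu)
  (mrr : forall j, measurable_fun setT (fun x => rr x ord0 j)).
Hypothesis regular : forall th, U th ->
     [/\ forall x y, 0 <= f (xi th) x y,
         measurable_fun setT (fun z : k.-tuple R * R => f (xi th) z.1 z.2),
         forall x, (\int[nu]_y (f (xi th) x y)%:E = 1)%E &
         forall x, (\int[nu]_y ((expR (gamma th * y) * f (xi th) x y)%R%:E) < +oo)%E].

Lemma measurable_cfun th : U th -> measurable_fun setT (fun x => cfun nu f x th).
Proof.
move=> /regular[f0 mf _ fin]; rewrite /cfun.
apply: measurableT_comp; first exact: measurable_ln.
pose F (z : k.-tuple R * R) := (expR (gamma th * z.2) * f (xi th) z.1 z.2)%:E.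
have F0 z : (0 <= F z)%E by rewrite lee_fin mulr_ge0// expR_ge0.
have mF : measurable_fun setT F.
  apply/measurable_EFinP; apply: measurable_funM => //.
  apply: measurableT_comp; first exact: measurable_expR.
  by apply: measurable_funM => //; exact: measurable_snd.
have := measurable_parametric_integral sf mF F0.
move=> h; apply/measurable_EFinP; apply: eq_measurable_fun h => x _ /=.
by rewrite fineK// ge0_fin_numE ?fin// integral_ge0// => y _; exact: F0 (x, y).
Qed.

Lemma measurable_pifun th : U th -> measurable_fun setT (fun x => pi x th).
Proof.
move=> Uth.
(* The inverse is written as exp(- ln) and the matrix product as a sum, so that measurability
   follows by composition. *)
have -> : (fun x => pi x th) = (fun x => expR (- ln (1 + expR (alpha th +
    (\sum_j beta th ord0 j * rr x ord0 j) + cfun nu f x th)))).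
  apply/funext => x; rewrite expRN lnK ?posrE ?addr_gt0 ?expR_gt0// /pi /pifun.
  suff -> : (beta th *m (rr x)^T) ord0 ord0 = \sum_j beta th ord0 j * rr x ord0 j.
    by [].
  by rewrite mxE; apply: eq_bigr => j _; rewrite [_^T _ _]mxE.
apply: measurableT_comp; first exact: measurable_expR.
apply: measurableT_comp; first exact: oppr_measurable.
apply: measurableT_comp; first exact: measurable_ln.
apply: measurable_funD => //.
apply: measurableT_comp; first exact: measurable_expR.
apply: measurable_funD; last exact: measurable_cfun.
apply: measurable_funD => //.
by apply: measurable_sum => j; exact: measurable_funM.
Qed.

Let measurable_response :
  measurable_fun setT (fun s : R * R * k.-tuple R => (s.1.2 == 1)%:R : R).
Proof.
have -> : (fun s : R * R * k.-tuple R => (s.1.2 == 1)%:R : R) =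
    (fun s => \1_[set 1] s.1.2).
  by apply/funext => s; rewrite indicE; congr (nat_of_bool _)%:R; apply/idP/idP => [/eqP ->|];
    rewrite inE// => ->.
apply: (measurableT_comp (measurable_indic _)); first exact: measurable_set1.
by apply: measurableT_comp; [exact: measurable_snd|exact: measurable_fst].
Qed.

Let measurable_pifun2 th : U th ->
  measurable_fun setT (fun s : R * R * k.-tuple R => pi s.2 th).
Proof.
by move=> Uth; apply: (measurableT_comp (measurable_pifun Uth)); exact: measurable_snd.
Qed.

Lemma measurable_Hfun th : U th -> measurable_fun setT
  (fun s : R * R * k.-tuple R => Hfun nu f rr s.2 (s.1.2 == 1)%:R th).
Proof.
move=> Uth; have mr := measurable_response; have mpi := measurable_pifun2 Uth.
rewrite /Hfun; apply: measurable_funB; last first.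
  by apply: measurable_funM => //; exact: measurable_funB.
by apply: measurable_funX; exact: measurable_funB.
Qed.

Lemma measurable_ell th : U th -> measurable_fun setT
  (fun s : R * R * k.-tuple R => ell nu f rr s.1.1 s.2 (s.1.2 == 1)%:R th).
Proof.
move=> Uth; have [_ mf _ _] := regular Uth;
have mr := measurable_response; have mpi := measurable_pifun2 Uth.
rewrite /ell; apply: measurable_funD; first apply: measurable_funD.
- apply: measurable_funM => //; apply: measurableT_comp; first exact: measurable_ln.
  apply: (measurableT_comp mf (g := fun s : R * R * k.-tuple R => (s.2, s.1.1))).
  apply/measurable_fun_pairP; split; first exact: measurable_snd.
  exact: (measurableT_comp measurable_fst measurable_fst).
- by apply: measurable_funM => //; apply: measurableT_comp mpi; exact: measurable_ln.
- apply: measurable_funM; first exact: measurable_funB.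
  apply: measurableT_comp; first exact: measurable_ln.
  exact: measurable_funB.
Qed.

End propensity_model.

(** * Smoothness of [H]; integrability and domination of the log-likelihood *)

Lemma derivable_pd_comp {R : realType} {D : nat} (g : 'rV[R]_D -> R) (phi phi1 phi2 : R -> R)
  (U : set 'rV[R]_D) a k j : open U -> U a ->
  (forall x : R, is_derive x 1 phi (phi1 x)) ->
  (forall x : R, is_derive x 1 phi1 (phi2 x)) ->
  (forall q i, U q -> derivable g q (delta_mx 0 i)) ->
  derivable (pd k g) a (delta_mx 0 j) ->
  derivable (pd k (phi \o g)) a (delta_mx 0 j).
Proof.
move=> oU Ua d1 d2 dg ddg.
have [h _] := pd_mul (pd_comp (dg a j Ua) d2).1 ddg.
apply: near_eq_derivable h; apply: filterS (open_nbhs_nbhs (conj oU Ua)) => q Uq.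
by rewrite (pd_comp (dg q k Uq) d1).2.
Qed.

Lemma is_derive_continuous {R : realType} (phi : R -> R) (x df : R) :
  is_derive x 1 phi df -> {for x, continuous phi}.
Proof. by case=> /derivable1_diffP/differentiable_continuous. Qed.

Lemma Hfun_regular {R : realType} {k m p : nat} (nu : {measure set R -> \bar R})
  (f : 'rV[R]_p -> k.-tuple R -> R -> R) (rr : k.-tuple R -> 'rV[R]_m)
  (U : set 'rV[R]_(m + p).+2) x r a :
  open U -> C3_on U (ell nu f rr 0 x 0) -> U a ->
  [/\ forall i, derivable (Hfun nu f rr x r) a (delta_mx 0 i),
      forall i j, derivable (pd i (Hfun nu f rr x r)) a (delta_mx 0 j) &
      {for a, continuous (Hfun nu f rr x r)}].
Proof.
move=> oU l3 Ua; rewrite HfunE.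
have d1 (y : R) : is_derive y 1 (Hpoly r)
  (0 + (2 * r - 3) * expR y + 2 * 2 * expR (2 * y)) by exact: is_derive_Hpoly.
have d2 (y : R) := is_derive_Hpoly (0 : R) (2 * r - 3) (2 * 2) y.
have dl q i : U q -> derivable (ell nu f rr 0 x 0) q (delta_mx 0 i).
  by move=> Uq; case: (l3 i i i q Uq) => h _ _ _; exact: h.
split => [i|i j|].
- exact: (pd_comp (dl a i Ua) d1).1.
- apply: (@derivable_pd_comp _ _ _ _ _ _ U a i j oU Ua d1 d2 dl).
  by case: (l3 i j j a Ua) => _ h _ _; exact: h.
- apply: (@continuous_comp _ _ _ (ell nu f rr 0 x 0) (Hpoly r)).
    by have [_ _ h] := C3_on_continuous oU l3 Ua; exact: h.
  exact: is_derive_continuous (d1 _).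
Qed.

(** The positive part is dominated by [b], so an integral above minus infinity leaves a finite
    integral for the negative part. *)
Lemma L1_of_integral_gtNy {d} {T : measurableType d} {R : realType} (P : probability T R)
  (X b : T -> R) : measurable_fun setT X -> L1 P b -> (forall w, X w <= b w) ->
  (-oo < \int[P]_w (X w)%:E)%E -> L1 P X.
Proof.
move=> mX lb Xb; have mX' : measurable_fun setT (EFin \o X) by exact/measurable_EFinP.
have pos : (\int[P]_w ((EFin \o X)^\+ w) < +oo)%E.
  have /integrableP[mb] := lb; apply: le_lt_trans.
  apply: ge0_le_integral => //.
  - exact: measurable_funepos.
  - exact: measurableT_comp.
  - move=> w _; rewrite funeposE /= -EFin_max lee_fin ge_max normr_ge0 andbT.
    exact: le_trans (Xb w) (ler_norm _).
rewrite integralE => neg; apply/integrableP; split => //.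
rewrite (_ : (fun w => _) = ((EFin \o X)^\+ \+ (EFin \o X)^\-)%E); last by rewrite -fune_abse.
rewrite ge0_integralD//; [|exact: measurable_funepos|exact: measurable_funeneg].
rewrite lte_add_pinfty// ltey; apply/eqP => h; move: neg; rewrite -/(EFin \o X) h.
by case: (integral _ _ _) pos => [r| |].
Qed.

(** The dominating function is ln (1 + sup L), which is nonnegative and at least l = ln L on the
    ball; [measurable_supremum] makes the uncountable supremum measurable. *)
Lemma log1p_domination {d d1} {T : measurableType d} {S : measurableType d1} {R : realType}
  {n : nat} (P : probability T R) (O0 : T -> S) (l : S -> 'rV[R]_n -> R)
  (K : set 'rV[R]_n) th rho :
  measurable_fun setT O0 -> compact K ->
  (forall q, K q -> measurable_fun setT (l ^~ q)) ->
  (forall s q, K q -> {for q, continuous (l s)}) ->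
  K th -> 0 < rho ->
  (\int[P]_w log1p_e (ereal_sup [set (expR (l (O0 w) th'))%:E
     | th' in [set th' | K th' /\ (`|th' - th| < rho)%R]]) < +oo)%E ->
  exists b, [/\ L1 P b, forall w, 0 <= b w &
    forall w th', K th' -> `|th' - th| < rho -> l (O0 w) th' <= b w].
Proof.
move=> mO0 cK ml cl Kth rho0 fin.
pose A := [set th' | K th' /\ `|th' - th| < rho].
have Ath : A th by split => //; rewrite subrr normr0.
pose L s q := expR (l s q).
have cL s q : K q -> {for q, continuous (L s)}.
  move=> Kq; apply: (@continuous_comp _ _ _ (l s) expR); first exact: cl.
  exact: continuous_expR.
have [||||phi [mphi Aphi phic]] := @measurable_supremum _ S R n L A.
- by exists th.
- by move=> q [Kq _]; apply: measurableT_comp; [exact: measurable_expR|exact: ml].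
- by move=> s q [Kq _]; exact: cL.
- move=> s; have [c Hc] := compact_bounded_above cK (@cL s).
  by exists c => q [Kq _]; exact: Hc.
have phi0 s : 0 < phi s by apply: lt_le_trans (Aphi s th Ath); exact: expR_gt0.
have supE s : ereal_sup [set (L s q)%:E | q in A] = (phi s)%:E.
  apply/eqP; rewrite eq_le; apply/andP; split.
    by apply: ge_ereal_sup => _ [q Aq <-]; rewrite lee_fin; exact: Aphi.
  set e := ereal_sup _; have Le q : A q -> ((L s q)%:E <= e)%E.
    by move=> Aq; apply: ereal_sup_ubound; exists q.
  case: e Le => [r Lr||Lr]; [|by rewrite leey|by have := Lr th Ath].
  by rewrite lee_fin; apply: phic => q Aq; rewrite -lee_fin; exact: Lr.
pose b w := ln (1 + phi (O0 w)).
have b0 w : 0 <= b w by apply: ln_ge0; rewrite lerDl ltW.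
have mb : measurable_fun setT b.
  apply: measurableT_comp; first exact: measurable_ln.
  by apply: measurable_funD => //; exact: measurableT_comp.
exists b; split => //.
  apply/integrableP; split; first exact/measurable_EFinP.
  apply: le_lt_trans fin; rewrite le_eqVlt; apply/orP; left; apply/eqP.
  by apply: eq_integral => w _; rewrite (supE (O0 w))/= ger0_norm.
move=> w q Kq qr; rewrite -[l _ q]expRK ler_ln ?posrE ?expR_gt0 ?addr_gt0//.
by apply: le_trans (Aphi _ q (conj Kq qr)) _; rewrite lerDr.
Qed.

Theorem theorem1
  (R : realType) (d0 : measure_display) (T : measurableType d0)
  (P : probability T R) (k m p : nat)
  (* dominating measure for Y (counting for discrete Y, Lebesgue for continuous Y) *)
  (nu : {measure set R -> \bar R})
  (* the parametric family f(y | x; xi) and the known function r(x) *)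
  (f : 'rV[R]_p -> k.-tuple R -> R -> R) (rr : k.-tuple R -> 'rV[R]_m)
  (* generic full-data variables (Y, R, X) and the sample (Y_i, R_i, X_i) *)
  (Y0 R0 : T -> R) (X0 : T -> k.-tuple R)
  (Ys Rs : nat -> T -> R) (Xs : nat -> T -> k.-tuple R)
  (* parameter space, an open set on which the model is regular, theta*, MLE *)
  (Theta U : set 'rV[R]_(m + p).+2) (thetastar : 'rV[R]_(m + p).+2)
  (thetahat : nat -> T -> 'rV[R]_(m + p).+2)
  (* true likelihood contribution of (RY, R) given X = x *)
  (Lt : R -> k.-tuple R -> R -> R) :
  (* ---------- data ---------- *)
  (forall w, R0 w = 0 \/ R0 w = 1) ->
  (forall i w, Rs i w = 0 \/ Rs i w = 1) ->
  measurable_fun setT Y0 ->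
  iid_copies P (fun i w => (Rs i w * Ys i w, Rs i w, Xs i w))
               (fun w => (R0 w * Y0 w, R0 w, X0 w)) ->
  (* ---------- the model ---------- *)
  sigma_finite setT nu ->
  (forall j, measurable_fun setT (fun x => rr x ord0 j)) ->
  (forall th, U th ->
     [/\ forall x y, 0 <= f (xi th) x y,
         measurable_fun setT (fun z : k.-tuple R * R => f (xi th) z.1 z.2),
         forall x, (\int[nu]_y (f (xi th) x y)%:E = 1)%E &
         forall x, (\int[nu]_y ((expR (gamma th * y) * f (xi th) x y)%R%:E) < +oo)%E]) ->
  (* ---------- the true likelihood contribution L_t ---------- *)
  (forall y x r, 0 <= Lt y x r) ->
  (forall y x, Lt y x 0 = Lt 0 x 0) ->
  (forall A B, measurable A -> measurable B ->
     P [set w | R0 w = 1 /\ Y0 w \in A /\ X0 w \in B] =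
     (\int[P]_w ((\1_B (X0 w))%:E * \int[nu]_(y in A) (Lt y (X0 w) 1)%:E))%E) ->
  (forall B, measurable B ->
     P [set w | R0 w = 0 /\ X0 w \in B] =
     (\int[P]_w ((\1_B (X0 w) * Lt 0 (X0 w) 0)%R%:E))%E) ->
  (* ---------- Assumption 1: an instrumental variable X_j0 ---------- *)
  (exists j0 : 'I_k,
     (exists g : R -> k.-tuple R -> R,
        [/\ measurable_fun setT (fun z : R * k.-tuple R => g z.1 z.2),
            (forall y x x', (forall j, j != j0 -> tnth x j = tnth x' j) ->
                            g y x = g y x') &
            forall C, measurable C ->
              P [set w | R0 w = 1 /\ (Y0 w, X0 w) \in C] =
              (\int[P]_w ((\1_C (Y0 w, X0 w) * g (Y0 w) (X0 w))%R%:E))%E]) /\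
     ~ (exists q : k.-tuple R -> set R -> R,
        [/\ forall A, measurable A -> measurable_fun setT (fun x => q x A),
            (forall x x' A, (forall j, j != j0 -> tnth x j = tnth x' j) ->
                            q x A = q x' A) &
            forall A B, measurable A -> measurable B ->
              P [set w | Y0 w \in A /\ X0 w \in B] =
              (\int[P]_w ((\1_B (X0 w) * q (X0 w) A)%R%:E))%E])) ->
  (* ---------- Assumption 2: correctly specified f for Y | X, R = 1 ---------- *)
  (exists xi0 : 'rV[R]_p,
     forall A B, measurable A -> measurable B ->
       P [set w | R0 w = 1 /\ Y0 w \in A /\ X0 w \in B] =
       (\int[P]_w ((\1_B (X0 w) * \1_[set 1%R] (R0 w))%R%:E *
                   \int[nu]_(y in A) (f xi0 (X0 w) y)%:E))%E) ->
  (* ---------- the estimator: a measurable maximizer of ell_n over Theta ---------- *)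
  (forall n w, Theta (thetahat n w) /\
     forall th, Theta th ->
       elln nu f rr Ys Rs Xs n w th <= elln nu f rr Ys Rs Xs n w (thetahat n w)) ->
  (forall n j, measurable_fun setT (fun w => thetahat n w ord0 j)) ->
  (* ---------- Condition 1 ---------- *)
  Theta thetastar ->
  (forall th, Theta th -> th != thetastar ->
     (Eell nu f rr P Y0 R0 X0 th < Eell nu f rr P Y0 R0 X0 thetastar)%E) ->
  (* ---------- Condition 2 ---------- *)
  compact Theta -> (Theta°) thetastar ->
  (* ---------- Condition 3 ---------- *)
  open U -> Theta `<=` U ->
  (forall y x r, r = 0 \/ r = 1 -> C3_on U (ell nu f rr y x r)) ->
  (* ---------- Condition 4 ---------- *)
  P.-integrable setT
    (fun w => (ln (Lt (R0 w * Y0 w) (X0 w) (R0 w)))%:E) ->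
  (exists rho0 : R, 0 < rho0 /\
     forall th rho, Theta th -> 0 < rho < rho0 ->
       (\int[P]_w log1p_e (ereal_sup
           [set (Lik nu f rr (R0 w * Y0 w)%R (X0 w) (R0 w) th')%:E
              | th' in [set th' | Theta th' /\ (`|th' - th| < rho)%R]]) < +oo)%E) ->
  (* ---------- Condition 5 (with the existence of J and Sigma) ---------- *)
  (forall i j, P.-integrable setT (fun w =>
     (pd i (pd j (ell nu f rr (R0 w * Y0 w) (X0 w) (R0 w))) thetastar)%:E)) ->
  (forall a, P.-integrable setT (fun w =>
     ((Zw nu f rr Y0 R0 X0 thetastar a w) ^+ 2)%:E)) ->
  Jmat nu f rr P Y0 R0 X0 thetastar \in unitmx ->
  (forall v : 'rV[R]_(1 + (m + p).+2), v != 0 ->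
     0 < (v *m Sigmat nu f rr P Y0 R0 X0 thetastar *m v^T) ord0 ord0) ->
  (* ---------- Condition 6 ---------- *)
  (forall j, P.-integrable setT (fun w =>
     (pd j (Hfun nu f rr (X0 w) (R0 w)) thetastar)%:E)) ->
  (* ---------- Condition 7 ---------- *)
  (exists (eps : R) (M : R -> k.-tuple R -> R -> R),
     [/\ 0 < eps,
         P.-integrable setT (fun w => (M (Y0 w) (X0 w) (R0 w))%:E) &
         forall (i j l : 'I_(m + p).+2) y x r th, r = 0 \/ r = 1 ->
           `|th - thetastar| <= eps ->
           `|pd l (pd j (pd i (ell nu f rr y x r))) th| <= M y x r /\
           `|pd j (pd i (Hfun nu f rr x r)) th| <= M y x r]) ->
  (* ---------- conclusion ---------- *)
  cvg_in_dist_normal P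
    (fun n w => Tstat nu f rr Rs Xs thetahat n w
                - Num.sqrt n%:R * Delta nu f rr P R0 X0 thetastar)
    (sigma2 nu f rr P Y0 R0 X0 thetastar).
Proof.
move=> R01 Rs01 mY iid sf mrr regular _ _ _ _ _ _ mle mth Tths ident cTheta Tint oU TU
  l3 _ [rho0 [rho00 cond4]] ldd lZ2 Ju Spos ldH [eps [M [eps0 lM bd]]].
(* Replacing r by [r = 1] makes both functions regular on the whole sample space. *)
pose l (s : R * R * k.-tuple R) : 'rV[R]_(m + p).+2 -> R :=
  ell nu f rr s.1.1 s.2 (s.1.2 == 1)%:R.
pose H (s : R * R * k.-tuple R) : 'rV[R]_(m + p).+2 -> R :=
  Hfun nu f rr s.2 (s.1.2 == 1)%:R.
have ind r : r = 0 \/ r = 1 -> ((r : R) == 1)%:R = r.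
  by case=> ->; rewrite ?eqxx// eq_sym oner_eq0.
have rcase s : ((s == 1 :> R)%:R : R) = 0 \/ ((s == 1 :> R)%:R : R) = 1.
  by case: (s == 1); [right|left].
have lO w : l (R0 w * Y0 w, R0 w, X0 w) = ell nu f rr (R0 w * Y0 w) (X0 w) (R0 w).
  by rewrite /l /= (ind _ (R01 w)).
have HO w : H (R0 w * Y0 w, R0 w, X0 w) = Hfun nu f rr (X0 w) (R0 w).
  by rewrite /H /= (ind _ (R01 w)).
have lOi i w : l (Rs i w * Ys i w, Rs i w, Xs i w) =
    ell nu f rr (Rs i w * Ys i w) (Xs i w) (Rs i w).
  by rewrite /l /= (ind _ (Rs01 i w)).
have HOi i w : H (Rs i w * Ys i w, Rs i w, Xs i w) = Hfun nu f rr (Xs i w) (Rs i w).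
  by rewrite /H /= (ind _ (Rs01 i w)).
(* M is integrable along Y0, whereas the sample contains R0 * Y0. *)
have lY w : l (R0 w * Y0 w, R0 w, X0 w) = ell nu f rr (Y0 w) (X0 w) (R0 w).
  rewrite lO; case: (R01 w) => ->; last by rewrite mul1r.
  exact: ell_missing.
have ml q : U q -> measurable_fun setT (l ^~ q) by move=> Uq; exact: (measurable_ell sf mrr regular Uq).
have mH q : U q -> measurable_fun setT (H ^~ q) by move=> Uq; exact: (measurable_Hfun sf mrr regular Uq).
have l3' s : C3_on U (l s) by apply: l3.
have Hreg s q : U q -> [/\ forall i, derivable (H s) q (delta_mx 0 i),
    forall i j, derivable (pd i (H s)) q (delta_mx 0 j) & {for q, continuous (H s)}].
  by move=> Uq; apply: (Hfun_regular (U := U)) Uq => //; apply: l3; left.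
have cl s q : U q -> {for q, continuous (l s)}.
  by move=> Uq; have [_ _ h] := C3_on_continuous oU (l3' s) Uq; exact: h.
have mO0 := iid_copies_measurable0 iid.
have dom th : Theta th -> exists rho b, [/\ 0 < rho, L1 P b, forall w, 0 <= b w &
    forall w th', Theta th' -> `|th' - th| < rho ->
      l (R0 w * Y0 w, R0 w, X0 w) th' <= b w].
  move=> Tth; have r2 : 0 < rho0 / 2 < rho0.
    by rewrite divr_gt0//= ltr_pdivrMr// ltr_pMr// ltr1n.
  have := cond4 th _ Tth r2; case/andP: r2 => r20 _.
  under eq_integral => w _ do rewrite /Lik -lO.
  move=> /(log1p_domination mO0 cTheta (fun q Tq => ml q (TU q Tq))
    (fun s q Tq => cl s q (TU q Tq)) Tth r20)[b [lb b0 Hb]].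
  by exists (rho0 / 2), b; split.
have D0 : (0 < (m + p).+2)%N by [].
have Uths := TU _ Tths.
have EellE th : Eell nu f rr P Y0 R0 X0 th =
    (\int[P]_w (l (R0 w * Y0 w, R0 w, X0 w) th)%:E)%E.
  by apply: eq_integral => w _; rewrite lO.
have ident' th : Theta th -> th != thetastar ->
    (\int[P]_w (l (R0 w * Y0 w, R0 w, X0 w) th)%:E <
     \int[P]_w (l (R0 w * Y0 w, R0 w, X0 w) thetastar)%:E)%E.
  by move=> Tth tn; have := ident th Tth tn; rewrite (EellE th) (EellE thetastar).
have lths : L1 P (fun w => l (R0 w * Y0 w, R0 w, X0 w) thetastar).
  have [rho [b [rho1 lb _ Hb]]] := dom _ Tths.
  apply: (L1_of_integral_gtNy _ lb).
  - exact: (measurableT_comp (ml _ Uths) mO0).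
  - by move=> w; apply: Hb => //; rewrite subrr normr0.
  (* As theta* is interior and the dimension positive, [Theta] contains another point [q]. Its mean
     log-likelihood is strictly smaller, so that of theta* exceeds minus infinity. *)
  - have /nbhs_ballP[r /= r0 Hr] := Tint.
    pose q := (r / 2) *: delta_mx 0 (Ordinal D0) + thetastar.
    have qr : `|q - thetastar| = r / 2 by rewrite addrK norm_delta_le gtr0_norm ?divr_gt0.
    apply: (@le_lt_trans _ _ (\int[P]_w (l (R0 w * Y0 w, R0 w, X0 w) q)%:E)%E).
      exact: leNye.
    apply: ident'.
      by apply: Hr; rewrite -ball_normE /= distrC qr ltr_pdivrMr// ltr_pMr// ltr1n.
    by rewrite -subr_eq0 -normr_gt0 qr divr_gt0.
have bdK s : exists K, forall i j k0 q, `|q - thetastar| <= eps ->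
      `|pd k0 (pd j (pd i (l s))) q| <= K /\ `|pd j (pd i (H s)) q| <= K.
  by exists (M s.1.1 s.2 (s.1.2 == 1)%:R) => i j k0 q qe; apply: bd.
have bdM w i j k0 q : `|q - thetastar| <= eps ->
    `|pd k0 (pd j (pd i (l (R0 w * Y0 w, R0 w, X0 w)))) q| <= M (Y0 w) (X0 w) (R0 w) /\
    `|pd j (pd i (H (R0 w * Y0 w, R0 w, X0 w))) q| <= M (Y0 w) (X0 w) (R0 w).
  by move=> qe; rewrite lY HO; apply: bd.
have thhT n w : Theta (thetahat n w) by case: (mle n w).
have thh_max n w th : Theta th ->
    \sum_(i < n) l (Rs i w * Ys i w, Rs i w, Xs i w) th <=
    \sum_(i < n) l (Rs i w * Ys i w, Rs i w, Xs i w) (thetahat n w).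
  have E q : elln nu f rr Ys Rs Xs n w q =
      \sum_(i < n) l (Rs i w * Ys i w, Rs i w, Xs i w) q.
    by apply: eq_bigr => i _; rewrite lOi.
  by move=> Tth; have [_ /(_ th Tth)] := mle n w; rewrite (E th) (E (thetahat n w)).
have lH2 : L1 P (fun w => H (R0 w * Y0 w, R0 w, X0 w) thetastar ^+ 2).
  have := lZ2 (lshift _ ord0); congr (_.-integrable _ _); apply/funext => w.
  by rewrite /= HO /Zw /Zvec row_mxEl mxE.
have lpsi2 j : L1 P (fun w => pd j (l (R0 w * Y0 w, R0 w, X0 w)) thetastar ^+ 2).
  have := lZ2 (rshift _ j); congr (_.-integrable _ _); apply/funext => w.
  by rewrite /= lO /Zw /Zvec row_mxEr mxE.
have ldH' j : L1 P (fun w => pd j (H (R0 w * Y0 w, R0 w, X0 w)) thetastar).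
  by have := ldH j; congr (_.-integrable _ _); apply/funext => w; rewrite /= HO.
have ddE i j : (fun w => pd i (pd j (l (R0 w * Y0 w, R0 w, X0 w))) thetastar) =
    (fun w => pd i (pd j (ell nu f rr (R0 w * Y0 w) (X0 w) (R0 w))) thetastar).
  by apply/funext => w; rewrite lO.
have ldd' i j : L1 P (fun w => pd i (pd j (l (R0 w * Y0 w, R0 w, X0 w))) thetastar).
  by rewrite ddE; exact: ldd i j.
have JE i j : Jmat nu f rr P Y0 R0 X0 thetastar i j =
    - Ex P (fun w => pd i (pd j (l (R0 w * Y0 w, R0 w, X0 w))) thetastar).
  by rewrite ddE mxE.
have hvE j : hvec nu f rr P R0 X0 thetastar ord0 j =
    Ex P (fun w => pd j (H (R0 w * Y0 w, R0 w, X0 w)) thetastar).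
  rewrite mxE; suff -> : (fun w => pd j (H (R0 w * Y0 w, R0 w, X0 w)) thetastar) =
    (fun w => pd j (Hfun nu f rr (X0 w) (R0 w)) thetastar) by [].
  by apply/funext => w; rewrite HO.
have zE a w : Zw nu f rr Y0 R0 X0 thetastar a w =
    row_mx (\row_(_ < 1) H (R0 w * Y0 w, R0 w, X0 w) thetastar)
      (\row_j pd j (l (R0 w * Y0 w, R0 w, X0 w)) thetastar) ord0 a.
  by rewrite HO lO.
have main := @smooth_m_estimation_clt _ _ _ _ R P _ _ iid _ D0 l H Theta U thetastar
  thetahat eps (fun w => M (Y0 w) (X0 w) (R0 w)) oU TU cTheta Tint ml mH l3'
  (fun s q i Uq => let: And3 h _ _ := Hreg s q Uq in h i)
  (fun s q i j Uq => let: And3 _ h _ := Hreg s q Uq in h i j)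
  (fun s q Uq => let: And3 _ _ h := Hreg s q Uq in h)
  eps0 bdK lM bdM dom lths ident' thhT thh_max mth lH2 lpsi2 ldH' ldd' _ _ Ju JE hvE
  (Zw nu f rr Y0 R0 X0 thetastar) zE Spos.
have SE : statistic P (fun i w => (Rs i w * Ys i w, Rs i w, Xs i w))
      (fun w => (R0 w * Y0 w, R0 w, X0 w)) H thetastar thetahat =
    (fun n w => Tstat nu f rr Rs Xs thetahat n w
                - Num.sqrt n%:R * Delta nu f rr P R0 X0 thetastar).
  have DE : Ex P (fun w => H (R0 w * Y0 w, R0 w, X0 w) thetastar) =
      Delta nu f rr P R0 X0 thetastar by apply: eq_Ex => w; rewrite HO.
  apply/funext => n; apply/funext => w; rewrite /statistic DE /Tstat.
  by congr (_ * _ - _); apply: eq_bigr => i _; rewrite HOi.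
rewrite -SE; exact: main.
Qed.
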